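(* Let $k \geq 1$, let $X$ be a process satisfying general self-similarity with $\mathcal{C}^k$ invariance components on $I$, an open interval of $\mathbb{R}$, and let $((f_y,c_y),\ y \in I)$ be a family of $\mathcal{C}^k$ good invariance components for $X$, relatively to some reference point $y_0 \in I$. Assume that either Assumption 1 or Assumption 2 is satisfied for $E=I$. Let $g : I \to \mathbb{R}$ and $\alpha \in \mathbb{R}$ be defined via $$\forall y \in I,\quad g(y) := \int_{y_0}^y \frac{1}{f_z'(y_0)}\, dz, \qquad \alpha := -\log(c_{g^{-1}(1)}),$$ where $f_z'$ denotes the derivative of the function $f_z : I \to I$. Then $g$ and $\alpha$ are well-defined, $g$ is a $\mathcal{C}^k$-diffeomorphism from $I$ to $\mathbb{R}$, and there is a real Lévy process $\xi$ such that, setting $$\forall t \in [0,+\infty],\quad \varphi(t) := \int_0^t e^{\alpha\xi(s)}\, ds,$$ we have $$\zeta(X_{y_0}) = \varphi(+\infty) = \int_0^{+\infty} e^{\alpha\xi(s)}\, ds \quad\text{and}\quad \forall\, 0 \leq t < \varphi(+\infty),\ X_{y_0}(t) = g^{-1}\left(\xi(\varphi^{-1}(t))\right).$$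
   Context: Processes and life-time. Let $E$ be a locally compact separable metric space. A strongly Markovian càdlàg process $X$ on $E$ is given through the processes $X_y$ ($y\in E$), $X_y$ being $X$ started from $y$; $P_y$ is the law of $X_y$. The process $X_y$ may have a finite life-time $\zeta(X_y)\in(0,+\infty]$, namely the time at which every compact subset of $E$ containing $y$ has been left by $X_y$ (the limit of the first exit times from an increasing sequence of compact sets such that every compact subset of $E$ is contained in one of them). If $\mathbb{P}(\zeta(X_y)<+\infty)>0$ one adds a cemetery point $\Delta$ to $E$, whose neighborhoods are the sets $K^c\cup\{\Delta\}$, $K\subset E$ compact, and puts $X_y(t)=\Delta$ for $t\ge \zeta(X_y)$. There is no instantaneous killing: $\Delta$ is absorbing and can only be reached continuously. A homeomorphism $f$ of $E$ is extended to $E\cup\{\Delta\}$ by $f(\Delta)=\Delta$. General self-similarity. $X$ satisfies general self-similarity on $E$ if for some point $y_0\in E$, $$\forall y\in E,\ (X_y(t),\ t\ge 0)\overset{\mathcal L}{=}(f_y(X_{y_0}(c_y t)),\ t\ge 0),$$ where $(f_y,\ y\in E)$ is a family of homeomorphisms of $E$ such that $(y,x)\mapsto f_y(x)$ and $(y,x)\mapsto f_y^{-1}(x)$ are continuous from $E\times E$ to $E$, and $(c_y,\ y\in E)$ is a family of positive constants with $y\mapsto c_y$ continuous. Then $((f_y,c_y),\ y\in E)$ is called a family of invariance components for $X$ relatively to the reference point $y_0$. $\mathcal{C}^k$ invariance components. If $E$ is a $\mathcal{C}^k$-differentiable manifold, invariance components are called $\mathcal{C}^k$ if $(y,x)\mapsto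 f_y(x)$, $(y,x)\mapsto f_y^{-1}(x)$ and $y\mapsto c_y$ are of class $\mathcal{C}^k$. An open interval of $\mathbb{R}$ carries its usual differential structure. Good invariance components. Invariance components $((f_y,c_y),\ y\in E)$ relatively to $y_0$ are called good if $f_{y_0}=id_E$, $c_{y_0}=1$, and $c_{f_y(z)}=c_y\times c_z$ for all $y,z\in E$. Support and assumptions. $Supp(X_y):=\overline{\bigcup_{t\ge0}Supp(X_y(t))}=\{z\in E:\ \forall\epsilon>0,\ \exists t\ge0,\ \mathbb{P}(X_y(t)\in B(z,\epsilon))>0\}$. Assumption 1: $E=Supp(X_{y_0})$. Assumption 2: there exists $y\in E$ such that $y$ belongs to the interior of $Supp(X_y)$. Lévy processes start from $0$. $\varphi^{-1}$ denotes the inverse of the increasing bijection $\varphi:[0,+\infty[\to[0,\varphi(+\infty)[$. *)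

(* Defs.v *)
From mathcomp Require Import all_boot all_order all_algebra.
From mathcomp Require Import all_classical all_reals all_analysis.
From mathcomp Require Import measurable_realfun.
Set Implicit Arguments.
Unset Strict Implicit.
Unset Printing Implicit Defensive.
Import Order.TTheory GRing.Theory Num.Theory.
Import numFieldNormedType.Exports.
Local Open Scope classical_set_scope.
Local Open Scope ring_scope.

(* The state space is E = I, an open interval of R, with a cemetery point.
   Points of E are written [Some x] with [I x], the cemetery is [None].
   Functions on E are functions on R whose values off I are never used; their
   inverses on I are given by [pinv I]. *)

(* Neighbourhoods in E with the cemetery: those of [Some x] are the usual ones
   (I is open), those of [None] are the K^c with K a compact subset of I. *)
Definition nbhs_state (R : realType) (I : set R) (o : option R) :
    set (set (option R)) :=
  match o with
  | Some x => Some @ nbhs x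
  | None => [set A | exists K : set R,
               [/\ compact K, K `<=` I & ~` (Some @` K) `<=` A]]
  end.

Definition borel_state (R : realType) (B : set (option R)) : Prop :=
  measurable (Some @^-1` B).

Definition exit_time (R : realType) (x : R -> option R) (K : set R) : \bar R :=
  ereal_inf [set t%:E | t in [set t | 0 <= t /\ ~ (Some @` K) (x t)]].

(* Exit times are monotone in K, so that the limit along an exhausting sequence
   of compact subsets of I is the supremum over all compact subsets of I. *)
Definition lifetime (R : realType) (I : set R) (x : R -> option R) : \bar R :=
  ereal_sup [set exit_time x K | K in [set K | compact K /\ K `<=` I]].

(* The last field says that the cemetery can only be reached continuously; it
   excludes a jump from a point of I to [None] at the life-time. *)
Record cadlag_path (R : realType) (I : set R) (x : R -> option R) : Prop := {
  path_state : forall t r, 0 <= t -> x t = Some r -> I r ;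
  path_right_continuous : forall t, 0 <= t ->
    x @ t^'+ `=>` nbhs_state I (x t) ;
  path_left_limit : forall t, 0 < t -> exists o : option R,
    (forall r, o = Some r -> I r) /\ x @ t^'- `=>` nbhs_state I o ;
  path_lifetime : forall t, 0 <= t ->
    (x t = None <-> (lifetime I x <= t%:E)%E) ;
  path_no_killing : forall t, 0 < t -> x t = None ->
    x @ t^'- `=>` nbhs_state I None }.

Definition fdd (R : realType) (d : measure_display) (T : measurableType d)
    (P : probability T R) (Y : T -> R -> option R)
    (n : nat) (s : 'I_n -> R) (B : 'I_n -> set (option R)) : \bar R :=
  P [set w | forall i, B i (Y w (s i))].

Definition same_law (R : realType) (d1 d2 : measure_display)
    (T1 : measurableType d1) (T2 : measurableType d2)
    (P1 : probability T1 R) (P2 : probability T2 R)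
    (Y1 : T1 -> R -> option R) (Y2 : T2 -> R -> option R) : Prop :=
  forall (n : nat) (s : 'I_n -> R) (B : 'I_n -> set (option R)),
    (forall i, 0 <= s i) -> (forall i, borel_state (B i)) ->
    fdd P1 Y1 s B = fdd P2 Y2 s B.

Definition natural_filtration (R : realType) (T : Type)
    (Y : T -> R -> option R) (t : R) : set (set T) :=
  <<s [set A | exists (s : R) (B : set (option R)),
        [/\ 0 <= s, s <= t, borel_state B & A = [set w | B (Y w s)]]] >>.

Definition stopping_time (R : realType) (T : Type)
    (Y : T -> R -> option R) (tau : T -> \bar R) : Prop :=
  (forall w, (0 <= tau w)%E) /\
  (forall t, 0 <= t -> natural_filtration Y t [set w | (tau w <= t%:E)%E]).

Definition stopped_event (R : realType) (d : measure_display)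
    (T : measurableType d) (Y : T -> R -> option R) (tau : T -> \bar R)
    (A : set T) : Prop :=
  measurable A /\
  (forall t, 0 <= t ->
     natural_filtration Y t (A `&` [set w | (tau w <= t%:E)%E])).

(* [X y] is the process started from y, on its own probability space.  In the
   strong Markov property the event [tau < +oo, X_y(tau) <> cemetery] is the
   only one that matters, since the cemetery is absorbing. *)
Record strong_Markov_process (R : realType) (I : set R)
    (d : measure_display) (Omega : R -> measurableType d)
    (P : forall y, probability (Omega y) R)
    (X : forall y, Omega y -> R -> option R) : Prop := {
  process_measurable : forall y t (B : set (option R)),
    I y -> 0 <= t -> borel_state B -> measurable [set w | B (X y w t)] ;
  process_cadlag : forall y w, I y -> cadlag_path I (X y w) ;
  process_start : forall y, I y -> P y [set w | X y w 0 = Some y] = 1%E ;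
  process_kernel : forall (n : nat) (s : 'I_n -> R)
      (B : 'I_n -> set (option R)),
    (forall i, 0 <= s i) -> (forall i, borel_state (B i)) ->
    measurable_fun I (fun z => fdd (P z) (X z) s B) ;
  process_strong_Markov : forall y (tau : Omega y -> \bar R)
      (A : set (Omega y)) (n : nat) (s : 'I_n -> R)
      (B : 'I_n -> set (option R)),
    I y -> stopping_time (X y) tau -> stopped_event (X y) tau A ->
    (forall i, 0 <= s i) -> (forall i, borel_state (B i)) ->
    let D := A `&` [set w | (tau w < +oo)%E /\ X y w (fine (tau w)) <> None] in
    P y (D `&` [set w | forall i, B i (X y w (fine (tau w) + s i))]) =
    (\int[P y]_(w in D)
       if X y w (fine (tau w)) is Some z then fdd (P z) (X z) s B else 0)%E }.

Record invariance_components (R : realType) (I : set R)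
    (d : measure_display) (Omega : R -> measurableType d)
    (P : forall y, probability (Omega y) R)
    (X : forall y, Omega y -> R -> option R)
    (y0 : R) (f : R -> R -> R) (c : R -> R) : Prop := {
  inv_reference : I y0 ;
  inv_bij : forall y, I y -> set_bij I I (f y) ;
  inv_continuous : {within I `*` I, continuous (fun p : R * R => f p.1 p.2)} ;
  inv_continuousV :
    {within I `*` I, continuous (fun p : R * R => pinv I (f p.1) p.2)} ;
  inv_pos : forall y, I y -> 0 < c y ;
  inv_cst_continuous : {within I, continuous c} ;
  inv_law : forall y, I y ->
    same_law (P y) (P y0) (X y)
             (fun w t => omap (f y) (X y0 w (c y * t))) }.

(* h is of class C^k on the open set U of a finite-dimensional space V: in
   finite dimension the differential is continuous iff p |-> dh_p(v) is
   continuous for every v. *)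
Fixpoint Ck (R : realType) (V : normedModType R) (k : nat) (U : set V)
    (h : V -> R) : Prop :=
  if k is k'.+1 then
    (forall p, U p -> differentiable h p) /\
    (forall v, Ck k' U (fun p => 'd h p v))
  else forall p, U p -> {for p, continuous h}.

Definition Ck_components (R : realType) (k : nat) (I : set R)
    (f : R -> R -> R) (c : R -> R) : Prop :=
  [/\ Ck k (I `*` I) (fun p : R * R => f p.1 p.2),
      Ck k (I `*` I) (fun p : R * R => pinv I (f p.1) p.2) &
      Ck k I c].

Definition good_components (R : realType) (I : set R) (y0 : R)
    (f : R -> R -> R) (c : R -> R) : Prop :=
  [/\ forall x, I x -> f y0 x = x,
      c y0 = 1 &
      forall y z, I y -> I z -> c (f y z) = c y * c z].

Definition Supp (R : realType) (I : set R)
    (d : measure_display) (Omega : R -> measurableType d)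
    (P : forall y, probability (Omega y) R)
    (X : forall y, Omega y -> R -> option R) (y : R) : set R :=
  [set z | I z /\ forall e, 0 < e -> exists2 t, 0 <= t &
     (0 < P y [set w | (Some @` ball z e) (X y w t)])%E].

Definition assumption1 (R : realType) (I : set R)
    (d : measure_display) (Omega : R -> measurableType d)
    (P : forall y, probability (Omega y) R)
    (X : forall y, Omega y -> R -> option R) (y0 : R) : Prop :=
  I = Supp I P X y0.

Definition assumption2 (R : realType) (I : set R)
    (d : measure_display) (Omega : R -> measurableType d)
    (P : forall y, probability (Omega y) R)
    (X : forall y, Omega y -> R -> option R) : Prop :=
  exists2 y, I y & interior (Supp I P X y) y.

Definition oriented_integral (R : realType) (a b : R) (h : R -> R) : R :=
  if a <= b then \int[@lebesgue_measure R]_(z in `[a, b]) h z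
  else - \int[@lebesgue_measure R]_(z in `[b, a]) h z.

Definition g_of (R : realType) (y0 : R) (f : R -> R -> R) (y : R) : R :=
  oriented_integral y0 y (fun z => (derive1 (f z) y0)^-1).

(* The inverse of f_z'(y0) is a total operation, and so is the integral: this
   is the condition under which g_of has its intended meaning on I. *)
Definition g_well_defined (R : realType) (I : set R) (y0 : R)
    (f : R -> R -> R) : Prop :=
  (forall z, I z -> derivable (f z) y0 1 /\ derive1 (f z) y0 != 0) /\
  (forall y, I y -> (@lebesgue_measure R).-integrable
     `[Num.min y0 y, Num.max y0 y] (fun z => ((derive1 (f z) y0)^-1)%:E)).

Definition Ck_diffeo_to_R (R : realType) (k : nat) (I : set R) (g : R -> R) :
    Prop :=
  [/\ set_bij I setT g, Ck k I g & Ck k setT (pinv I g)].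

Record Levy_process (R : realType) (d : measure_display) (T : measurableType d)
    (P : probability T R) (xi : T -> R -> R) : Prop := {
  Levy_measurable : forall t, 0 <= t -> measurable_fun setT (xi ^~ t) ;
  Levy_start : forall w, xi w 0 = 0 ;
  Levy_right_continuous : forall w t, 0 <= t -> xi w @ t^'+ --> xi w t ;
  Levy_left_limit : forall w t, 0 < t -> cvg (xi w @ t^'-) ;
  Levy_stationary : forall s t (B : set R), 0 <= s -> 0 <= t -> measurable B ->
    P [set w | B (xi w (s + t) - xi w s)] = P [set w | B (xi w t)] ;
  Levy_independent : forall (n : nat) (t : nat -> R) (B : nat -> set R),
    0 <= t 0%N -> {homo t : i j / (i <= j)%N >-> i <= j} ->
    (forall i, measurable (B i)) ->
    P [set w | forall i : 'I_n, B i (xi w (t i.+1) - xi w (t i))] =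
    (\prod_(i < n) P [set w | B i (xi w (t i.+1) - xi w (t i))%R])%E }.

Definition phi (R : realType) (alpha : R) (x : R -> R) (t : \bar R) : \bar R :=
  (\int[@lebesgue_measure R]_(s in [set s : R | (0 <= s)%R /\ s%:E <= t])
     (expR (alpha * x s))%:E)%E.

Definition phi_inv (R : realType) (alpha : R) (x : R -> R) : R -> R :=
  pinv [set t : R | 0 <= t] (fun t => fine (phi alpha x t%:E)).

(* Main.v *)
(* Lamperti's time change.  Good invariance components satisfy the group law
   f_y(f_x(w)) = f_(f_y(x))(w): otherwise the two sides would be separated on an open set,
   which the process charges because its support is all of I (by connectedness, under
   Assumption 2), and this contradicts the Markov property combined with
   self-similarity.  Differentiating the law at y0 makes g an isomorphism from this group
   onto (R, +), and then c_y = exp(-alpha g(y)).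
   In the coordinate g, X started from z has the law of the path started from 0,
   translated by z and run at speed exp(-alpha z).  The clock, the integral of
   exp(-alpha x) along a path x, is strictly increasing with inverse psi; psi(s) is a
   strict stopping time, and xi(s) = x(psi(s)) is merely translated by z, because the
   change of speed acts on psi alone.  So the strong Markov property at psi(s) gives xi
   independent stationary increments, up to killing.  There is no killing: at each step
   of a grid the killing probability is the same whatever the past, so xi could be
   killed while bounded on the grid, whereas the clock of a path that leaves every
   compact subset stops only after xi has become unbounded.  Finally psi has right
   derivative exp(alpha xi), so psi is the function phi of the theorem. *)
Require Import Defs.
From HB Require Import structures.
From mathcomp Require Import all_boot all_order all_algebra.
From mathcomp Require Import all_classical all_reals all_analysis.
From mathcomp Require Import measurable_realfun.
From mathcomp Require Import lra ring.
Set Implicit Arguments.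
Unset Strict Implicit.
Unset Printing Implicit Defensive.
Import Order.TTheory GRing.Theory Num.Theory.
Import numFieldNormedType.Exports.
Local Open Scope classical_set_scope.
Local Open Scope ring_scope.

(** The paths are only cadlag, so the clock and its inverse have right derivatives but in general no
    derivatives. Every change of variable (restarting, rescaling, inverting the clock) goes through
    one uniqueness statement, [right_derivative_unique]. The processes [X y] live on unrelated
    probability spaces, and their Markov property refers to natural filtrations, neither completed
    nor right-continuous. So the laws are moved to one space of killed real paths, where [Q z] is
    built for every real [z] from the law at [y0] alone: the scaling relation then holds by
    construction, and agreement with the law of [g(X_y)] is checked on finite-dimensional events.
    The stopping time is strict because the clock is continuous: whether level [s] is attained by
    time [t] is visible at [t] itself or, after death, at an earlier grid time. In the group law,
    two continuous maps are separated only locally, whereas laws are compared on half-lines; the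
    monotonicity of each [f y] bridges the gap. The killing argument shows that each survival
    probability is 0 or 1; being alive at the start excludes 0 for small times. *)

Lemma measurable_preimage d d' (T : measurableType d) (T' : measurableType d')
    (F : T -> T') A : measurable_fun setT F -> measurable A -> measurable (F @^-1` A).
Proof. by move=> mF mA; rewrite -[X in measurable X]setTI; exact: mF. Qed.

Lemma measurable_forall_ord d (T : measurableType d) n (A : 'I_n -> set T) :
  (forall i, measurable (A i)) -> measurable [set w | forall i, A i w].
Proof.
move=> mA; rewrite (_ : [set w | _] = \bigcap_(i in [set i : 'I_n | True]) A i).
  exact: fin_bigcap_measurable.
by apply/seteqP; split => w H i; [move=> _|have := H i I].
Qed.

(** * Functions determined by their right derivatives *)

Section right_derivative.
Variable R : realType.
Implicit Types (F G h : R -> R) (l t T : R).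

Definition right_continuous_at h t := forall e, 0 < e -> exists2 d, 0 < d &
  forall u, t <= u -> u < t + d -> `|h u - h t| <= e.

Definition left_continuous_at h t := forall e, 0 < e -> exists2 d, 0 < d &
  forall u, t - d < u -> u <= t -> `|h u - h t| <= e.

(** Increments replace difference quotients: [u = t] is allowed, and combining two such bounds is
    linear arithmetic. *)
Definition right_derivative F l t := forall e, 0 < e -> exists2 d, 0 < d &
  forall u, t <= u -> u < t + d -> `|F u - F t - l * (u - t)| <= e * (u - t).

Lemma right_continuous_atP h t :
  right_continuous_at h t <-> h u @[u --> t^'+] --> h t.
Proof.
split=> [H|H].
- apply/cvgrPdist_le => e e0; have [d d0 Hd] := H _ e0.
  near=> u; rewrite distrC; apply: Hd; first by near: u; exact: nbhs_right_ge.
  by near: u; apply: nbhs_right_lt; rewrite ltrDl.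
- move=> e e0; move/cvgrPdist_le : H => /(_ _ e0).
  rewrite near_withinE => -[d /= d0 Hd]; exists d => // u.
  rewrite le_eqVlt => /orP[/eqP <- _|tu ud]; first by rewrite subrr normr0 ltW.
  rewrite distrC; apply: Hd => //=; rewrite distrC ger0_norm ?subr_ge0 1?ltW//.
  by rewrite ltrBlDl.
Unshelve. all: end_near. Qed.

(** The difference [D] has right derivative 0. Let [s] be the supremum of the times up to which [D]
    has grown at most linearly with slope [e]: left continuity keeps the bound at [s], and the right
    derivative pushes it beyond [s] unless [s = T]. Then [e] tends to 0. *)
Lemma right_derivative_unique F G (l : R -> R) T : 0 <= T ->
  (forall t, 0 < t -> t <= T -> left_continuous_at F t) ->
  (forall t, 0 < t -> t <= T -> left_continuous_at G t) ->
  (forall t, 0 <= t -> t < T -> right_derivative F (l t) t) ->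
  (forall t, 0 <= t -> t < T -> right_derivative G (l t) t) ->
  F T - F 0 = G T - G 0.
Proof.
move=> T0 lF lG dF dG.
pose D t := F t - G t.
suff: `|D T - D 0| <= 0.
  by rewrite normr_le0 subr_eq0 => /eqP; rewrite /D; lra.
apply/ler_addgt0Pl => e0 e0p; rewrite addr0.
(* [T + 1] because [T] may be 0; [e * T] stays below [e0] in all cases. *)
pose e := e0 / (T + 1).
have ep : 0 < e by rewrite divr_gt0// ltr_wpDl.
apply: (@le_trans _ _ (e * T)); last first.
  by rewrite /e mulrAC ler_pdivrMr ?ltr_wpDl// ler_pM2l//; lra.
pose S := [set t | 0 <= t <= T /\ forall u, 0 <= u <= t -> `|D u - D 0| <= e * u].
have S0 : S 0.
  split; first by rewrite lexx.
  by move=> u; rewrite -eq_le => /eqP <-; rewrite subrr normr0 mulr0.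
have supS : has_sup S.
  by split; [exists 0|exists T => t [/andP[_ ?] _]].
set s := sup S.
have s0 : 0 <= s by apply: ub_le_sup => //; exists T => t [/andP[_ ?] _].
have sT : s <= T by apply: ge_sup; [exists 0|move=> t [/andP[_ ?] _]].
have lS u : 0 <= u -> u < s -> `|D u - D 0| <= e * u.
  move=> u0 us; have us0 : 0 < s - u by rewrite subr_gt0.
  have [t [tT Ht]] := sup_adherent us0 supS.
  by rewrite -/s opprB addrC subrK => ut; apply: Ht; rewrite u0 ltW.
have Ss : `|D s - D 0| <= e * s.
  move: s0; rewrite le_eqVlt => /orP[/eqP <-|sp].
    by rewrite subrr normr0 mulr0.
  apply/ler_addgt0Pl => h hp.
  have h2 : 0 < h / 2 by lra.
  have [d1 d1p H1] := lF _ sp sT _ h2; have [d2 d2p H2] := lG _ sp sT _ h2.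
  pose d := Num.min s (Num.min d1 d2).
  have dp : 0 < d by rewrite !lt_min sp d1p.
  have ds : d <= s by rewrite ge_min lexx.
  have dd1 : d <= d1 by rewrite !ge_min lexx orbT.
  have dd2 : d <= d2 by rewrite !ge_min lexx !orbT.
  pose u := s - d / 2.
  have u1 : `|F u - F s| <= h / 2 by apply: H1; rewrite /u; lra.
  have u2 : `|G u - G s| <= h / 2 by apply: H2; rewrite /u; lra.
  have u3 : `|D u - D 0| <= e * u by apply: lS; rewrite /u; lra.
  have u4 : e * u <= e * s by rewrite ler_pM2l// /u; lra.
  move: u1 u2 u3; rewrite !ler_norml /D; lra.
move: sT; rewrite le_eqVlt => /orP[/eqP <-//|sT].
exfalso.
have e2 : 0 < e / 2 by lra.
have [d1 d1p H1] := dF _ s0 sT _ e2; have [d2 d2p H2] := dG _ s0 sT _ e2.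
pose d := Num.min (T - s) (Num.min d1 d2).
have dp : 0 < d by rewrite !lt_min subr_gt0 sT d1p.
have ds : d <= T - s by rewrite ge_min lexx.
have dd1 : d <= d1 by rewrite !ge_min lexx orbT.
have dd2 : d <= d2 by rewrite !ge_min lexx !orbT.
have : S (s + d / 2).
  split; first by lra.
  move=> u /andP[u0 us]; have [us'|us'] := ltP u s; first exact: lS.
  have v1 : `|F u - F s - l s * (u - s)| <= e / 2 * (u - s) by apply: H1; lra.
  have v2 : `|G u - G s - l s * (u - s)| <= e / 2 * (u - s) by apply: H2; lra.
  move: v1 v2 Ss; rewrite !ler_norml /D; lra.
move=> Sd; have : s + d / 2 <= s.
  by apply: ub_le_sup Sd; exists T => t [/andP[_ ?] _].
lra.
Qed.

End right_derivative.

(** * Joint measurability of right-continuous processes *)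

Section joint_measurability.
Context (R : realType) (d : measure_display) (T : measurableType d).
Variable Y : T -> R -> R.
Hypothesis mY : forall u, 0 <= u -> measurable_fun setT (Y ^~ u).
Hypothesis rY : forall w u, 0 <= u -> right_continuous_at (Y w) u.

(** The successor puts the grid point to the right of the sampled time, where right-continuity
    applies; [Num.max 0 u] extends the process to negative times. *)
Let grid n (u : R) : R := (Num.truncn (n.+1%:R * Num.max 0 u)).+1%:R / n.+1%:R.

Let grid_gt n u : Num.max 0 u < grid n u.
Proof.
rewrite /grid ltr_pdivlMr// mulrC.
exact: truncnS_gt.
Qed.

Let grid_le n u : grid n u <= Num.max 0 u + n.+1%:R^-1.
Proof.
rewrite /grid ler_pdivrMr// mulrDl mulVf// [X in _ <= X + _]mulrC -natr1 lerD2r.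
by have /andP[] := @truncn_itv _ (n.+1%:R * Num.max 0 u) ltac:(by rewrite mulr_ge0// le_max lexx).
Qed.

(* Approximate from the right along a grid: right-continuous processes are
   pointwise limits of countable combinations of measurable rectangles. *)
Lemma right_continuous_jointly_measurable :
  measurable_fun setT (fun p : T * R => Y p.1 (Num.max 0 p.2)).
Proof.
pose h n (p : T * R) := Y p.1 (grid n p.2).
apply: (@measurable_fun_cvg _ _ _ _ h) => [n|[w u] _].
  move=> _ B mB; rewrite setTI.
  rewrite (_ : _ @^-1` B = \bigcup_j
    ((fun w => Y w (j.+1%:R / n.+1%:R)) @^-1` B `*`
     [set u | (j%:R <= n.+1%:R * Num.max 0 u < j.+1%:R)])); last first.
    apply/seteqP; split => [[w u] /= Bh|[w u] [j _] [/= Bw /= ju]].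
      exists (Num.truncn (n.+1%:R * Num.max 0 u)) => //; split => //=.
      by apply: truncn_itv; rewrite mulr_ge0// le_max lexx.
    rewrite /h /grid /=.
    have /eqP -> // : Num.truncn (n.+1%:R * Num.max 0 u) == j.
    by rewrite truncn_eq// mulr_ge0// le_max lexx.
  apply: bigcup_measurable => j _; apply: measurableX.
    have j0 : 0 <= j.+1%:R / n.+1%:R :> R by rewrite divr_ge0.
    rewrite -[X in measurable X]setTI; exact: (mY j0).
  rewrite -[X in measurable X]setTI.
  have -> : [set u : R | j%:R <= n.+1%:R * Num.max 0 u < j.+1%:R] =
    (fun u : R => n.+1%:R * Num.max 0 u) @^-1` `[j%:R, j.+1%:R[.
    by apply/seteqP; split => u /=; rewrite in_itv.
  have mf : measurable_fun setT (fun u : R => n.+1%:R * Num.max 0 u).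
    by apply: measurable_funM => //; exact: measurable_maxr.
  exact: mf.
apply/cvgrPdist_le => e e0 /=.
have m0 : 0 <= Num.max 0 u by rewrite le_max lexx.
have [dl dl0 Hd] := rY w m0 e0.
have := @cvg_harmonic R; move/cvgrPdist_lt => /(_ _ dl0); apply: filterS => n /=.
rewrite sub0r normrN ger0_norm ?harmonic_ge0// /harmonic => nd.
rewrite distrC; apply: Hd; first exact/ltW/grid_gt.
by apply: (le_lt_trans (grid_le _ _)); rewrite ltrD2l.
Qed.

End joint_measurability.

(** Joint measurability over the one-point space, restricted to its only section. *)
Lemma right_continuous_measurable (R : realType) (h : R -> R) :
  (forall u, 0 <= u -> right_continuous_at h u) ->
  measurable_fun setT (fun u : R => h (Num.max 0 u)).
Proof.
move=> rh.
have := @right_continuous_jointly_measurable R _ unit (fun _ => h) _ (fun _ => rh).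
move=> /(_ (fun _ _ => measurable_cst _)) mh.
have mp : measurable_fun setT (fun u : R => (tt, u)).
  exact: measurable_fun_pair.
exact: (measurableT_comp mh mp).
Qed.

(** * Integrals of right-continuous functions *)

Section integral_right_derivative.
Variable R : realType.
Local Notation mu := (@lebesgue_measure R).

Lemma right_continuous_measurable_itv (h : R -> R) (i : interval R) :
  (forall u, 0 <= u -> right_continuous_at h u) ->
  [set` i] `<=` [set u | 0 <= u] ->
  measurable_fun [set` i] h.
Proof.
move=> rh i0; apply: (@eq_measurable_fun _ _ _ _ _ (fun u : R => h (Num.max 0 u))).
  by move=> u; rewrite inE => /i0 /= u0; rewrite max_r.
apply: measurable_funTS; exact: right_continuous_measurable.
Qed.

(** One estimate for three uses: [l = 0] gives the Lipschitz bound, [l = h t] the right derivative,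
    and a midpoint [l] the lower bound on increments of the clock. *)
Lemma Rintegral_itv_approx (h : R -> R) (a b l e : R) : 0 <= a -> a <= b ->
  (forall u, 0 <= u -> right_continuous_at h u) ->
  (forall x, a <= x -> x <= b -> `|h x - l| <= e) ->
  `|\int[mu]_(x in `]a, b]) h x - l * (b - a)| <= e * (b - a).
Proof.
move=> a0 ab rh hl.
have mD : measurable (`]a, b]%classic : set (measurableTypeR R)) by exact: measurable_itv.
have muD : mu `]a, b] = (b - a)%:E by rewrite lebesgue_measure_itv /= lte_fin; 
  move: ab; rewrite le_eqVlt => /orP[/eqP ->|ab]; [rewrite ltxx subrr|rewrite ab EFinB].
have muf : (mu `]a, b] < +oo)%E by rewrite muD ltry.
have mh : measurable_fun `]a, b] h.
  apply: right_continuous_measurable_itv => // x; rewrite /= in_itv /= => /andP[ax _].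
  by rewrite (le_trans a0)// ltW.
have ih : mu.-integrable `]a, b] (EFin \o h).
  apply: measurable_bounded_integrable => //.
  exists (`|l| + e); split => //; first by rewrite num_real.
  move=> M lM x /=; rewrite in_itv /= => /andP[/ltW ax xb].
  apply: le_trans (ltW lM); have := hl _ ax xb.
  have := ler_normD (h x - l) l; rewrite subrK; lra.
have il : mu.-integrable `]a, b] (EFin \o (fun=> l)).
  by apply: measurable_bounded_integrable => //; exact: bounded_cst.
have ie : mu.-integrable `]a, b] (EFin \o (fun=> e)).
  by apply: measurable_bounded_integrable => //; exact: bounded_cst.
have -> : l * (b - a) = \int[mu]_(x in `]a, b]) l by rewrite Rintegral_cst//; congr (_ * _); rewrite (congr1 fine muD).
have -> : e * (b - a) = \int[mu]_(x in `]a, b]) e by rewrite Rintegral_cst//; congr (_ * _); rewrite (congr1 fine muD).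
rewrite -RintegralB//.
have ihl : mu.-integrable `]a, b] (EFin \o (fun x => h x - l)).
  exact: (integrableB mD ih il).
apply: le_trans (le_normr_Rintegral mD ihl) _.
apply: le_Rintegral => //.
  exact: (integrable_norm ihl).
by move=> x /=; rewrite in_itv /= => /andP[/ltW ax xb]; exact: hl.
Qed.

Variables (h : R -> R) (T M : R).
Hypothesis rh : forall u, 0 <= u -> right_continuous_at h u.
Hypothesis hM : forall u, 0 <= u -> u <= T -> `|h u| <= M.

Lemma integrable_itv0 t : 0 <= t -> t <= T -> mu.-integrable `[0, t] (EFin \o h).
Proof.
move=> t0 tT; have mD : measurable (`[0, t]%classic : set (measurableTypeR R)).
  exact: measurable_itv.
have muf : (mu `[0%R, t] < +oo)%E.
  by rewrite lebesgue_measure_itv /= lte_fin; case: ifP; rewrite ltry.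
apply: measurable_bounded_integrable => //.
- apply: right_continuous_measurable_itv => // x /=.
  by rewrite in_itv /= => /andP[].
- exists M; split; first by rewrite num_real.
  move=> N MN x /=; rewrite in_itv /= => /andP[x0 xt].
  by apply: le_trans (ltW MN); apply: hM => //; exact: le_trans tT.
Qed.

Lemma Rintegral_increment t u : 0 <= t -> t <= u -> u <= T ->
  \int[mu]_(x in `[0, u]) h x - \int[mu]_(x in `[0, t]) h x =
  \int[mu]_(x in `]t, u]) h x.
Proof.
move=> t0 tu uT; rewrite Rintegral_itvB//; apply: integrable_itv0 => //.
exact: le_trans tu.
Qed.

Lemma Rintegral_Lipschitz t u : 0 <= t -> t <= u -> u <= T ->
  `|\int[mu]_(x in `[0, u]) h x - \int[mu]_(x in `[0, t]) h x| <= M * (u - t).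
Proof.
move=> t0 tu uT; rewrite Rintegral_increment//.
rewrite -[X in `|X|]subr0 -(mul0r (u - t)); apply: Rintegral_itv_approx => //.
by move=> x tx xu; rewrite subr0; apply: hM; lra.
Qed.

Lemma Rintegral_left_continuous t : 0 < t -> t <= T ->
  left_continuous_at (fun t => \int[mu]_(x in `[0, t]) h x) t.
Proof.
move=> t0 tT e e0.
have M0 : 0 <= M by apply: le_trans (hM (ltW t0) tT).
exists (Num.min t (e / (M + 1))).
  by rewrite lt_min t0 divr_gt0// ltr_wpDl.
move=> u tu ut.
have h1 : Num.min t (e / (M + 1)) <= t by rewrite ge_min lexx.
have h2 : Num.min t (e / (M + 1)) <= e / (M + 1) by rewrite ge_min lexx orbT.
rewrite distrC; apply: le_trans (Rintegral_Lipschitz _ ut tT) _; first lra.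
have h3 : t - u <= e / (M + 1) by lra.
move: h3; rewrite ler_pdivlMr ?ltr_wpDl//; nra.
Qed.

Lemma Rintegral_right_derivative t : 0 <= t -> t < T ->
  right_derivative (fun t => \int[mu]_(x in `[0, t]) h x) (h t) t.
Proof.
move=> t0 tT e e0; have [d d0 Hd] := rh t0 e0.
exists (Num.min d (T - t)); first by rewrite lt_min d0 subr_gt0.
move=> u tu ud.
have h1 : Num.min d (T - t) <= d by rewrite ge_min lexx.
have h2 : Num.min d (T - t) <= T - t by rewrite ge_min lexx orbT.
rewrite Rintegral_increment//; last lra.
apply: Rintegral_itv_approx => // x tx xu; apply: Hd => //; lra.
Qed.

Lemma Rintegral_itv00 : \int[mu]_(x in `[0, 0]) h x = 0.
Proof. by rewrite set_itv1 Rintegral_set1. Qed.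

End integral_right_derivative.

(** What remains of a cadlag path on [I] in the coordinate [g]. The last field is the trace of the
    topology at the cemetery: a path that dies takes arbitrarily large values before, so it is not
    killed by a jump. The premise on [x 0] exempts paths that are dead from the start. *)
Record real_path (R : realType) (x : R -> option R) : Prop := {
  real_path_right : forall t r, 0 <= t -> x t = Some r ->
    forall e, 0 < e -> exists2 d, 0 < d & forall u, t <= u -> u < t + d ->
      exists2 r', x u = Some r' & `|r' - r| <= e ;
  real_path_dead : forall s t, 0 <= s -> s <= t -> x s = None -> x t = None ;
  real_path_left : forall t r, 0 < t -> x t = Some r -> exists l,
    forall e, 0 < e -> exists2 d, 0 < d &
      forall u, 0 <= u -> t - d < u -> u < t ->
      exists2 r', x u = Some r' & `|r' - l| <= e ;
  real_path_bounded : forall t r, 0 <= t -> x t = Some r -> exists M,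
    forall u, 0 <= u -> u <= t -> exists2 r', x u = Some r' & `|r'| <= M ;
  real_path_death : forall t r, 0 <= t -> x 0 = Some r -> x t = None ->
    forall M, exists u r', [/\ 0 <= u, x u = Some r' & M < `|r'|] }.

(** * The clock of a killed path and its inverse *)

Section clock.
Variables (R : realType) (alpha : R).
Implicit Types (x : R -> option R) (s t u : R).

Definition path_val x u : R := if x u is Some r then r else 0.

(** The value 0 at the cemetery makes the clock stop at death. *)
Definition speed x u : R := if x u is Some r then expR (- alpha * r) else 0.

Definition clock x t : R := \int[@lebesgue_measure R]_(u in `[0, t]) speed x u.

(** The time-changed path is still alive at [s]; the negation is killing before or at [s]. *)
Definition reached x s := exists t, [/\ 0 <= t, x t & clock x t = s].

Definition clock_inv x s : R := xget 0 [set t | [/\ 0 <= t, x t & clock x t = s]].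

Definition lamperti x s : option R :=
  if `[< reached x s >] then x (clock_inv x s) else None.

Lemma isSomeP (T : Type) (o : option T) : o -> exists r, o = Some r.
Proof. by case: o => // r _; exists r. Qed.

Section real_path.
Variable x : R -> option R.
Hypothesis hx : real_path x.

Lemma alive_le s t : 0 <= s -> s <= t -> x t -> x s.
Proof.
by move=> s0 st; case E : (x s) => //; rewrite (real_path_dead hx s0 st E).
Qed.

Lemma alive_right t : 0 <= t -> x t ->
  exists2 d, 0 < d & forall u, t <= u -> u < t + d -> x u.
Proof.
move=> t0 /isSomeP[r xt]; have [d d0 Hd] := real_path_right hx t0 xt ltr01.
by exists d => // u tu ud; have [r' ->] := Hd _ tu ud.
Qed.

Lemma path_val_right_continuous t : 0 <= t -> right_continuous_at (path_val x) t.
Proof.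
move=> t0 e e0; rewrite /path_val; case xt : (x t) => [r|]; last first.
  by exists 1 => // u tu _; rewrite (real_path_dead hx t0 tu xt) subrr normr0 ltW.
have [d d0 Hd] := real_path_right hx t0 xt e0.
by exists d => // u tu ud; have [r' ->] := Hd _ tu ud.
Qed.

Lemma speed_right_continuous t : 0 <= t -> right_continuous_at (speed x) t.
Proof.
move=> t0 e e0; rewrite /speed; case xt : (x t) => [r|]; last first.
  by exists 1 => // u tu _; rewrite (real_path_dead hx t0 tu xt) subrr normr0 ltW.
have /cvgrPdist_le/(_ _ e0) : expR (- alpha * z) @[z --> r] --> expR (- alpha * r).
  apply: continuous_cvg; first exact: continuous_expR.
  by apply: cvgM; [exact: cvg_cst|exact: cvg_id].
rewrite near_simpl => /nbhs_ballP[h /= h0 Hh].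
have h2 : 0 < h / 2 by lra.
have [d d0 Hd] := real_path_right hx t0 xt h2.
exists d => // u tu ud; have [r' -> rr'] := Hd _ tu ud.
by rewrite distrC; apply: Hh; rewrite /ball /= distrC; lra.
Qed.

Lemma speed_bounds T : 0 <= T -> x T -> exists m M, [/\ 0 < m, 0 < M &
  forall u, 0 <= u -> u <= T -> m <= speed x u /\ speed x u <= M].
Proof.
move=> T0 /isSomeP[r xT]; have [K HK] := real_path_bounded hx T0 xT.
exists (expR (- (`|alpha| * K))), (expR (`|alpha| * K)).
split; rewrite ?expR_gt0// => u u0 uT; rewrite /speed; have [r' -> rK] := HK u u0 uT.
have := ler_wpM2l (normr_ge0 alpha) rK.
rewrite -normrM ler_norml => /andP[h1 h2].
by rewrite !ler_expR; split; lra.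
Qed.

Lemma speed_gt0 t : x t -> 0 < speed x t.
Proof. by rewrite /speed; case: (x t) => // r _; rewrite expR_gt0. Qed.

Lemma clock0 : clock x 0 = 0.
Proof. by rewrite /clock Rintegral_itv00. Qed.

Lemma speed_abs_bound T : 0 <= T -> x T -> exists2 M, 0 < M &
  forall u, 0 <= u -> u <= T -> `|speed x u| <= M.
Proof.
move=> T0 xT; have [m [M [m0 M0 H]]] := speed_bounds T0 xT.
exists M => // u u0 uT; have [h1 h2] := H u u0 uT.
by rewrite ger0_norm//; lra.
Qed.

Lemma clock_increment_ge s t m : 0 <= s -> s <= t -> x t ->
  (forall u, s <= u -> u <= t -> m <= speed x u) ->
  m * (t - s) <= clock x t - clock x s.
Proof.
move=> s0 st xt hm; have t0 : 0 <= t by lra.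
have [M M0 HM] := speed_abs_bound t0 xt.
rewrite /clock (Rintegral_increment speed_right_continuous HM)//.
(* The bounds [m] and [M] are recast as a distance to their midpoint; the radius [(M - m) / 2] then
   leaves exactly the slope [m] as lower bound. *)
have h1 : forall u, s <= u -> u <= t -> `|speed x u - (m + M) / 2| <= (M - m) / 2.
  move=> u su ut; have := hm u su ut; have /(_ _ ut) := HM u.
  by rewrite !ler_norml; lra.
have := Rintegral_itv_approx s0 st speed_right_continuous h1.
rewrite ler_norml => /andP[h2 _]; nra.
Qed.

Lemma clock_lt s t : 0 <= s -> s < t -> x t -> clock x s < clock x t.
Proof.
move=> s0 st xt; have t0 : 0 <= t by lra.
have [m [M [m0 M0 H]]] := speed_bounds t0 xt.
rewrite -subr_gt0; apply: lt_le_trans (clock_increment_ge s0 (ltW st) xt (m := m) _).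
  by rewrite mulr_gt0// subr_gt0.
by move=> u su ut; have [] := H u; lra.
Qed.

Lemma clock_le s t : 0 <= s -> s <= t -> x t -> clock x s <= clock x t.
Proof.
by move=> s0; rewrite le_eqVlt => /orP[/eqP ->//|st xt]; apply/ltW/clock_lt.
Qed.

Lemma clock_ge0 t : 0 <= t -> x t -> 0 <= clock x t.
Proof. by move=> t0 xt; rewrite -clock0 clock_le. Qed.

Lemma clock_lt_inv s t : 0 <= s -> 0 <= t -> x s -> clock x s < clock x t -> s < t.
Proof.
move=> s0 t0 xs cst; rewrite ltNge; apply/negP => ts.
by have := clock_le t0 ts xs; rewrite leNgt cst.
Qed.

Lemma clock_inj s t : 0 <= s -> 0 <= t -> x s -> x t -> clock x s = clock x t -> s = t.
Proof.
move=> s0 t0 xs xt cst; case: (ltgtP s t) => // st.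
- by have := clock_lt s0 st xt; rewrite cst ltxx.
- by have := clock_lt t0 st xs; rewrite cst ltxx.
Qed.

Lemma clock_left_continuous t : 0 < t -> x t -> left_continuous_at (clock x) t.
Proof.
move=> t0 xt; have [M M0 HM] := speed_abs_bound (ltW t0) xt.
exact: (Rintegral_left_continuous speed_right_continuous HM).
Qed.

Lemma clock_right_derivative t : 0 <= t -> x t ->
  right_derivative (clock x) (speed x t) t.
Proof.
move=> t0 xt; have [d d0 Hd] := alive_right t0 xt.
have xt' : x (t + d / 2) by apply: Hd; lra.
have t'0 : 0 <= t + d / 2 by lra.
have [M M0 HM] := speed_abs_bound t'0 xt'.
by apply: (Rintegral_right_derivative speed_right_continuous HM) => //; lra.
Qed.

(** Identifies the clocks of shifted and rescaled paths without a change of variables in the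
    integral. *)
Lemma clock_unique F T : 0 <= T -> x T -> F 0 = 0 ->
  (forall t, 0 < t -> t <= T -> left_continuous_at F t) ->
  (forall t, 0 <= t -> t < T -> right_derivative F (speed x t) t) ->
  F T = clock x T.
Proof.
move=> T0 xT F0 lF dF; have -> : F T = F T - F 0 by rewrite F0 subr0.
have -> : clock x T = clock x T - clock x 0 by rewrite clock0 subr0.
apply: (right_derivative_unique (l := speed x)) => // t t0 tT.
- by apply: clock_left_continuous => //; apply: alive_le tT xT; exact: ltW.
- by apply: clock_right_derivative => //; apply: alive_le (ltW tT) xT.
Qed.

Lemma clock_IVT T s : 0 <= T -> x T -> 0 <= s -> s <= clock x T ->
  exists t, [/\ 0 <= t, t <= T, x t & clock x t = s].
Proof.
move=> T0 xT s0 sT; have [M M0 HM] := speed_abs_bound T0 xT.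
have iT : (@lebesgue_measure R).-integrable `[0, T] (EFin \o speed x).
  exact: (integrable_itv0 speed_right_continuous HM).
have cT := parameterized_integral_continuous T0 iT.
have [|t] := IVT (v := s) T0 cT.
  have -> : parameterized_integral lebesgue_measure 0 0 (speed x) = 0 by exact: clock0.
  have -> : parameterized_integral lebesgue_measure 0 T (speed x) = clock x T by [].
  by rewrite min_l ?max_r ?clock_ge0// s0 sT.
rewrite in_itv /= => /andP[t0 tT] ct; exists t; split => //.
exact: alive_le tT xT.
Qed.

Lemma clock_inv_spec s : reached x s ->
  [/\ 0 <= clock_inv x s, x (clock_inv x s) & clock x (clock_inv x s) = s].
Proof. by move=> rs; have := xgetPex 0 rs. Qed.

Lemma clock_invK t : 0 <= t -> x t -> clock_inv x (clock x t) = t.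
Proof.
move=> t0 xt; have [|p0 xp] := @clock_inv_spec (clock x t); first by exists t.
exact: clock_inj.
Qed.

Lemma reached_clock t : 0 <= t -> x t -> reached x (clock x t).
Proof. by exists t. Qed.

Lemma reached_ge0 s : reached x s -> 0 <= s.
Proof. by move=> [t [t0 xt <-]]; exact: clock_ge0. Qed.

Lemma reached_le u s : 0 <= u -> u <= s -> reached x s -> reached x u.
Proof.
move=> u0 us [t [t0 xt ct]]; move: us; rewrite -ct => us.
by have [v [v0 vt xv cv]] := clock_IVT t0 xt u0 us; exists v.
Qed.

Lemma clock_inv_lt u s : 0 <= u -> u < s -> reached x s ->
  clock_inv x u < clock_inv x s.
Proof.
move=> u0 us rs; have ru := reached_le u0 (ltW us) rs.
have [p0 xp cp] := clock_inv_spec rs; have [q0 xq cq] := clock_inv_spec ru.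
by apply: clock_lt_inv => //; rewrite cp cq.
Qed.

Lemma clock_inv_le u s : 0 <= u -> u <= s -> reached x s ->
  clock_inv x u <= clock_inv x s.
Proof.
by move=> u0; rewrite le_eqVlt => /orP[/eqP ->//|us rs]; apply/ltW/clock_inv_lt.
Qed.

Lemma clock_inv0 : x 0 -> clock_inv x 0 = 0.
Proof. by move=> x0; rewrite -{1}clock0 clock_invK. Qed.

Lemma lampertiE s : reached x s -> lamperti x s = x (clock_inv x s).
Proof. by move=> rs; rewrite /lamperti; case: asboolP. Qed.

Lemma lampertiP s : lamperti x s <-> reached x s.
Proof.
rewrite /lamperti; case: asboolP => // rs; split => // _.
by have [] := clock_inv_spec rs.
Qed.

Lemma lamperti_clock t : 0 <= t -> x t -> lamperti x (clock x t) = x t.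
Proof. by move=> t0 xt; rewrite lampertiE ?clock_invK//; exists t. Qed.

Lemma lamperti0 : x 0 -> lamperti x 0 = x 0.
Proof. by move=> x0; rewrite -{1}clock0 lamperti_clock. Qed.

(** While the path is alive at [t], the event that the inverse clock at [s] is at most [t] is
    decided by the clock at [t]; this is the core of the stopping time property. *)
Lemma clock_inv_le_iff s t : 0 <= t -> x t -> 0 <= s ->
  (reached x s /\ clock_inv x s <= t) <-> s <= clock x t.
Proof.
move=> t0 xt s0; split=> [[rs st]|st].
  by have [p0 xp <-] := clock_inv_spec rs; exact: clock_le.
have [v [v0 vt xv cv]] := clock_IVT t0 xt s0 st.
by split; [exists v|rewrite -cv clock_invK].
Qed.

(** The path survives a little longer, so the clock strictly exceeds [s] at some living time [t]
    close to the right; every level below [clock x t] is then reached before [t]. *)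
Lemma clock_inv_right s d : reached x s -> 0 < d -> exists2 h, 0 < h &
  forall u, s <= u -> u < s + h ->
    [/\ reached x u, clock_inv x s <= clock_inv x u & clock_inv x u < clock_inv x s + d].
Proof.
move=> rs d0; have [p0 xp cp] := clock_inv_spec rs.
have [d' d'0 Hd] := alive_right p0 xp.
pose t := clock_inv x s + Num.min d d' / 2.
have m0 : 0 < Num.min d d' by rewrite lt_min d0.
have md : Num.min d d' <= d by rewrite ge_min lexx.
have md' : Num.min d d' <= d' by rewrite ge_min lexx orbT.
have pt : clock_inv x s < t by rewrite /t; lra.
have xt : x t by apply: Hd; rewrite /t; lra.
have t0 : 0 <= t by lra.
have ct := clock_lt p0 pt xt; rewrite cp in ct.
exists (clock x t - s); first by rewrite subr_gt0.
move=> u su uh; have u0 : 0 <= u by apply: le_trans su; exact: reached_ge0.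
have uct : u < clock x t by lra.
have ru : reached x u by apply: reached_le u0 (ltW uct) _; exists t.
split => //; first by apply: clock_inv_le => //; exact: reached_ge0.
have : clock_inv x u < t.
  by rewrite -[X in _ < X]clock_invK//; apply: clock_inv_lt => //; exists t.
rewrite /t; lra.
Qed.

(** The strict upper inequality matters: it keeps the inverse clock in the punctured left
    neighbourhood where the left limit of the path is available. *)
Lemma clock_inv_left s d : 0 < s -> reached x s -> 0 < d -> exists2 h, 0 < h &
  forall u, 0 <= u -> s - h < u -> u < s ->
    clock_inv x s - d < clock_inv x u /\ clock_inv x u < clock_inv x s.
Proof.
move=> s0 rs d0; have [p0 xp cp] := clock_inv_spec rs.
have [pd|pd] := ltP (clock_inv x s - d) 0.
  exists 1 => // u u0 _ us; split; last exact: clock_inv_lt.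
  have ru := reached_le u0 (ltW us) rs.
  by have [q0 _ _] := clock_inv_spec ru; lra.
have pd' : clock_inv x s - d < clock_inv x s by lra.
exists (s - clock x (clock_inv x s - d)).
  by rewrite subr_gt0 -[X in _ < X]cp clock_lt.
move=> u u0 us us'; split; last exact: clock_inv_lt.
have xpd : x (clock_inv x s - d) by apply: alive_le (ltW pd') xp.
have ru := reached_le u0 (ltW us') rs.
have [q0 xq cq] := clock_inv_spec ru.
by apply: clock_lt_inv => //; rewrite cq; lra.
Qed.

End real_path.
End clock.

(** * Shifts and scalings of paths *)

Section path_transformations.
Variables (R : realType) (alpha : R).
Implicit Types (x : R -> option R) (s t u z : R).

Definition shift_path s x : R -> option R := fun t => x (s + t).

(** Self-similarity read in the coordinate [g]: with [z = g y], the map [f y] becomes the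
    translation by [z] and [c y] becomes [expR (- alpha * z)]. *)
Definition scale_path z x : R -> option R :=
  fun t => omap (fun r => r + z) (x (expR (- alpha * z) * t)).

Lemma real_path_shift s x : real_path x -> 0 <= s -> x s ->
  real_path (shift_path s x).
Proof.
move=> hx s0 xs; rewrite /shift_path; split.
- move=> t r t0 xt e e0; have st0 : 0 <= s + t by lra.
  have [d d0 Hd] := real_path_right hx st0 xt e0.
  by exists d => // u tu ud; apply: Hd; lra.
- by move=> u t u0 ut; apply: (real_path_dead hx); lra.
- move=> t r t0 xt; have st0 : 0 < s + t by lra.
  have [l Hl] := real_path_left hx st0 xt; exists l => e e0.
  by have [d d0 Hd] := Hl _ e0; exists d => // u u0 tu ut; apply: Hd; lra.
- move=> t r t0 xt; have st0 : 0 <= s + t by lra.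
  have [M HM] := real_path_bounded hx st0 xt; exists M => u u0 ut.
  by apply: HM; lra.
- move=> t r t0; rewrite addr0 => xsr xt M; have st0 : 0 <= s + t by lra.
  have [K HK] := real_path_bounded hx s0 xsr.
  have /isSomeP[r0 x0] := alive_le hx (lexx 0) s0 xs.
  (* Asking for a value above the bound [K] valid on [[0, s]] forces it to occur after time [s]. *)
  have [u [r' [u0 xu Mr]]] := real_path_death hx st0 x0 xt (Num.max M K).
  exists (u - s), r'; rewrite subrKC.
  have su : s < u.
    rewrite ltNge; apply/negP => us; have [r''] := HK _ u0 us.
    by rewrite xu => -[<-]; move: Mr; rewrite gt_max leNgt => /andP[_ ->].
  by split => //; [lra|move: Mr; rewrite gt_max => /andP[]].
Qed.

(** Both sides vanish at 0 and share the same right derivative, so [clock_unique] applies. *)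
Lemma clock_shift s x t : real_path x -> 0 <= s -> 0 <= t -> x (s + t) ->
  clock alpha (shift_path s x) t = clock alpha x (s + t) - clock alpha x s.
Proof.
move=> hx s0 t0 xst; have xs : x s by apply: alive_le xst => //; lra.
have hsx := real_path_shift hx s0 xs.
symmetry; apply: (@clock_unique _ alpha _ hsx (fun t => clock alpha x (s + t) - clock alpha x s)) => //.
- by rewrite addr0 subrr.
- move=> u u0 ut e e0.
  have [| |d d0 Hd] := clock_left_continuous alpha hx (t := s + u) _ _ e0; first lra.
    by apply: alive_le xst => //; lra.
  exists d => // v uv vu; rewrite opprB addrA subrK.
  by apply: Hd; lra.
- move=> u u0 ut e e0.
  have [| |d d0 Hd] := clock_right_derivative alpha hx (t := s + u) _ _ e0; first lra.
    by apply: alive_le xst => //; lra.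
  exists d => // v uv vu; rewrite opprB addrA subrK.
  have -> : v - u = (s + v) - (s + u) by ring.
  by apply: Hd; lra.
Qed.

(** Restarting the path at the time when its clock shows [s] resets the clock by exactly [s], so the
    time change turns this random restart into a shift by the fixed time [s]. *)
Lemma lamperti_shift s x r : real_path x -> reached alpha x s -> 0 <= r ->
  lamperti alpha (shift_path (clock_inv alpha x s) x) r = lamperti alpha x (s + r).
Proof.
move=> hx rs r0; have [p0 xp cp] := clock_inv_spec rs.
set p := clock_inv alpha x s in p0 xp cp *.
have hpx := real_path_shift hx p0 xp.
case E : (lamperti alpha (shift_path p x) r) => [v|].
  have /lampertiP[t [t0 xt ct]] : lamperti alpha (shift_path p x) r by rewrite E.
  rewrite -E -ct lamperti_clock// clock_shift// cp subrKC lamperti_clock//.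
  by lra.
case F : (lamperti alpha x (s + r)) => [v|//].
have /lampertiP[t [t0 xt ct]] : lamperti alpha x (s + r) by rewrite F.
have pt : p <= t.
  rewrite leNgt; apply/negP => tp; have := clock_lt alpha hx t0 tp xp.
  by rewrite ct cp; lra.
have xpt : shift_path p x (t - p) by rewrite /shift_path subrKC.
have tp0 : 0 <= t - p by lra.
have : clock alpha (shift_path p x) (t - p) = r.
  by rewrite clock_shift// subrKC ct cp; lra.
by move=> cr; move: E; rewrite -cr lamperti_clock//; move: xpt; case: (shift_path _ _ _).
Qed.

Lemma scale_path_alive z x t : isSome (scale_path z x t) = isSome (x (expR (- alpha * z) * t)).
Proof. by rewrite /scale_path; case: (x _). Qed.

Let rate_gt0 z : 0 < expR (- alpha * z). Proof. exact: expR_gt0. Qed.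

Lemma real_path_scale z x : real_path x -> real_path (scale_path z x).
Proof.
move=> hx; rewrite /scale_path; set k := expR _; have k0 : 0 < k by exact: rate_gt0.
have kK u : k * (k^-1 * u) = u by rewrite mulrA divff ?gt_eqF// mul1r.
have kdiv d : 0 < d -> 0 < d / k by move=> d0; rewrite divr_gt0.
have kd d : d / k * k = d by rewrite mulfVK ?gt_eqF.
split.
- move=> t r t0; case xt : (x (k * t)) => [q|//] [<-] e e0.
  have [d d0 Hd] := real_path_right hx (mulr_ge0 (ltW k0) t0) xt e0.
  exists (d / k); first exact: kdiv.
  move=> u tu ud; have [||r' -> H] := Hd (k * u).
  + by rewrite ler_pM2l.
  + by rewrite -(kd d) [_ * k]mulrC -mulrDr ltr_pM2l.
  + by exists (r' + z) => //; rewrite opprD addrACA subrr addr0.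
- move=> s t s0 st; case E : (x (k * s)) => // _.
  by rewrite (real_path_dead hx _ _ E)// ?ler_pM2l// mulr_ge0// ltW.
- move=> t r t0; case xt : (x (k * t)) => [q|//] _.
  have kt0 : 0 < k * t by rewrite mulr_gt0.
  have [l Hl] := real_path_left hx kt0 xt; exists (l + z) => e e0.
  have [d d0 Hd] := Hl _ e0; exists (d / k); first exact: kdiv.
  move=> u u0 tu ut; have [|||r' -> H] := Hd (k * u).
  + by rewrite mulr_ge0// ltW.
  + by rewrite -(kd d) [_ * k]mulrC -mulrBr ltr_pM2l.
  + by rewrite ltr_pM2l.
  + by exists (r' + z) => //; rewrite opprD addrACA subrr addr0.
- move=> t r t0; case xt : (x (k * t)) => [q|//] _.
  have [M HM] := real_path_bounded hx (mulr_ge0 (ltW k0) t0) xt.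
  exists (M + `|z|) => u u0 ut; have [||r' -> H] := HM (k * u).
  + by rewrite mulr_ge0// ltW.
  + by rewrite ler_pM2l.
  + by exists (r' + z) => //; apply: le_trans (ler_normD _ _) _; rewrite lerD2r.
- move=> t r t0; rewrite mulr0; case x0 : (x 0) => [q|//] _.
  case xt : (x (k * t)) => [//|] _ M.
  have [u [r' [u0 xu Mr]]] := real_path_death hx (mulr_ge0 (ltW k0) t0) x0 xt (M + `|z|).
  exists (k^-1 * u), (r' + z); rewrite kK xu; split => //.
    by rewrite mulr_ge0// invr_ge0 ltW.
  have := ler_normB (r' + z) z; rewrite addrK; lra.
Qed.

(** The translation by [z] multiplies the speed by [expR (- alpha * z)], which is also the
    derivative of the rescaled time: the two factors match, and the clock only sees the rescaled
    time. *)
Lemma clock_scale z x t : real_path x -> 0 <= t -> x (expR (- alpha * z) * t) ->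
  clock alpha (scale_path z x) t = clock alpha x (expR (- alpha * z) * t).
Proof.
move=> hx t0 xt; have hzx := real_path_scale z hx.
have xzt : scale_path z x t by rewrite scale_path_alive.
set k := expR _ in xt *; have k0 : 0 < k by exact: rate_gt0.
have kd d : d / k * k = d by rewrite mulfVK ?gt_eqF.
symmetry; apply: (@clock_unique _ alpha _ hzx (fun t => clock alpha x (k * t))) => //.
- by rewrite mulr0 clock0.
- move=> u u0 ut e e0.
  have [| |d d0 Hd] := clock_left_continuous alpha hx (t := k * u) _ _ e0.
  + by rewrite mulr_gt0.
  + by apply: alive_le xt => //; rewrite ?ler_pM2l// mulr_ge0// ltW.
  exists (d / k); first by rewrite divr_gt0.
  move=> v uv vu; apply: Hd; rewrite ?ler_pM2l//.
  by rewrite -(kd d) [_ * k]mulrC -mulrBr ltr_pM2l.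
- move=> u u0 ut e e0; have ek0 : 0 < e / k by rewrite divr_gt0.
  have ku0 : 0 <= k * u by rewrite mulr_ge0// ltW.
  have xku : x (k * u) by apply: alive_le xt => //; rewrite ler_pM2l// ltW.
  have [d d0 Hd] := clock_right_derivative alpha hx ku0 xku ek0.
  exists (d / k); first by rewrite divr_gt0.
  move=> v uv vu; have -> : speed alpha (scale_path z x) u = k * speed alpha x (k * u).
    rewrite /speed /scale_path -/k; move: xku; case: (x (k * u)) => //= r _.
    by rewrite /k -expRD; congr expR; ring.
  have := Hd (k * v); rewrite ler_pM2l// => /(_ uv).
  rewrite -(kd d) [_ * k]mulrC -mulrDr ltr_pM2l// => /(_ vu).
  rewrite -mulrBr mulrA [speed _ _ _ * k]mulrC => /le_trans; apply.
  by rewrite mulrA kd.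
Qed.

(** The time rescaling is absorbed by the inverse clock, and only the translation survives. This is
    why the increments of the time-changed path do not depend on the starting point. *)
Lemma lamperti_scale z x s : real_path x ->
  lamperti alpha (scale_path z x) s = omap (fun r => r + z) (lamperti alpha x s).
Proof.
move=> hx; have hzx := real_path_scale z hx.
have k0 := rate_gt0 z.
case E : (lamperti alpha (scale_path z x) s) => [v|].
  have /lampertiP[t [t0 xt ct]] : lamperti alpha (scale_path z x) s by rewrite E.
  rewrite -E -ct lamperti_clock//; rewrite scale_path_alive in xt.
  by rewrite clock_scale// lamperti_clock// mulr_ge0// ltW.
case F : (lamperti alpha x s) => [v|//].
have /lampertiP[t [t0 xt ct]] : lamperti alpha x s by rewrite F.
pose t' := (expR (- alpha * z))^-1 * t.
have t'0 : 0 <= t' by rewrite mulr_ge0// invr_ge0 ltW.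
have tE : expR (- alpha * z) * t' = t by rewrite /t' mulrA divff ?gt_eqF// mul1r.
have xt' : scale_path z x t' by rewrite scale_path_alive tE.
have cs : clock alpha (scale_path z x) t' = s by rewrite clock_scale ?tE.
by move: E; rewrite -cs lamperti_clock//; move: xt'; case: (scale_path _ _ _).
Qed.

End path_transformations.

(** * The inverse clock as the integral of the exponential of the time-changed path *)

Section inverse_clock.
Variables (R : realType) (alpha : R) (x : R -> option R).
Hypothesis hx : real_path x.
Hypothesis full : forall s, 0 <= s -> reached alpha x s.

Local Notation xi := (path_val (lamperti alpha x)).
Local Notation psi := (clock_inv alpha x).

Lemma lamperti_val s : 0 <= s -> xi s = path_val x (psi s).
Proof. by move=> s0; rewrite /path_val lampertiE//; exact: full. Qed.

Lemma lamperti_right_continuous s : 0 <= s -> right_continuous_at xi s.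
Proof.
move=> s0 e e0; have [p0 xp _] := clock_inv_spec (full s0).
have [d d0 Hd] := path_val_right_continuous hx p0 e0.
have [h h0 Hh] := clock_inv_right hx (full s0) d0.
exists h => // u su uh; have [ru pu pu'] := Hh _ su uh.
by rewrite !lamperti_val//; [exact: Hd|exact: le_trans su].
Qed.

Lemma lamperti_left_limit s : 0 < s -> exists l, forall e, 0 < e ->
  exists2 d, 0 < d & forall u, s - d < u -> u < s -> `|xi u - l| <= e.
Proof.
move=> s0; have [p0 xp cp] := clock_inv_spec (full (ltW s0)).
have pp : 0 < psi s.
  rewrite lt_neqAle p0 andbT; apply/eqP => E; move: cp; rewrite -E clock0.
  by move=> E0; move: s0; rewrite -E0 ltxx.
have /isSomeP[r xr] := xp.
have [l Hl] := real_path_left hx pp xr; exists l => e e0.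
have [d d0 Hd] := Hl _ e0.
have [h h0 Hh] := clock_inv_left hx s0 (full (ltW s0)) d0.
exists (Num.min s h); first by rewrite lt_min s0.
move=> u su us.
have m1 : Num.min s h <= s by rewrite ge_min lexx.
have m2 : Num.min s h <= h by rewrite ge_min lexx orbT.
have u0 : 0 <= u by lra.
have [||h1 h2] := Hh u u0; [lra|lra|].
have [q0 xq _] := clock_inv_spec (full u0).
have [||r' E H] := Hd (psi u) q0; [lra|lra|].
by rewrite lamperti_val// /path_val E.
Qed.

Lemma lamperti_bounded s : 0 <= s -> exists M, forall u, 0 <= u -> u <= s ->
  `|xi u| <= M.
Proof.
move=> s0; have [p0 /isSomeP[r xp] _] := clock_inv_spec (full s0).
have [M HM] := real_path_bounded hx p0 xp; exists M => u u0 us.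
have [q0 xq _] := clock_inv_spec (full u0).
have [|r' E H] := HM _ q0; first exact: clock_inv_le (full s0).
by rewrite lamperti_val// /path_val E.
Qed.

Let h u := expR (alpha * xi u).

Lemma expR_lamperti u : 0 <= u -> h u = (speed alpha x (psi u))^-1.
Proof.
move=> u0; have [q0 /isSomeP[r xq] _] := clock_inv_spec (full u0).
by rewrite /h lamperti_val// /path_val /speed xq -expRN mulNr opprK.
Qed.

Lemma expR_lamperti_right_continuous u : 0 <= u -> right_continuous_at h u.
Proof.
move=> u0 e e0.
have /cvgrPdist_le/(_ _ e0) : expR (alpha * z) @[z --> xi u] --> h u.
  apply: continuous_cvg; first exact: continuous_expR.
  by apply: cvgM; [exact: cvg_cst|exact: cvg_id].
rewrite near_simpl => /nbhs_ballP[c /= c0 Hc].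
have c2 : 0 < c / 2 by lra.
have [d d0 Hd] := lamperti_right_continuous u0 c2.
exists d => // v uv vd; have H := Hd _ uv vd.
by rewrite distrC; apply: Hc; rewrite /ball /= distrC; lra.
Qed.

Lemma expR_lamperti_bounded T : 0 <= T -> exists M,
  forall u, 0 <= u -> u <= T -> `|h u| <= M.
Proof.
move=> T0; have [K HK] := lamperti_bounded T0.
exists (expR (`|alpha| * K)) => u u0 uT; rewrite ger0_norm ?expR_ge0// /h ler_expR.
have := ler_wpM2l (normr_ge0 alpha) (HK _ u0 uT).
by rewrite -normrM ler_norml => /andP[].
Qed.

(** The one-sided rule for the derivative of an inverse function, since [h s] is the inverse of the
    speed at [psi s]. *)
Lemma clock_inv_right_derivative s : 0 <= s -> right_derivative psi (h s) s.
Proof.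
move=> s0 e e0; have [p0 xp cp] := clock_inv_spec (full s0).
set l := speed alpha x (psi s); have l0 : 0 < l by exact: speed_gt0.
have hl : h s = l^-1 by exact: expR_lamperti.
(* With [k] the increment of [psi] and [v] that of the clock: [l / 2] yields [k <= 2 * v / l], and
   then [e' * k <= e * l * v], which becomes [e * v] after division by [l]. *)
pose e' := Num.min (l / 2) (e * l * l / 2).
have e'0 : 0 < e' by rewrite lt_min !divr_gt0// !mulr_gt0.
have e'1 : e' <= l / 2 by rewrite ge_min lexx.
have e'2 : e' <= e * l * l / 2 by rewrite ge_min lexx orbT.
have [d d0 Hd] := clock_right_derivative alpha hx p0 xp e'0.
have [c c0 Hc] := clock_inv_right hx (full s0) d0.
exists c => // u su uc; have [ru pu pu'] := Hc _ su uc.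
have := Hd _ pu pu'; have [_ _ ->] := clock_inv_spec ru; rewrite cp -/l hl.
set k := psi u - psi s; have k0 : 0 <= k by rewrite /k; lra.
set v := u - s => H; have v0 : 0 <= v by rewrite subr_ge0.
clearbody k v l.
have lk : l / 2 * k <= v by move: H; rewrite ler_norml; nra.
have kv : k <= 2 * v / l by rewrite ler_pdivlMr//; nra.
have -> : k - l^-1 * v = - (l^-1 * (v - l * k)).
  by rewrite mulrBr mulKf ?gt_eqF// opprB.
rewrite normrN normrM (ger0_norm (ltW _)) ?invr_gt0// mulrC ler_pdivrMr//.
apply: (le_trans H); apply: le_trans (_ : e' * (2 * v / l) <= _).
  by rewrite ler_wpM2l// ltW.
rewrite mulrA ler_pdivrMr//; nra.
Qed.

(** Both sides vanish at 0, are left-continuous and have right derivative [h]. *)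
Lemma integral_expR_lamperti s : 0 <= s ->
  \int[@lebesgue_measure R]_(u in `[0, s]) expR (alpha * xi u) = psi s.
Proof.
move=> s0; have [M HM] := expR_lamperti_bounded s0.
pose F t := \int[@lebesgue_measure R]_(u in `[0, t]) h u.
have x0 : x 0.
  have [p0 xp _] := clock_inv_spec (full s0).
  exact: alive_le xp.
have F0 : F 0 = 0 by rewrite /F Rintegral_itv00.
have -> : psi s = psi s - psi 0 by rewrite clock_inv0// subr0.
have -> : \int[@lebesgue_measure R]_(u in `[0, s]) expR (alpha * xi u) = F s - F 0.
  by rewrite F0 subr0.
apply: (right_derivative_unique (l := h)) => // t t0 ts.
- exact: (Rintegral_left_continuous expR_lamperti_right_continuous HM).
- move=> e e0; have [c c0 Hc] := clock_inv_left hx t0 (full (ltW t0)) e0.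
  exists (Num.min t c); first by rewrite lt_min t0.
  move=> u tu; rewrite le_eqVlt => /orP[/eqP ->|ut]; first by rewrite subrr normr0 ltW.
  have m1 : Num.min t c <= t by rewrite ge_min lexx.
  have m2 : Num.min t c <= c by rewrite ge_min lexx orbT.
  have [| | |] := Hc u; try lra.
  by move=> h1 h2; rewrite ler_norml; lra.
- exact: (Rintegral_right_derivative expR_lamperti_right_continuous HM).
- exact: clock_inv_right_derivative.
Qed.

Let x_psi s : 0 <= s -> [/\ 0 <= psi s, x (psi s)
  & clock alpha x (psi s) = s].
Proof. by move=> s0; exact: (clock_inv_spec (full s0)). Qed.

Lemma phi_lamperti t : 0 <= t -> phi alpha xi t%:E = (psi t)%:E.
Proof.
move=> t0; have [M HM] := expR_lamperti_bounded t0.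
rewrite -(integral_expR_lamperti t0) /Rintegral fineK; last first.
  apply: integrable_fin_num => //.
  exact: (integrable_itv0 (expR_lamperti_right_continuous) HM).
rewrite /phi; congr (integral _ _ _); apply/seteqP.
by split => s /=; rewrite in_itv /= lee_fin => /andP.
Qed.

Lemma phi_inv_lamperti t : 0 <= t -> x t -> phi_inv alpha xi t = clock alpha x t.
Proof.
move=> t0 xt; pose F s := fine (phi alpha xi s%:E).
have FE s : 0 <= s -> F s = psi s by move=> s0; rewrite /F phi_lamperti.
have c0 := clock_ge0 alpha hx t0 xt.
have -> : t = F (clock alpha x t) by rewrite FE// clock_invK.
rewrite /phi_inv pinvKV ?inE//.
  by rewrite FE// clock_invK.
move=> u v; rewrite !inE /= => u0 v0; rewrite -/(F u) -/(F v) !FE// => E.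
by have [_ _ <-] := x_psi u0; rewrite E; have [] := x_psi v0.
Qed.

(** By monotone convergence [phi] at infinity is the limit of [psi n]. Each [psi n] is a living
    time, hence smaller than any dead time; conversely [psi n] passes every living time as soon as
    [n] exceeds the clock there. *)
Lemma phi_lamperti_oo t : 0 <= t -> (t%:E < phi alpha xi +oo)%E <-> x t.
Proof.
move=> t0; pose J n := `[0, n%:R]%classic : set R.
have UJ : [set s : R | 0 <= s /\ (s%:E <= +oo)%E] = \bigcup_n J n.
  apply/seteqP; split => [s /= [s0 _]|s /= [n _]].
    exists (Num.truncn s).+1 => //=; rewrite /J /= in_itv /= s0.
    exact/ltW/truncnS_gt.
  by rewrite /J /= in_itv /= => /andP[s0 _]; split => //; rewrite leey.
have mJ n : measurable (J n) by exact: measurable_itv.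
have mh n : measurable_fun (J n) (fun s => (expR (alpha * xi s))%:E).
  apply/measurable_EFinP; apply: right_continuous_measurable_itv.
    exact: expR_lamperti_right_continuous.
  by move=> s /=; rewrite in_itv /= => /andP[].
have h0 (s : R) : (0 <= (expR (alpha * xi s))%:E)%E by rewrite lee_fin expR_ge0.
have JE n : (\int[@lebesgue_measure R]_(s in J n) (expR (alpha * xi s))%:E =
    (psi n%:R)%:E)%E.
  rewrite -phi_lamperti//; congr (integral _ _ _); apply/seteqP.
  by split => s /=; rewrite /J /= in_itv /= lee_fin => /andP.
have mUJ : measurable_fun (\bigcup_n J n) (fun s => (expR (alpha * xi s))%:E).
  by apply/measurable_fun_bigcup.
split=> [|xt].
  case E : (x t) => [//|]; rewrite ltNge; apply: contraNT => _.
  rewrite /phi UJ; have ndJ : nondecreasing_seq J.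
    move=> m n mn; rewrite subsetEset => s; rewrite /J /= !in_itv /= => /andP[-> sm] /=.
    by apply: (le_trans sm); rewrite ler_nat.
  have cJ := ge0_nondecreasing_set_cvg_integral (mu := @lebesgue_measure R)
    ndJ mJ mh (fun _ s _ => h0 s).
  have /cvg_lim <- // := cJ; apply: lime_le; first by apply/cvg_ex; exists
    (\int[@lebesgue_measure R]_(s in \bigcup_n J n) (expR (alpha * xi s))%:E)%E.
  apply: nearW => n; rewrite JE lee_fin leNgt; apply/negP => /ltW tn.
  have [_ xn _] := x_psi (ler0n R n).
  by have := alive_le hx t0 tn xn; rewrite E.
(* A slightly later living time [t'] provides the strict inequality. *)
have [e e0 He] := alive_right hx t0 xt; pose t' := t + e / 2.
have t'0 : 0 <= t' by rewrite /t'; lra.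
have xt' : x t' by apply: He; rewrite /t'; lra.
have [n nt] : exists n, clock alpha x t' <= n%:R :> R.
  by exists (Num.truncn (clock alpha x t')).+1; exact/ltW/truncnS_gt.
apply: (@lt_le_trans _ _ (psi n%:R)%:E).
  rewrite lte_fin; apply: (@lt_le_trans _ _ t'); first by rewrite /t'; lra.
  rewrite -[leLHS](clock_invK alpha hx t'0 xt').
  by apply: clock_inv_le => //; [exact: clock_ge0|exact: full].
rewrite -JE /phi UJ; apply: ge0_subset_integral => //.
- exact: mJ.
- by apply: bigcupT_measurable => m; exact: mJ.
- by move=> s Js; exists n.
Qed.

Lemma lamperti_phi_inv t : 0 <= t -> x t -> Some (xi (phi_inv alpha xi t)) = x t.
Proof.
move=> t0 xt; rewrite phi_inv_lamperti// /path_val lamperti_clock//.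
by case: (x t) xt.
Qed.

End inverse_clock.

(** * Killing of the time-changed path forces large values on fine grids *)

Section explosion.
Variables (R : realType) (alpha : R) (x : R -> option R).
Hypothesis hx : real_path x.

(* The path leaves every bounded set before its clock stops, since otherwise it
   would neither die nor slow down. *)
Lemma unreached_unbounded s : x 0 -> 0 <= s -> ~ reached alpha x s -> forall K,
  exists u, reached alpha x u /\ K < `|path_val (lamperti alpha x) u|.
Proof.
move=> x0 s0 nrs K; apply: contrapT => H.
have HK t r : 0 <= t -> x t = Some r -> `|r| <= K.
  move=> t0 xt; rewrite leNgt; apply/negP => Kr; apply: H.
  have xt' : x t by rewrite xt.
  exists (clock alpha x t); split; first by exists t.
  by rewrite /path_val lamperti_clock// xt.
have /isSomeP[r0 x0r] := x0.
have alive t : 0 <= t -> x t.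
  move=> t0; case xt : (x t) => //.
  have [u [r [u0 xu Kr]]] := real_path_death hx t0 x0r xt K.
  by have := HK _ _ u0 xu; rewrite leNgt Kr.
pose m := expR (- (`|alpha| * K)); have m0 : 0 < m by exact: expR_gt0.
apply: nrs; have T0 : 0 <= s / m by rewrite divr_ge0// ltW.
have := clock_increment_ge (alpha := alpha) (m := m) hx (lexx (0 : R)) T0 (alive _ T0).
rewrite subr0 clock0 subr0 [m * _]mulrC mulfVK ?gt_eqF// => sT.
have [|t [t0 tT xt ct]] := clock_IVT (alpha := alpha) hx T0 (alive _ T0) s0 (sT _); last by exists t.
move=> u u0 uT; have /isSomeP[r xu] := alive _ u0.
rewrite /speed xu ler_expR.
have := ler_wpM2l (normr_ge0 alpha) (HK _ _ u0 xu).
by rewrite -normrM ler_norml; lra.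
Qed.

Lemma reached_right u K : reached alpha x u -> K < `|path_val (lamperti alpha x) u| ->
  exists2 d, 0 < d & forall w, u <= w -> w < u + d ->
    reached alpha x w /\ K < `|path_val (lamperti alpha x) w|.
Proof.
move=> ru; rewrite /path_val lampertiE// => Ku.
have [p0 xp _] := clock_inv_spec ru; have /isSomeP[r xr] := xp.
rewrite xr in Ku; have e0 : 0 < (`|r| - K) / 2 by lra.
have [d d0 Hd] := real_path_right hx p0 xr e0.
have [h h0 Hh] := clock_inv_right hx ru d0.
exists h => // w uw wh; have [rw pw pw'] := Hh _ uw wh; split => //.
rewrite lampertiE//; have [r' -> H] := Hd _ pw pw'.
by have := ler_normD r' (r - r'); rewrite subrKC distrC; lra.
Qed.

(** A value above [K] persists on an interval [[u, u + d[] by right-continuity, and a grid of mesh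
    [h < d] has its first point after [u] in that interval. *)
Lemma lamperti_explosion s K : x 0 -> 0 <= s -> ~ reached alpha x s ->
  exists2 d, 0 < d & forall h, 0 < h -> h < d -> exists j : nat,
    reached alpha x (j%:R * h) /\ K < `|path_val (lamperti alpha x) (j%:R * h)|.
Proof.
move=> x0 s0 nrs; have [u [ru Ku]] := unreached_unbounded x0 s0 nrs K.
have [d d0 Hd] := reached_right ru Ku; exists d => // h h0 hd.
have u0 : 0 <= u by exact: (reached_ge0 hx ru).
exists (Num.truncn (u / h)).+1.
have /andP[] := @truncn_itv _ (u / h) ltac:(by rewrite divr_ge0// ltW).
rewrite ler_pdivlMr// ltr_pdivrMr// -natr1 => h1 h2.
by apply: Hd; nra.
Qed.

End explosion.

(** * The measurable space of killed real paths *)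

Definition rpath (R : realType) := {x : R -> option R | real_path x}.

Lemma real_path_cst (R : realType) : real_path (fun=> Some 0 : option R).
Proof.
split=> //.
- by move=> t r _ [<-] e e0; exists 1 => // u _ _; exists 0; rewrite ?subrr ?normr0 ?ltW.
- by move=> t r _ _; exists 0 => e e0; exists 1 => // u *; exists 0; rewrite ?subrr ?normr0 ?ltW.
- by move=> t r _ _; exists 0 => u _ _; exists 0; rewrite ?normr0.
Qed.

HB.instance Definition _ (R : realType) := gen_eqMixin (rpath R).
HB.instance Definition _ (R : realType) := gen_choiceMixin (rpath R).
HB.instance Definition _ (R : realType) :=
  isPointed.Build (rpath R) (exist _ _ (real_path_cst R)).

Definition coord (R : realType) (p : rpath R) : R -> option R := sval p.

Definition cylinders (R : realType) : set (set (rpath R)) :=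
  [set A | exists (s : R) (B : set (option R)),
     [/\ 0 <= s, borel_state B & A = [set p | B (coord p s)]]].

Definition cylinders_upto (R : realType) (t : R) : set (set (rpath R)) :=
  [set A | exists (s : R) (B : set (option R)),
     [/\ 0 <= s, s <= t, borel_state B & A = [set p | B (coord p s)]]].

Definition path_space (R : realType) : measurableType _ :=
  g_sigma_algebraType (@cylinders R).

(** The same paths with a smaller sigma-algebra: measurability in this type expresses membership in
    the filtration of the coordinates at time [t]. *)
Definition path_upto (R : realType) (t : R) : measurableType _ :=
  g_sigma_algebraType (@cylinders_upto R t).

Section path_space.
Variables (R : realType) (alpha : R).
Implicit Types (p : rpath R) (s t u z : R).

Lemma coordP p : real_path (coord p). Proof. exact: (svalP p). Qed.

Lemma upto_measurable t (A : set (rpath R)) :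
  measurable (A : set (path_upto t)) -> measurable (A : set (path_space R)).
Proof.
apply: (@sub_smallest2r _ (sigma_algebra setT) (@cylinders_upto R t) (@cylinders R)).
  exact: smallest_sigma_algebra.
by move=> _ [s [B [s0 st mB ->]]]; exists s, B.
Qed.

Lemma upto_le s t (A : set (rpath R)) : s <= t ->
  measurable (A : set (path_upto s)) -> measurable (A : set (path_upto t)).
Proof.
move=> st.
apply: (@sub_smallest2r _ (sigma_algebra setT) (@cylinders_upto R s) (@cylinders_upto R t)).
  exact: smallest_sigma_algebra.
move=> _ [u [B [u0 us mB ->]]]; exists u, B; split => //.
exact: le_trans st.
Qed.

Lemma measurable_coord s (B : set (option R)) : 0 <= s -> borel_state B ->
  measurable ([set p | B (coord p s)] : set (path_space R)).
Proof. by move=> s0 mB; apply: sub_sigma_algebra; exists s, B. Qed.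

Lemma measurable_coord_upto s t (B : set (option R)) : 0 <= s -> s <= t -> borel_state B ->
  measurable ([set p | B (coord p s)] : set (path_upto t)).
Proof. by move=> s0 st mB; apply: sub_sigma_algebra; exists s, B. Qed.

Lemma borel_state_alive : borel_state [set o : option R | o].
Proof. by rewrite /borel_state (_ : _ @^-1` _ = setT)//; apply/seteqP; split. Qed.

Lemma measurable_alive_upto s t : 0 <= s -> s <= t ->
  measurable ([set p | isSome (coord p s)] : set (path_upto t)).
Proof. by move=> s0 st; exact: (measurable_coord_upto s0 st borel_state_alive). Qed.

Lemma measurable_speed_upto s t : 0 <= s -> s <= t ->
  measurable_fun setT (fun p : path_upto t => speed alpha (coord p) s).
Proof.
move=> s0 st _ B mB; rewrite setTI.
apply: (@measurable_coord_upto s t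
  [set o | B (if o is Some r then expR (- alpha * r) else 0)]) => //.
rewrite /borel_state.
have mf : measurable_fun setT (fun r : R => expR (- alpha * r)).
  by apply: measurableT_comp => //; exact: measurable_funM.
by have := mf measurableT B mB; rewrite setTI.
Qed.

(** Freezing the speed at time [t] keeps the process right-continuous and all its values in the past
    of [t], so that joint measurability and Tonelli's theorem apply inside [path_upto t]. *)
Lemma measurable_clock_upto t : 0 <= t ->
  measurable_fun setT (fun p : path_upto t => clock alpha (coord p) t).
Proof.
move=> t0.
pose Y (p : path_upto t) u := speed alpha (coord p) (Num.min u t).
have mY u : 0 <= u -> measurable_fun setT (Y ^~ u).
  by move=> u0; apply: measurable_speed_upto; rewrite ?le_min ?u0// ge_min lexx orbT.
have rY p u : 0 <= u -> right_continuous_at (Y p) u.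
  move=> u0 e e0; rewrite /Y; have [ut|tu] := leP t u.
    exists 1 => // v uv _; rewrite min_r ?(le_trans ut)// subrr normr0 ltW//.
  have [d d0 Hd] := speed_right_continuous alpha (coordP p) u0 e0.
  exists (Num.min d (t - u)); first by rewrite lt_min d0 subr_gt0.
  move=> v uv vd.
  have m1 : Num.min d (t - u) <= d by rewrite ge_min lexx.
  have m2 : Num.min d (t - u) <= t - u by rewrite ge_min lexx orbT.
  by rewrite min_l ?Hd//; lra.
have mj := right_continuous_jointly_measurable mY rY.
pose f (q : path_upto t * R) := (Y q.1 (Num.max 0 q.2) * \1_(`[0, t]%classic) q.2)%:E.
have mf : measurable_fun setT f.
  apply/measurable_EFinP; apply: measurable_funM => //.
  by apply: measurableT_comp => //; apply: measurable_indic; exact: measurable_itv.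
have f0 q : (0 <= f q)%E.
  rewrite lee_fin mulr_ge0// /Y /speed; case: (coord _ _) => // r; exact: expR_ge0.
have := measurable_fun_fubini_tonelli_F (m2 := @lebesgue_measure R) f mf f0.
move=> mF; rewrite (_ : (fun _ => _) = fine \o fubini_F (@lebesgue_measure R) f).
  exact: measurableT_comp.
apply/funext => p /=; rewrite /clock /Rintegral /fubini_F; congr fine.
rewrite integral_mkcond; apply: eq_integral => u _.
rewrite /f patchE /= mem_setE indicE in_itv /= mem_setE in_itv /=.
case: ifPn => [/andP[u0 ut]|]; last by rewrite mulr0.
by rewrite mulr1 /Y max_r// min_l.
Qed.

(** If the path is alive at [t], compare its clock at [t] with [s]. If it is dead at [t], the clock
    attains [s] strictly before death, hence is at least [s] at some living grid point [q n j <= t].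
    Both cases use only the past of [t], and the union over grids is countable. *)
Lemma clock_inv_stopping s t : 0 <= s -> 0 <= t ->
  measurable ([set p | reached alpha (coord p) s /\ clock_inv alpha (coord p) s <= t]
    : set (path_upto t)).
Proof.
move=> s0 t0.
pose A u := [set p : rpath R | coord p u /\ s <= clock alpha (coord p) u].
have mA u : 0 <= u -> u <= t -> measurable (A u : set (path_upto t)).
  move=> u0 ut; apply: (upto_le ut).
  apply: measurableI; first exact: measurable_alive_upto.
  have := measurable_clock_upto u0.
  move=> /(_ measurableT `[s, +oo[%classic (measurable_itv _)); rewrite setTI.
  by congr (measurable _); apply/seteqP; split => p /=; rewrite in_itv /= andbT.
pose q n j : R := j%:R / n.+1%:R.
rewrite (_ : [set _ | _] = A t `|` ((~` [set p | isSome (coord p t)]) `&`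
    \bigcup_n \bigcup_(j in [set j | q n j <= t]) A (q n j))); last first.
  apply/seteqP; split => p /=.
    move=> [rs pt]; have hp := coordP p.
    have [v0 xv cv] := clock_inv_spec rs; set v := clock_inv _ _ _ in pt v0 xv cv.
    case xt : (isSome (coord p t)).
      by left; split => //; rewrite -cv; exact: clock_le.
    right; split => //.
    (* The path is alive at [v] and dead at [t], so there is room for a grid point between them. *)
    have vt : v < t.
      by rewrite lt_neqAle pt andbT; apply/eqP => E; rewrite E xt in xv.
    have [d d0 Hd] := alive_right hp v0 xv.
    pose e := Num.min d (t - v).
    have e0 : 0 < e by rewrite lt_min d0 subr_gt0.
    have e1 : e <= d by rewrite ge_min lexx.
    have e2 : e <= t - v by rewrite ge_min lexx orbT.
    pose n := Num.truncn (e^-1).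
    have nE : n.+1%:R^-1 < e.
      rewrite invf_plt ?posrE//.
      exact: truncnS_gt.
    pose j := (Num.truncn (v * n.+1%:R)).+1.
    have /andP[j1 j2] := @truncn_itv _ (v * n.+1%:R) ltac:(by rewrite mulr_ge0).
    have q1 : v < q n j by rewrite /q ltr_pdivlMr.
    have q2 : q n j <= v + n.+1%:R^-1.
      have -> : q n j = ((Num.truncn (v * n.+1%:R))%:R + 1) / n.+1%:R by rewrite /q /j -[in LHS]natr1.
      by rewrite ler_pdivrMr// mulrDl mulVf// lerD2r.
    have q3 : q n j < v + e by apply: (le_lt_trans q2); rewrite ltrD2l.
    have qt : q n j <= t by move: (q n j) q3 => w; lra.
    have qd : q n j < v + d by move: (q n j) q3 => w; lra.
    have xq : coord p (q n j) by apply: Hd => //; exact: ltW.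
    exists n => //; exists j => //.
    by split => //; rewrite -cv; apply: clock_le => //; exact: ltW.
  have hp := coordP p.
  move=> [[xt st]|[_ [n _ [j qt [xq sq]]]]].
    by apply/(clock_inv_le_iff alpha hp t0 xt s0).
  have q0 : 0 <= q n j by rewrite divr_ge0.
  have [rs ps] := (clock_inv_le_iff alpha hp q0 xq s0).2 sq.
  by split => //; exact: le_trans qt.
apply: measurableU; first exact: mA.
apply: measurableI.
  by apply: measurableC; exact: measurable_alive_upto.
apply: bigcup_measurable => n _; apply: bigcup_measurable => j jt.
by apply: mA => //; rewrite divr_ge0.
Qed.

(** The value 0 where [s] is not reached makes this a finite sampling time, usable for all paths. *)
Definition random_time s p : R :=
  if `[< reached alpha (coord p) s >] then clock_inv alpha (coord p) s else 0.

Lemma random_time_ge0 s p : 0 <= random_time s p.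
Proof. by rewrite /random_time; case: asboolP => // /clock_inv_spec[]. Qed.

Lemma measurable_reached s : 0 <= s ->
  measurable ([set p | reached alpha (coord p) s] : set (path_space R)).
Proof.
move=> s0; rewrite (_ : [set _ | _] =
  \bigcup_n [set p | reached alpha (coord p) s /\ clock_inv alpha (coord p) s <= n%:R]).
  apply: bigcup_measurable => n _; apply: (@upto_measurable n%:R).
  exact: clock_inv_stopping.
apply/seteqP; split => [p rs|p [n _ []]//].
have [p0 _ _] := clock_inv_spec rs.
exists (Num.truncn (clock_inv alpha (coord p) s)).+1 => //; split => //=.
exact/ltW/truncnS_gt.
Qed.

Lemma measurable_random_time s : 0 <= s ->
  measurable_fun setT (random_time s : path_space R -> R).
Proof.
move=> s0 mD; apply: (measurability _ (RGenOInfty.measurableE R)) => //.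
move=> _ [_ [a ->] <-]; rewrite setTI.
rewrite (_ : _ @^-1` _ = if 0 <= a then [set p | reached alpha (coord p) s] `&`
  ~` [set p | reached alpha (coord p) s /\ clock_inv alpha (coord p) s <= a] else setT).
  case: leP => a0; last exact: measurableT.
  apply: measurableI; first exact: measurable_reached.
  by apply: measurableC; apply: (@upto_measurable a); exact: clock_inv_stopping.
apply/seteqP; case: leP => a0; split => p //=; rewrite in_itv /= andbT.
- rewrite /random_time; case: asboolP => [rs ap|_]; last by rewrite ltNge a0.
  by split => // -[_]; rewrite leNgt ap.
- by move=> [rs nps]; rewrite /random_time asboolT// ltNge; apply/negP => ?; exact: nps.
- by move=> _; apply: (lt_le_trans a0); exact: random_time_ge0.
Qed.

End path_space.

(** * Measurability of sampling, time change, shift and scaling *)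

Section path_maps.
Variables (R : realType) (alpha : R).
Implicit Types (p : path_space R) (s t u z : R).

Lemma measurable_path_val s : 0 <= s ->
  measurable_fun setT (fun p : path_space R => path_val (coord p) s).
Proof.
move=> s0 _ B mB; rewrite setTI.
apply: (@measurable_coord _ s [set o | B (if o is Some r then r else 0)]) => //.
Qed.

Lemma measurable_alive s : 0 <= s ->
  measurable ([set p : path_space R | isSome (coord p s)] : set (path_space R)).
Proof. by move=> s0; exact: (measurable_coord s0 (@borel_state_alive R)). Qed.

Section random_sampling.
Variable tau : path_space R -> R.
Hypothesis mtau : measurable_fun setT tau.
Hypothesis tau0 : forall p, 0 <= tau p.

Let measurable_sample (Y : path_space R -> R -> R) :
  (forall u, 0 <= u -> measurable_fun setT (Y ^~ u)) ->
  (forall p u, 0 <= u -> right_continuous_at (Y p) u) ->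
  measurable_fun setT (fun p => Y p (tau p)).
Proof.
move=> mY rY; have mj := right_continuous_jointly_measurable mY rY.
have mp : measurable_fun setT (fun p => (p, tau p)) by exact: measurable_fun_pair.
have := measurableT_comp mj mp; apply: eq_measurable_fun => p _ /=.
by rewrite max_r.
Qed.

Lemma measurable_path_val_at : measurable_fun setT (fun p => path_val (coord p) (tau p)).
Proof.
apply: (measurable_sample (Y := fun p => path_val (coord p))); first exact: measurable_path_val.
by move=> p u; apply: path_val_right_continuous; exact: coordP.
Qed.

(** Being alive, coded by 0 or 1, is a right-continuous process: life persists a little to the
    right, and death is absorbing. It can thus be sampled at [tau] like the values. *)
Lemma measurable_alive_at : measurable [set p : path_space R | isSome (coord p (tau p))].
Proof.
have : measurable_fun setT (fun p => (isSome (coord p (tau p)))%:R : R).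
  apply: (measurable_sample (Y := fun p u => (isSome (coord p u))%:R)).
    move=> u u0; rewrite (_ : (fun _ => _) = \1_[set p : path_space R | isSome (coord p u)]).
      by apply: measurable_indic; exact: measurable_alive.
    by apply/funext => p; rewrite indicE mem_setE.
  move=> p u u0 e e0; case E : (coord p u) => [r|].
    have [|d d0 Hd] := alive_right (coordP p) u0; first by rewrite E.
    by exists d => // v uv vd; rewrite Hd// subrr normr0 ltW.
  exists 1 => // v uv _.
  by rewrite (real_path_dead (coordP p) u0 uv E) subrr normr0 ltW.
move=> /(_ measurableT `[1, +oo[%classic (measurable_itv _)); rewrite setTI.
congr (measurable _); apply/seteqP; split => p /=; rewrite in_itv /= andbT;
  by case: isSome => //; rewrite ler10.
Qed.

Lemma measurable_coord_at (B : set (option R)) : borel_state B ->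
  measurable [set p : path_space R | B (coord p (tau p))].
Proof.
move=> mB; rewrite (_ : [set _ | _] =
  ([set p : path_space R | isSome (coord p (tau p))] `&`
     (fun p => path_val (coord p) (tau p)) @^-1` (Some @^-1` B)) `|`
  (~` [set p : path_space R | isSome (coord p (tau p))] `&` [set p : path_space R | B None])); last first.
  apply/seteqP; split => p /=; rewrite /path_val.
    by case: (coord p (tau p)) => [r|] Bp; [left|right].
  by case: (coord p (tau p)) => [r|] [[]|[]].
apply: measurableU; apply: measurableI.
- exact: measurable_alive_at.
- by apply: measurable_preimage => //; exact: measurable_path_val_at.
- by apply: measurableC; exact: measurable_alive_at.
- have [b|b] := pselect (B None).
    by rewrite (_ : [set _ | _] = setT)//; apply/seteqP; split.
  by rewrite (_ : [set _ | _] = set0)//; apply/seteqP; split.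
Qed.

End random_sampling.

Local Notation reach p s := (reached alpha (coord p) s).

Lemma random_timeE s p : reach p s ->
  random_time alpha s p = clock_inv alpha (coord p) s.
Proof. by move=> rs; rewrite /random_time asboolT. Qed.

Lemma measurable_lamperti s (B : set (option R)) : 0 <= s -> borel_state B ->
  measurable ([set p : path_space R | B (lamperti alpha (coord p) s)] : set (path_space R)).
Proof.
move=> s0 mB; rewrite (_ : [set _ | _] =
  ([set p : path_space R | reach p s] `&` [set p : path_space R | B (coord p (random_time alpha s p))]) `|`
  (~` [set p : path_space R | reach p s] `&` [set p : path_space R | B None])); last first.
  apply/seteqP; split => p /=; rewrite /lamperti /random_time;
    case: asboolP => rs Bp; [by left|by right|..].
    by case: Bp => -[].
  by case: Bp => -[].
have mr := measurable_reached alpha s0.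
apply: measurableU; apply: measurableI => //.
- by apply: measurable_coord_at => //; [exact: measurable_random_time|exact: random_time_ge0].
- exact: measurableC.
- have [b|b] := pselect (B None).
    by rewrite (_ : [set _ | _] = setT)//; apply/seteqP; split.
  by rewrite (_ : [set _ | _] = set0)//; apply/seteqP; split.
Qed.

Lemma measurable_lamperti_val s : 0 <= s -> measurable_fun setT
  (fun p : path_space R => path_val (lamperti alpha (coord p)) s).
Proof.
move=> s0 _ B mB; rewrite setTI.
by apply: (@measurable_lamperti s [set o | B (if o is Some r then r else 0)]).
Qed.

(** Paths that do not reach [s] are left unchanged, only to have a total map; the Markov property
    below always intersects with [reached]. *)
Definition shift_at s (p : rpath R) : rpath R :=
  if pselect (reach p s) is left rs then
    let: And3 p0 xp _ := clock_inv_spec rs in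
    exist _ _ (real_path_shift (coordP p) p0 xp)
  else p.

Lemma coord_shift_at s p : reach p s ->
  coord (shift_at s p) = shift_path (clock_inv alpha (coord p) s) (coord p).
Proof.
by move=> rs; rewrite /shift_at; case: pselect => // rs'; case: clock_inv_spec.
Qed.

Definition scale_at z (p : rpath R) : rpath R :=
  exist _ _ (real_path_scale alpha z (coordP p)).

Lemma coord_scale_at z p : coord (scale_at z p) = scale_path alpha z (coord p).
Proof. by []. Qed.

Lemma measurable_to_path_space d (T : measurableType d) (F : T -> path_space R) :
  (forall s B, 0 <= s -> borel_state B -> measurable [set w | B (coord (F w) s)]) ->
  measurable_fun setT F.
Proof.
move=> H; apply: (@measurability _ _ T (path_space R) setT F (@cylinders R) erefl) => _ [_ [s [B [s0 mB ->]]] <-].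
by rewrite setTI; exact: H.
Qed.

Lemma measurable_shift_at s : 0 <= s ->
  measurable_fun setT (shift_at s : path_space R -> path_space R).
Proof.
move=> s0; apply: measurable_to_path_space => u B u0 mB.
rewrite (_ : [set _ | _] =
  ([set p : path_space R | reach p s] `&` [set p : path_space R | B (coord p (random_time alpha s p + u))]) `|`
  (~` [set p : path_space R | reach p s] `&` [set p : path_space R | B (coord p u)])); last first.
  apply/seteqP; split => p /=.
    have [rs|rs] := pselect (reach p s); last first.
      by rewrite /shift_at; case: pselect => // _ ?; right.
    by rewrite coord_shift_at// /shift_path => Bp; left; rewrite random_timeE.
  move=> [[rs]|[rs]]; first by rewrite coord_shift_at// random_timeE.
  by rewrite /shift_at; case: pselect.
have mr := measurable_reached alpha s0.
apply: measurableU; apply: measurableI => //.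
- apply: measurable_coord_at => //.
    by apply: measurable_funD => //; exact: measurable_random_time.
  by move=> p; rewrite addr_ge0// random_time_ge0.
- exact: measurableC.
- exact: measurable_coord.
Qed.

Lemma measurable_scale_at z :
  measurable_fun setT (scale_at z : path_space R -> path_space R).
Proof.
apply: measurable_to_path_space => u B u0 mB.
rewrite (_ : [set _ | _] =
  [set p : path_space R | [set o | B (omap (fun r => r + z) o)] (coord p (expR (- alpha * z) * u))])//.
apply: measurable_coord; first by rewrite mulr_ge0// expR_ge0.
have mf : measurable_fun setT (fun r : R => r + z) by exact: measurable_funD.
by have := mf measurableT _ mB; rewrite setTI.
Qed.

End path_maps.

Section path_space_induction.
Variable R : realType.

Definition fdd_cylinder n (s : 'I_n -> R) (B : 'I_n -> set (option R)) :
  set (path_space R) := [set p : path_space R | forall i, B i (coord p (s i))].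

(** The pi-lambda theorem: finite-dimensional cylinders generate the sigma-algebra, and two of them
    intersect in a third, indexed by the concatenated times. *)
Lemma path_space_induction (H : set (set (path_space R))) : dynkin H ->
  (forall n (s : 'I_n -> R) B, (forall i, 0 <= s i) -> (forall i, borel_state (B i)) ->
    H (fdd_cylinder s B)) ->
  forall A, measurable A -> H A.
Proof.
move=> dH HC.
pose G : set (set (path_space R)) := [set A | exists n (s : 'I_n -> R) B,
  [/\ forall i, 0 <= s i, forall i, borel_state (B i) & A = fdd_cylinder s B]].
have GI : setI_closed G.
  move=> _ _ [n [s [B [s0 mB ->]]]] [m [t [C [t0 mC ->]]]].
  exists (n + m)%N, (fun i : 'I_(n + m) => match fintype.split i with inl j => s j | inr j => t j end),
    (fun i : 'I_(n + m) => match fintype.split i with inl j => B j | inr j => C j end); split.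
  - by move=> i; case: (fintype.split i).
  - by move=> i; case: (fintype.split i).
  - apply/seteqP; split => p.
      by move=> [Bp Cp] i /=; case: (fintype.split i).
    move=> Hp; split => i.
      by have := Hp (lshift m i); rewrite -[lshift m i]/(unsplit (inl i)) unsplitK.
    by have := Hp (rshift n i); rewrite -[rshift n i]/(unsplit (inr i)) unsplitK.
have GH : G `<=` H by move=> _ [n [s [B [s0 mB ->]]]]; exact: HC.
have GT : <<s G >> `<=` H.
  apply: (@lambda_system_subset _ G GI setT H) => //.
  exact/dynkin_lambda_system.
move=> A mA; apply: GT; move: A mA.
apply: (@sub_smallest2r _ (sigma_algebra setT) (@cylinders R) G).
  exact: smallest_sigma_algebra.
move=> _ [s [B [s0 mB ->]]]; exists 1%N, (fun=> s), (fun=> B); split => //.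
by apply/seteqP; split => p; [move=> Bp i|move=> /(_ ord0)].
Qed.

End path_space_induction.

(** * Probabilities as real numbers *)

Section real_valued_probability.
Context (R : realType) d (T : measurableType d) (P : probability T R).
Implicit Types A B : set T.

Definition pr A : R := fine (P A).

Lemma prE A : measurable A -> P A = (pr A)%:E.
Proof. by move=> mA; rewrite fineK// fin_num_measure. Qed.

Lemma pr_ge0 A : 0 <= pr A. Proof. exact: fine_ge0. Qed.

Lemma prT : pr setT = 1. Proof. by rewrite /pr probability_setT. Qed.

Lemma pr0 : pr set0 = 0. Proof. by rewrite /pr measure0. Qed.

Lemma pr_le A B : measurable A -> measurable B -> A `<=` B -> pr A <= pr B.
Proof. by move=> mA mB AB; rewrite -lee_fin -!prE// le_measure// inE. Qed.

Lemma pr_le1 A : measurable A -> pr A <= 1.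
Proof. by move=> mA; rewrite -prT pr_le. Qed.

Lemma prID A B : measurable A -> measurable B -> pr A = pr (A `&` B) + pr (A `\` B).
Proof.
move=> mA mB; apply: EFin_inj; rewrite EFinD.
rewrite -(prE mA) -(prE (measurableI _ _ mA mB)) -(prE (measurableD mA mB)).
by rewrite addeC; exact: measureDI.
Qed.

Lemma prC A : measurable A -> pr (~` A) = 1 - pr A.
Proof.
by move=> mA; rewrite -prT (prID measurableT mA) setTI setTD [X in X - _]addrC addrK.
Qed.

Lemma pr_full A B : measurable A -> measurable B -> pr B = 1 -> pr (A `&` B) = pr A.
Proof.
move=> mA mB B1; rewrite (prID mA mB).
suff -> : pr (A `\` B) = 0 by rewrite addr0.
apply/eqP; rewrite eq_le pr_ge0 andbT.
have -> : 0 = pr (~` B) by rewrite prC// B1 subrr.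
by apply: pr_le; [exact: measurableD|exact: measurableC|exact: subDsetr].
Qed.

Lemma pr_bigcup0 (F : (set T)^nat) : (forall n, measurable (F n)) ->
  (forall n, pr (F n) = 0) -> pr (\bigcup_n F n) = 0.
Proof.
move=> mF F0; have mU : measurable (\bigcup_n F n) by exact: bigcup_measurable.
have : P.-negligible (\bigcup_n F n).
  apply: negligible_bigcup => n; apply/negligibleP => //.
  by have := prE (mF n); rewrite F0.
by move=> /(negligibleP P mU) P0; rewrite /pr (_ : P _ = 0%E).
Qed.

Lemma pr_bigsetU (F : (set T)^nat) n : (forall i, measurable (F i)) ->
  trivIset setT F -> pr (\big[setU/set0]_(i < n) F i) = \sum_(i < n) pr (F i).
Proof.
move=> mF tF; apply: EFin_inj; rewrite -sumEFin -prE; last exact: bigsetU_measurable.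
rewrite (measure_bigsetU P mF tF n).
by apply: eq_bigr => i _; exact: prE.
Qed.

(** Continuity from above, in the form used on the killing events: a uniform lower bound along a
    vanishing sequence of events cannot be positive. *)
Lemma pr_nincr_cvg0 (F : (set T)^nat) (c : R) : (forall n, measurable (F n)) ->
  {homo F : n m / (n <= m)%N >-> m `<=` n} -> \bigcap_n F n = set0 ->
  (forall n, c <= pr (F n)) -> c <= 0.
Proof.
move=> mF dF F0 cF.
have P0 : (P (F 0%N) < +oo)%E by rewrite (prE (mF 0%N)) ltry.
have : P (F n) @[n --> \oo] --> P (\bigcap_n F n).
  apply: nonincreasing_cvg_mu => //.
  - by rewrite F0.
  - by move=> n m nm; apply/subsetPset; exact: dF.
rewrite F0 measure0 => cvF; rewrite -lee_fin.
apply: (cvge_ge _ cvF); apply: nearW => n.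
by rewrite prE// lee_fin.
Qed.

End real_valued_probability.

(** * From scaling and the Markov property to independent stationary increments without killing *)

Section levy.
Variables (R : realType) (alpha : R) (Q : R -> probability (path_space R) R).

Local Notation reach s := [set p : path_space R | reached alpha (coord p) s].
Local Notation val s := (fun p : path_space R => path_val (lamperti alpha (coord p)) s).
Local Notation shift := (shift_at alpha : R -> path_space R -> path_space R).
Local Notation scale := (scale_at alpha : R -> path_space R -> path_space R).

Hypothesis Q_start : forall z,
  pr (Q z) [set p : path_space R | coord p 0 = Some z] = 1.
Hypothesis Q_kernel : forall A, measurable A ->
  measurable_fun setT (fun z => Q z A).
Hypothesis Q_scale : forall z A, measurable A -> Q z A = Q 0 (scale z @^-1` A).
Hypothesis Q_Markov : forall s z A, 0 <= s -> measurable A ->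
  Q z (reach s `&` shift s @^-1` A) = (\int[Q z]_(p in reach s) Q (val s p) A)%E.

Let start z := [set p : path_space R | coord p 0 = Some z].

Let mstart z : measurable (start z).
Proof.
apply: (@measurable_coord _ 0 [set Some z]) => //.
rewrite /borel_state (_ : _ @^-1` _ = [set z]); first exact: measurable_set1.
by apply/seteqP; split => r /= [->].
Qed.

Let mreach s : 0 <= s -> measurable (reach s).
Proof. exact: measurable_reached. Qed.

Let mval s (B : set R) : 0 <= s -> measurable B -> measurable (val s @^-1` B).
Proof.
by move=> s0; apply: measurable_preimage; exact: measurable_lamperti_val.
Qed.

Lemma measurable_increment s t (B : set R) : 0 <= s -> 0 <= t -> measurable B ->
  measurable [set p : path_space R | B (val t p - val s p)].
Proof.
move=> s0 t0; apply: measurable_preimage; apply: measurable_funB;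
  exact: measurable_lamperti_val.
Qed.

Let mshift s A : 0 <= s -> measurable A -> measurable (shift s @^-1` A).
Proof.
by move=> s0; apply: measurable_preimage; exact: measurable_shift_at.
Qed.

(** Paths with another starting point are negligible for [Q z], so events need to be compared only
    on [start z]. *)
Lemma start_ae z A B : measurable A -> measurable B ->
  (forall p, start z p -> A p <-> B p) -> pr (Q z) A = pr (Q z) B.
Proof.
move=> mA mB AB.
rewrite -(pr_full mA (mstart z) (Q_start z)) -(pr_full mB (mstart z) (Q_start z)).
by congr pr; apply/seteqP; split => p [? sp]; split => //; apply/AB.
Qed.

(** Such events have the same probability whatever the starting point, which turns the Markov
    property into independence. *)
Definition scale_invariant (A : set (path_space R)) :=
  forall z p, A (scale z p) <-> A p.

Lemma pr_scale_invariant z A : measurable A -> scale_invariant A ->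
  pr (Q z) A = pr (Q 0) A.
Proof.
move=> mA iA; rewrite /pr Q_scale//; congr (fine (Q _ _)).
by apply/seteqP; split => p /=; apply iA.
Qed.

Let coord0_shift s p : reach s p ->
  coord (shift s p) 0 = Some (val s p).
Proof.
move=> rs; rewrite coord_shift_at// /shift_path addr0 /path_val lampertiE//.
by have [_ + _] := clock_inv_spec rs; case: (coord p _).
Qed.

(** For the event [S] intersected with [A], the integrand of the Markov property is the indicator of
    [B] times the constant probability of [A], by scale invariance; the integral therefore
    factors. *)
Lemma Markov_factor s z (B : set R) A : 0 <= s -> measurable B ->
  measurable A -> scale_invariant A ->
  pr (Q z) (reach s `&` val s @^-1` B `&` shift s @^-1` A) =
  pr (Q z) (reach s `&` val s @^-1` B) * pr (Q 0) A.
Proof.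
move=> s0 mB mA iA.
(* The value at time [s] is the starting point of the shifted path, so the condition on it is moved
   into the shifted event. *)
pose S := [set p : path_space R | [set o : option R | isSome o /\ B (if o is Some r then r else 0)] (coord p 0)].
have mS : measurable S.
  apply: measurable_coord => //; rewrite /borel_state (_ : _ @^-1` _ = B)//.
  by apply/seteqP; split => r; [case|].
have mrB : measurable (reach s `&` val s @^-1` B).
  by apply: measurableI; [exact: mreach|exact: mval].
have E1 : reach s `&` val s @^-1` B `&` shift s @^-1` A =
    reach s `&` shift s @^-1` (S `&` A).
  apply/seteqP; split => p /=.
    by move=> [[rs vB] sA]; split => //; split => //; rewrite /S /= coord0_shift.
  by move=> [rs [+ sA]]; rewrite /S /= coord0_shift// => -[_ vB].
have QE y : Q y (S `&` A) = ((pr (Q 0) A)%:E * (\1_B y)%:E)%E.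
  rewrite prE; last exact: measurableI.
  rewrite -EFinM indicE; congr EFin; case: (boolP (y \in B)); rewrite ?inE ?notin_setE => By.
    rewrite mulr1 -(pr_scale_invariant y mA iA); apply: start_ae => //.
      exact: measurableI.
    by move=> p sp; rewrite /S /= sp; split => [[]|].
  rewrite mulr0 -(pr0 (Q y)); apply: start_ae => //; first exact: measurableI.
  by move=> p sp; rewrite /S /= sp; split => [[[]]|].
apply: EFin_inj; rewrite EFinM E1 -prE; last first.
  by apply: measurableI; [exact: mreach|apply: mshift => //; exact: measurableI].
rewrite Q_Markov//; last exact: measurableI.
under eq_integral do rewrite QE.
have mind : measurable_fun (reach s) (fun p : path_space R => (\1_B (val s p) : R)%:E).
  apply: measurableT_comp => //; apply: measurable_funTS.
  have mi : measurable_fun setT (\1_B : R -> R) by exact: measurable_indic.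
  exact: (measurableT_comp mi (measurable_lamperti_val alpha s0)).
rewrite (ge0_integralZl_EFin (Q z) (mreach s0) _ mind) ?pr_ge0//.
  rewrite muleC; congr (_ * _)%E.
  rewrite (_ : (fun _ => _) = (fun p => (\1_(val s @^-1` B) p)%:E)); last first.
    by apply/funext => p; rewrite !indicE; congr ((nat_of_bool _)%:R)%:E; apply/idP/idP; rewrite !inE.
  rewrite integral_indic; [|exact: mreach|exact: mval].
  by rewrite setIC; exact: prE.
Qed.

Lemma reach_le s t : 0 <= s -> s <= t -> reach t `<=` reach s.
Proof. by move=> s0 st p; exact: (reached_le (coordP p)). Qed.

Lemma reached_scale_at z s p : reach s (scale z p) <-> reach s p.
Proof.
rewrite /= -!lampertiP lamperti_scale; last exact: coordP.
by case: lamperti.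
Qed.

Lemma val_scale_at z s p : reach s p -> val s (scale z p) = val s p + z.
Proof.
move=> /lampertiP; rewrite /path_val /= lamperti_scale; last exact: coordP.
by case: lamperti.
Qed.

Lemma reached_shift_at s t p : 0 <= t -> reach s p ->
  reach t (shift s p) <-> reach (s + t) p.
Proof.
move=> t0 rs; rewrite /= -!lampertiP coord_shift_at// lamperti_shift//.
exact: coordP.
Qed.

Lemma val_shift_at s t p : 0 <= t -> reach s p -> val t (shift s p) = val (s + t) p.
Proof.
move=> t0 rs; rewrite /path_val coord_shift_at// lamperti_shift//.
exact: coordP.
Qed.

Definition survival s := pr (Q 0) (reach s).

Lemma invariant_reach s : scale_invariant (reach s).
Proof. by move=> z p; exact: reached_scale_at. Qed.

Lemma survival_Markov s A : 0 <= s -> measurable A -> scale_invariant A ->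
  pr (Q 0) (reach s `&` shift s @^-1` A) = survival s * pr (Q 0) A.
Proof.
move=> s0 mA iA; have := Markov_factor 0 s0 measurableT mA iA.
by rewrite preimage_setT setIT.
Qed.

Lemma survivalD s t : 0 <= s -> 0 <= t -> survival (s + t) = survival s * survival t.
Proof.
move=> s0 t0; rewrite -survival_Markov//; [|exact: mreach|exact: invariant_reach].
congr pr; apply/seteqP; split => p.
  move=> rst; have rs : reach s p by apply: reach_le rst => //; rewrite lerDl.
  by split => //; apply/reached_shift_at.
by move=> [rs /reached_shift_at]; apply.
Qed.

Lemma survival_le1 s : 0 <= s -> survival s <= 1.
Proof. by move=> s0; apply: pr_le1; exact: mreach. Qed.

Lemma survival_nincr s t : 0 <= s -> s <= t -> survival t <= survival s.
Proof.
move=> s0 st; apply: pr_le; [apply: mreach|exact: mreach|exact: reach_le].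
exact: le_trans st.
Qed.

Lemma survivalX t n : 0 <= t -> survival (n%:R * t) = survival t ^+ n.
Proof.
move=> t0; elim: n => [|n IH].
  rewrite mul0r expr0 -[RHS](Q_start 0); apply: start_ae => //.
    exact: mreach.
    exact: mstart.
  move=> p sp; split=> [_ //|_]; exists 0; rewrite clock0.
  by rewrite (sp : coord p 0 = Some 0).
by rewrite -natr1 mulrDl mul1r survivalD ?mulr_ge0// IH exprSr.
Qed.

(** Bounding the grid values only, not the whole path, makes the event decompose under the Markov
    property at grid times. *)
Let bounded_skeleton h K k : set (path_space R) :=
  [set p | reach (k%:R * h) p /\ forall j : nat, (j <= k)%N -> `|val (j%:R * h) p| <= K].

Let mbounded_skeleton h K k : 0 <= h -> measurable (bounded_skeleton h K k).
Proof.
move=> h0; rewrite (_ : bounded_skeleton h K k = reach (k%:R * h) `&`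
    \bigcap_(j in [set j : nat | (j <= k)%N]) (val (j%:R * h) @^-1` [set r | `|r| <= K])).
  apply: measurableI; first by apply: mreach; rewrite mulr_ge0.
  apply: bigcap_measurable => [|j _]; [by exists 0%N|apply: mval]; first by rewrite mulr_ge0.
  rewrite (_ : [set r | _] = `[- K, K]%classic); first exact: measurable_itv.
  by apply/seteqP; split => r /=; rewrite in_itv /= ler_norml.
by apply/seteqP; split.
Qed.

Let val0 z p : start z p -> val 0 p = z.
Proof.
move=> sp; rewrite /path_val lamperti0; [|exact: coordP|].
  by move: sp; rewrite /start /= => ->.
by move: sp; rewrite /start /= => ->.
Qed.

Let reach0 z p : start z p -> reach 0 p.
Proof. by move=> sp; exists 0; rewrite clock0; split => //; move: sp; rewrite /start /= => ->. Qed.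

Let killed h K k : set (path_space R) :=
  bounded_skeleton h K k `&` ~` reach (k.+1%:R * h).

Let mkilled h K k : 0 <= h -> measurable (killed h K k).
Proof.
move=> h0; apply: measurableI; first exact: mbounded_skeleton.
by apply: measurableC; apply: mreach; rewrite mulr_ge0.
Qed.

Let skeletonS z h K k p : 0 <= h -> start z p -> `|z| <= K ->
  bounded_skeleton h K k.+1 p <-> reach h p /\ bounded_skeleton h K k (shift h p).
Proof.
move=> h0 sp zK.
have jh j : j.+1%:R * h = h + j%:R * h by rewrite -natr1; ring.
have jh0 j : 0 <= j%:R * h by rewrite mulr_ge0.
split=> [[rk Hk]|[rh [rk Hk]]].
  have rh : reach h p.
    by apply: reach_le rk => //; rewrite jh lerDl.
  split => //; split; first by apply/reached_shift_at => //; rewrite -jh.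
  by move=> j jk; rewrite val_shift_at// -jh; exact: Hk.
split; first by rewrite jh; apply/reached_shift_at.
case=> [_|j jk]; first by rewrite mul0r (val0 sp).
by rewrite jh -val_shift_at//; exact: Hk.
Qed.

(** Induction on [k] for all starting points at once: the Markov property at time [h] removes the
    first step. For [k = 0] the claim is that the probability of dying before [h] does not depend on
    the starting point. *)
Lemma kill_factor h K k z : 0 <= h ->
  pr (Q z) (killed h K k) = (1 - survival h) * pr (Q z) (bounded_skeleton h K k).
Proof.
(* From a starting point beyond [K], index 0 of the grid already violates the bound and both events
   are null. *)
move=> h0; have far k' z' : K < `|z'| -> pr (Q z') (killed h K k') =
    (1 - survival h) * pr (Q z') (bounded_skeleton h K k').
  move=> Kz.
  have E A : measurable A -> A `<=` bounded_skeleton h K k' -> pr (Q z') A = 0.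
    move=> mA sA; rewrite -(pr0 (Q z')); apply: start_ae => // p sp.
    split => // /sA[_ /(_ 0%N (leq0n _))]; rewrite mul0r (val0 sp).
    by rewrite leNgt Kz.
  rewrite !E ?mulr0//; [exact: mbounded_skeleton|exact: mkilled|].
  exact: subIsetl.
elim: k z => [|k IH] z; have [zK|/far//] := leP `|z| K.
- have -> : pr (Q z) (killed h K 0) = 1 - survival h.
    rewrite /survival -(pr_scale_invariant z (mreach h0) (@invariant_reach h)) -prC; last exact: mreach.
    apply: start_ae; [exact: mkilled|by apply: measurableC; exact: mreach|].
    move=> p sp; rewrite /killed mul1r; split => [[]//|nr]; split => //.
    split; first by rewrite mul0r; exact: reach0 sp.
    by move=> j; rewrite leqn0 => /eqP ->; rewrite mul0r (val0 sp).
  have -> : pr (Q z) (bounded_skeleton h K 0) = 1.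
    rewrite -(Q_start z); apply: start_ae; [exact: mbounded_skeleton|exact: mstart|].
    move=> p sp; split => // _; split; first by rewrite mul0r; exact: reach0 sp.
    by move=> j; rewrite leqn0 => /eqP ->; rewrite mul0r (val0 sp).
  by rewrite mulr1.
have kh0 : 0 <= k.+1%:R * h by rewrite mulr_ge0.
have mb := mbounded_skeleton K k h0.
have mk := mkilled K k h0.
have -> : pr (Q z) (bounded_skeleton h K k.+1) =
    pr (Q z) (reach h `&` shift h @^-1` bounded_skeleton h K k).
  apply: start_ae; [exact: mbounded_skeleton| |].
    by apply: measurableI; [exact: mreach|exact: mshift].
  by move=> p sp; apply: skeletonS sp _.
have -> : pr (Q z) (killed h K k.+1) =
    pr (Q z) (reach h `&` shift h @^-1` killed h K k).
  apply: start_ae; [exact: mkilled| |].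
    by apply: measurableI; [exact: mreach|exact: mshift].
  move=> p sp; have jh : k.+2%:R * h = h + k.+1%:R * h by rewrite -natr1; ring.
  rewrite /killed /setI /= (skeletonS k h0 sp zK) jh.
  split=> [[[rh bk] nr]|[rh [bk nr]]]; do ?split => //.
    by move=> /(reached_shift_at kh0 rh).
  by move=> /(reached_shift_at kh0 rh).
apply: EFin_inj; rewrite EFinM -prE; last first.
  by apply: measurableI; [exact: mreach|exact: mshift].
rewrite -prE; last first.
  by apply: measurableI; [exact: mreach|exact: mshift].
rewrite !Q_Markov//.
rewrite -ge0_integralZl_EFin//; [|exact: mreach| |].
- apply: eq_integral => p _; rewrite !prE// -EFinM IH//.
- apply: measurable_funTS; apply: (measurableT_comp (Q_kernel mb)).
  exact: measurable_lamperti_val.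
- by rewrite subr_ge0 survival_le1.
Qed.

(** Applied to the survival probability of one step: the killing probabilities of [n] steps add up
    to at least that of the whole interval. *)
Lemma Bernoulli_upper (y : R) n : 0 <= y -> y <= 1 -> 1 - y ^+ n <= n%:R * (1 - y).
Proof.
move=> y0 y1; elim: n => [|n IH]; first by rewrite expr0 subrr mul0r.
rewrite exprS -natr1; have : y ^+ n <= 1 by rewrite exprn_ile1.
have : 0 <= y ^+ n by rewrite exprn_ge0.
by nra.
Qed.

(* For every mesh, being killed before time [s] while bounded by [K] on the grid has
   probability at least [(1 - survival s) * pr (V K)]; as the mesh tends to 0, this
   event disappears by [lamperti_explosion]. *)
Lemma survival01 s : 0 < s -> (1 - survival s) * survival s = 0.
Proof.
move=> s0.
pose h n : R := s / n.+1%:R.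
have h0 n : 0 < h n by rewrite divr_gt0.
have h0' n : 0 <= h n by rewrite ltW.
have hn n : n.+1%:R * h n = s by rewrite /h mulrC mulfVK.
pose kills K n : set (path_space R) := \big[setU/set0]_(k < n.+1) killed (h n) K k.
have mkills K n : measurable (kills K n).
  by apply: bigsetU_measurable => k _; exact: mkilled.
pose V K : set (path_space R) := reach s `&`
  \bigcap_n \bigcap_(j in [set j : nat | (j <= n.+1)%N]) (val (j%:R * h n) @^-1` [set r | `|r| <= K]).
have mV K : measurable (V K).
  apply: measurableI; first exact: (mreach (ltW s0)).
  apply: bigcap_measurable => [|n _]; first by exists 0%N.
  apply: bigcap_measurable => [|j _]; [by exists 0%N|apply: mval].
    by rewrite mulr_ge0.
  rewrite (_ : [set r | _] = `[- K, K]%classic); first exact: measurable_itv.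
  by apply/seteqP; split => r /=; rewrite in_itv /= ler_norml.
have V0 K : (1 - survival s) * pr (Q 0) (V K) = 0.
  apply/eqP; rewrite eq_le; apply/andP; split; last first.
    by rewrite mulr_ge0 ?pr_ge0// subr_ge0 survival_le1// ltW.
  (* The tails over finer and finer meshes decrease to the event of being killed while bounded for
     infinitely many meshes, which is empty. Each tail must be shown to have probability at least
     [(1 - survival s) * pr (Q 0) (V K)]. *)
  apply: (@pr_nincr_cvg0 _ _ _ (Q 0) (fun N => \bigcup_(n in [set n | (N <= n)%N]) kills K n)).
  - by move=> N; apply: bigcup_measurable.
  - by move=> N M NM p [n /= Mn kp]; exists n => //=; exact: leq_trans Mn.
  - apply/seteqP; split => // p Hp.
    have inkill N : exists n k, [/\ (N <= n)%N, (k < n.+1)%N & killed (h n) K k p].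
      have [n Nn] := Hp N I; rewrite /kills -(bigcup_mkord n.+1 (fun k => killed (h n) K k)).
      by move=> [k /= kn kp]; exists n, k.
    have [n [k [_ kn [[rk _] nrk]]]] := inkill 0%N.
    have rs : ~ reach s p.
      move=> rs; apply: nrk; apply: reach_le rs; first by rewrite mulr_ge0.
      by rewrite -(hn n) ler_pM2r// ler_nat.
    have p0 : coord p 0.
      have [t0 xt _] := clock_inv_spec rk; exact: (alive_le (coordP p) (lexx (0:R)) t0 xt).
    have [d d0 Hd] := lamperti_explosion (coordP p) K p0 (ltW s0) rs.
    have [N HN] : exists N, forall n, (N <= n)%N -> h n < d.
      exists (Num.truncn (s / d)).+1 => m Nm.
      rewrite /h ltr_pdivrMr// mulrC -ltr_pdivrMr//.
      by apply: (lt_le_trans (truncnS_gt _)); rewrite ler_nat (leq_trans Nm).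
    have [m [l [Nm lm [[rl bl] nrl]]]] := inkill N.
    have [j [rj Kj]] := Hd (h m) (h0 m) (HN m Nm).
    have jl : (j <= l)%N.
      rewrite leqNgt; apply/negP => lj; apply: nrl; apply: reach_le rj.
        by rewrite mulr_ge0.
      by rewrite ler_pM2r// ler_nat.
    by have := bl j jl; rewrite leNgt Kj.
  move=> N; apply: (@le_trans _ _ (pr (Q 0) (kills K N))); last first.
    apply: pr_le => //; first exact: bigcup_measurable.
    by move=> p kp; exists N => /=.
  rewrite /kills pr_bigsetU; last 2 first.
  - by move=> k; exact: mkilled.
  - apply/trivIsetP => i j _ _; wlog ij : i j / (i < j)%N => [W|] neq.
      have [ij|ji|E] := ltngtP i j; [exact: W|rewrite setIC; apply: W => //|].
        by rewrite eq_sym.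
      by rewrite E eqxx in neq.
    apply/seteqP; split => // p [[_ nr] [[rj _] _]]; apply: nr.
    apply: reach_le rj; first by rewrite mulr_ge0.
    by rewrite ler_pM2r// ler_nat.
  (* Killing in different steps being disjoint, the probabilities add up. Each is at least
     [(1 - survival (h N)) * pr (Q 0) (V K)], because [V K] lies in every bounded skeleton. *)
  apply: (@le_trans _ _ (\sum_(i < N.+1) (1 - survival (h N)) * pr (Q 0) (V K))).
    rewrite sumr_const card_ord -[_ *+ _]mulr_natl mulrA ler_wpM2r ?pr_ge0//.
    rewrite -[in leLHS](hn N) survivalX//; apply: Bernoulli_upper; first exact: pr_ge0.
    exact: survival_le1.
  apply: ler_sum => i _; rewrite kill_factor// ler_wpM2l//.
    by rewrite subr_ge0 survival_le1.
  apply: pr_le => //; first exact: mbounded_skeleton.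
  move=> p [rs Vp]; split.
    apply: reach_le rs; first by rewrite mulr_ge0.
    by rewrite -(hn N) ler_pM2r// ler_nat ltnW.
  move=> j ji; apply: (Vp N I j) => /=; apply: leq_trans ji _.
  by rewrite ltnW// ltnW.
have [->|s1] := eqVneq (survival s) 1; first by rewrite subrr mul0r.
(* If [survival s] is not 1, every [V K] is null; but a path that reaches [s] is bounded up to that
   point, so it lies in [V K] for some integer [K]. *)
suff -> : survival s = 0 by rewrite mulr0.
apply/eqP; rewrite eq_le pr_ge0 andbT.
have <- : pr (Q 0) (\bigcup_n V n%:R) = 0.
  apply: pr_bigcup0 => // n; have /eqP := V0 n%:R.
  by rewrite mulf_eq0 subr_eq0 eq_sym (negbTE s1) /= => /eqP.
apply: pr_le; [exact: (mreach (ltW s0))|exact: bigcup_measurable|].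
move=> p rs; have hp := coordP p.
have [q0 /isSomeP[r xq] _] := clock_inv_spec rs.
have [M HM] := real_path_bounded hp q0 xq.
exists (Num.truncn (Num.max 0 M)).+1 => //; split => // n _ j /= jn.
have [jh0 jhs] : 0 <= j%:R * h n /\ j%:R * h n <= s.
  by split; [rewrite mulr_ge0|rewrite -[leRHS](hn n) ler_pM2r// ler_nat].
have ru := reached_le hp jh0 jhs rs.
rewrite /path_val lampertiE//; have [u0 xu _] := clock_inv_spec ru.
have [|r' -> rM] := HM _ u0; first exact: (clock_inv_le hp).
apply: (le_trans rM).
by apply: le_trans (ltW (truncnS_gt _)); rewrite le_max lexx orbT.
Qed.

(** Almost every path is alive at 0, so its clock reaches some small level: some [survival] at
    [1 / (n + 1)] is nonzero, hence 1. Multiplicativity then propagates 1 to all multiples, and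
    monotonicity to all times. *)
Lemma survival1 s : 0 <= s -> survival s = 1.
Proof.
have [n n0] : exists n, survival n.+1%:R^-1 != 0.
  apply: contrapT => /forallNP H; have := Q_start 0.
  suff : pr (Q 0) (start 0) <= 0.
    by move=> H0 H1; move: H0; rewrite /start H1 leNgt ltr01.
  have E : pr (Q 0) (\bigcup_n reach (n.+1%:R^-1)) = 0.
    apply: pr_bigcup0 => n; first by apply: mreach; rewrite invr_ge0.
    by have /negP/negPn/eqP := H n.
  apply: le_trans (_ : _ <= pr (Q 0) (\bigcup_n reach (n.+1%:R^-1))) _; last by rewrite E.
  apply: pr_le; [exact: mstart|by apply: bigcup_measurable => n _; apply: mreach; rewrite invr_ge0|].
  move=> p sp; have x0 : coord p 0 by move: sp; rewrite /start /= => ->.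
  have hp := coordP p.
  have [d d0 Hd] := alive_right hp (lexx (0 : R)) x0.
  have d2 : 0 < d / 2 by lra.
  have xd : coord p (d / 2) by apply: Hd; lra.
  have c0 : 0 < clock alpha (coord p) (d / 2).
    by rewrite -(clock0 alpha (coord p)); apply: (clock_lt alpha hp).
  exists (Num.truncn (clock alpha (coord p) (d / 2))^-1) => //=.
  apply: (reached_le hp _ _ (reached_clock alpha (ltW d2) xd)); first by rewrite invr_ge0.
  rewrite invf_ple ?posrE//.
  exact/ltW/truncnS_gt.
have n1 : 0 < n.+1%:R^-1 :> R by rewrite invr_gt0.
have S1 : survival n.+1%:R^-1 = 1.
  by have /eqP := survival01 n1; rewrite mulf_eq0 (negbTE n0) orbF subr_eq0 => /eqP.
move=> s0; apply/eqP; rewrite eq_le survival_le1//=.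
pose m := (Num.truncn (s * n.+1%:R)).+1.
have <- : survival (m%:R * n.+1%:R^-1) = 1 by rewrite survivalX ?ltW// S1 expr1n.
apply: survival_nincr => //; rewrite -/(_ / _) ler_pdivlMr//.
exact/ltW/truncnS_gt.
Qed.

Let pr_reach s A : 0 <= s -> measurable A -> pr (Q 0) (reach s `&` A) = pr (Q 0) A.
Proof.
by move=> s0 mA; rewrite setIC pr_full//; [exact: mreach|exact: survival1].
Qed.

(** Including survival up to [t n] keeps all the values genuine, which gives both scale invariance
    and compatibility with shifts. *)
Definition increments n (t : nat -> R) (B : nat -> set R) : set (path_space R) :=
  [set p | reach (t n) p /\
    forall i : nat, (i < n)%N -> B i (val (t i.+1) p - val (t i) p)].

Section increments.
Variables (n : nat) (t : nat -> R) (B : nat -> set R).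
Hypothesis t0 : 0 <= t 0%N.
Hypothesis t_homo : {homo t : i j / (i <= j)%N >-> i <= j}.
Hypothesis mB : forall i, measurable (B i).

Let t_ge0 i : 0 <= t i. Proof. by apply: (le_trans t0); exact: t_homo. Qed.

Lemma measurable_increments : measurable (increments n t B).
Proof.
rewrite (_ : increments n t B = reach (t n) `&`
  \bigcap_(i in [set i : nat | (i < n)%N])
  ((fun p : path_space R => val (t i.+1) p - val (t i) p) @^-1` B i)).
  apply: measurableI; first exact: mreach.
  have [->|n0] := eqVneq n 0%N.
    by rewrite (_ : [set i | _] = set0) ?bigcap_set0//; apply/seteqP; split.
  apply: bigcap_measurable => [|i _]; first by exists 0%N; rewrite /= lt0n.
  exact: measurable_increment.
by apply/seteqP; split.
Qed.

Lemma invariant_increments : scale_invariant (increments n t B).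
Proof.
move=> z p; rewrite /increments /mkset.
have E : reach (t n) p -> forall i : nat, (i < n)%N ->
    val (t i.+1) (scale z p) - val (t i) (scale z p) = val (t i.+1) p - val (t i) p.
  move=> rn i ik; rewrite (val_scale_at _ (reach_le (t_ge0 _) (t_homo ik) rn)).
  rewrite (val_scale_at _ (reach_le (t_ge0 _) (t_homo (ltnW ik)) rn)).
  by rewrite opprD addrACA subrr addr0.
split=> -[rn H].
  have {}rn : reach (t n) p by apply/(reached_scale_at z).
  by split => // i ik; rewrite -E//; exact: H.
split; first exact/reached_scale_at.
by move=> i ik; rewrite E//; exact: H.
Qed.

Lemma increments_shift a : 0 <= a -> a <= t 0%N -> increments n t B =
  reach a `&` shift a @^-1` increments n (fun i => t i - a) B.
Proof.
move=> a0 at0.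
have ta i : 0 <= t i - a by rewrite subr_ge0 (le_trans at0)// t_homo.
apply/seteqP; split => p.
  move=> [rn H]; have ra : reach a p.
    by apply: reach_le rn => //; rewrite -subr_ge0.
  split => //; split; first by apply/reached_shift_at => //; rewrite subrKC.
  by move=> i ik; rewrite !val_shift_at// !subrKC; exact: H.
move=> [ra [/(reached_shift_at (ta n) ra) rn H]]; rewrite subrKC in rn.
split => // i ik; have := H i ik.
by rewrite !val_shift_at// !subrKC.
Qed.

End increments.

(** Induction on the number of increments: the later ones form a scale invariant event of the path
    shifted to the first time, so [Markov_factor] splits off the first increment. *)
Lemma pr_increments n (t : nat -> R) (B : nat -> set R) : 0 <= t 0%N ->
  {homo t : i j / (i <= j)%N >-> i <= j} -> (forall i, measurable (B i)) ->
  pr (Q 0) (increments n t B) =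
  \prod_(i < n) pr (Q 0) (val (t i.+1 - t i) @^-1` B i).
Proof.
elim: n t B => [|n IH] t B t0 ht mB.
  rewrite big_ord0 -[RHS](survival1 t0); congr pr.
  by apply/seteqP; split => [p []|p rp]//; split.
(* A first restart brings the initial time to 0; since the path starts at 0 almost surely, its first
   increment is then simply its value at [u 1]. *)
pose u i := t i - t 0%N.
have u0 : u 0%N = 0 by rewrite /u subrr.
have hu : {homo u : i j / (i <= j)%N >-> i <= j} by move=> i j ij; rewrite /u lerD2r ht.
have u_ge0 i : 0 <= u i by rewrite -u0 hu.
rewrite (increments_shift n.+1 B ht t0 (lexx _)) survival_Markov//; last 2 first.
- by apply: measurable_increments => //; rewrite subrr.
- by apply: invariant_increments => //; rewrite subrr.
rewrite survival1// mul1r -/u.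
have hu1 : {homo (fun i => u i.+1) : i j / (i <= j)%N >-> i <= j} by move=> i j ij; exact: hu.
pose w i := u i.+1 - u 1%N.
have hw : {homo w : i j / (i <= j)%N >-> i <= j} by move=> i j ij; rewrite /w lerD2r hu1.
have w0 : 0 <= w 0%N by rewrite /w subrr.
have minc := measurable_increments n w0 hw (fun i => mB i.+1).
have iinc := @invariant_increments n w (fun i => B i.+1) w0 hw.
have -> : pr (Q 0) (increments n.+1 u B) =
    pr (Q 0) (reach (u 1%N) `&` val (u 1%N) @^-1` B 0%N `&`
      shift (u 1%N) @^-1` increments n w (fun i => B i.+1)).
  apply: start_ae.
  - by apply: measurable_increments => //; rewrite u0.
  - apply: measurableI; last exact: mshift.
    by apply: measurableI; [exact: mreach|exact: mval].
  move=> p sp; have E := increments_shift n (fun i => B i.+1) hu1 (u_ge0 1%N) (lexx _).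
  rewrite -/w in E; split.
    move=> [rn H].
    have : increments n (fun i => u i.+1) (fun i => B i.+1) p.
      by split => // i ik; exact: H.
    rewrite E => -[r1 H1]; split => //; split => //.
    by have := H 0%N isT; rewrite u0 (val0 sp) subr0.
  move=> [[r1 v1] s1].
  have : increments n (fun i => u i.+1) (fun i => B i.+1) p by rewrite E.
  move=> [rn H]; split => // -[_|i ik]; last exact: H.
  by rewrite u0 (val0 sp) subr0.
rewrite Markov_factor// pr_reach//; last exact: mval.
rewrite IH// big_ord_recl /= -/(u 1%N); congr (_ * _).
apply: eq_bigr => i _; rewrite /bump /= add1n.
by have -> : w i.+1 - w i = t i.+2 - t i.+1 by rewrite /w /u; ring.
Qed.

Lemma pr_stationary s t (B : set R) : 0 <= s -> 0 <= t -> measurable B ->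
  pr (Q 0) [set p : path_space R | B (val (s + t) p - val s p)] =
  pr (Q 0) (val t @^-1` B).
Proof.
move=> s0 t0 mB; pose u (i : nat) := if i is 0%N then s else s + t.
have hu : {homo u : i j / (i <= j)%N >-> i <= j}.
  by move=> [|i] [|j] //= _; rewrite lerDl.
have -> : pr (Q 0) (val t @^-1` B) = pr (Q 0) (increments 1 u (fun=> B)).
  have E : u 1%N - u 0%N = t by rewrite /u addrAC subrr add0r.
  by rewrite pr_increments// big_ord_recl big_ord0 mulr1 -[in LHS]E.
have st0 := addr_ge0 s0 t0.
rewrite -[LHS](pr_reach st0); last exact: measurable_increment.
congr pr; apply/seteqP; split => p [rp Bp]; split => //.
  by case.
exact: (Bp 0%N isT).
Qed.

Lemma pr_independent n (t : nat -> R) (B : nat -> set R) : 0 <= t 0%N ->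
  {homo t : i j / (i <= j)%N >-> i <= j} -> (forall i, measurable (B i)) ->
  pr (Q 0) [set p : path_space R |
    forall i : 'I_n, B i (val (t i.+1) p - val (t i) p)] =
  \prod_(i < n) pr (Q 0) [set p : path_space R | B i (val (t i.+1) p - val (t i) p)].
Proof.
move=> t0 ht mB; have tge0 i : 0 <= t i by apply: (le_trans t0); exact: ht.
transitivity (pr (Q 0) (increments n t B)).
  rewrite -[LHS](pr_reach (tge0 n)).
    congr pr; apply/seteqP; split => p [rp Bp]; split => //.
      by move=> i ik; exact: (Bp (Ordinal ik)).
    by move=> i; exact: Bp.
  by apply: measurable_forall_ord => i; exact: measurable_increment.
rewrite pr_increments//; apply: eq_bigr => i _.
have ti : 0 <= t i.+1 - t i by rewrite subr_ge0 ht.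
by rewrite -(pr_stationary (tge0 i) ti (mB i)) subrKC.
Qed.

(** Integer levels suffice, since reaching a level implies reaching all smaller nonnegative ones;
    this keeps the event measurable. *)
Definition lamperti_full : set (path_space R) := start 0 `&` \bigcap_n reach n%:R.

Lemma measurable_lamperti_full : measurable lamperti_full.
Proof.
apply: measurableI; first exact: mstart.
by apply: bigcapT_measurable => n; exact: mreach.
Qed.

Lemma lamperti_fullP p : lamperti_full p ->
  coord p 0 = Some 0 /\ forall s, 0 <= s -> reached alpha (coord p) s.
Proof.
move=> [sp H]; split => // s s0.
apply: (reached_le (coordP p) s0 _ (H (Num.truncn s).+1 I)).
exact/ltW/truncnS_gt.
Qed.

Lemma pr_lamperti_full : pr (Q 0) lamperti_full = 1.
Proof.
have mfull : measurable (\bigcap_n reach n%:R).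
  by apply: bigcapT_measurable => n; exact: mreach.
rewrite /lamperti_full setIC (pr_full mfull (mstart 0) (Q_start 0)).
have : pr (Q 0) (\bigcup_n ~` reach n%:R) = 0.
  apply: pr_bigcup0 => n; first by apply: measurableC; exact: mreach.
  by rewrite prC; [rewrite -/(survival _) survival1// subrr|exact: mreach].
by rewrite -setC_bigcap (prC (Q 0) mfull) => /eqP; rewrite subr_eq0 eq_sym => /eqP.
Qed.

End levy.

(** The difference [g - f] is positive on [D] with integral 0. The bound by 1 makes the integrals
    finite, so that they can be subtracted. *)
Lemma integral_eq_null (R : realType) d (T : measurableType d) (P : probability T R)
    (D : set T) (f g : T -> R) : measurable D ->
  measurable_fun D f -> measurable_fun D g ->
  (forall x, D x -> 0 <= f x) -> (forall x, D x -> f x < g x) ->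
  (forall x, D x -> g x <= 1) ->
  (\int[P]_(x in D) (f x)%:E = \int[P]_(x in D) (g x)%:E)%E -> P D = 0%E.
Proof.
move=> mD mf mg f0 fg g1 E.
have mgf : measurable_fun D (fun x => g x - f x) by exact: measurable_funB.
have gf0 x : D x -> (0 <= (g x - f x)%:E)%E by move=> Dx; rewrite lee_fin subr_ge0 ltW// fg.
have f_fin : (\int[P]_(x in D) (f x)%:E)%E \is a fin_num.
  rewrite ge0_fin_numE; last by apply: integral_ge0 => x Dx; rewrite lee_fin f0.
  apply: (@le_lt_trans _ _ (\int[P]_(x in D) (cst 1%E x))%E).
    apply: ge0_le_integral => //.
    - by apply/measurable_EFinP.
    - by move=> x Dx; rewrite /cst lee_fin (le_trans (ltW (fg _ Dx)))// g1.
  rewrite integral_cst// mul1e; apply: le_lt_trans (probability_le1 P mD) _.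
  by rewrite ltry.
have Z : (\int[P]_(x in D) (g x - f x)%:E = 0)%E.
  have : (\int[P]_(x in D) (f x)%:E + 0 =
      \int[P]_(x in D) (f x)%:E + \int[P]_(x in D) (g x - f x)%:E)%E.
    have mf' : measurable_fun D (fun x => (f x)%:E) by exact/measurable_EFinP.
    have mgf' : measurable_fun D (fun x => (g x - f x)%:E) by exact/measurable_EFinP.
    rewrite adde0 -ge0_integralD//.
    rewrite E; apply: eq_integral => x _; rewrite -EFinD.
    by rewrite subrKC.
  move: f_fin; case: (\int[P]_(x in D) (f x)%:E)%E => // r _.
  case: (\int[P]_(x in D) _)%E => // s; rewrite -!EFinD => -[rs].
  by congr EFin; lra.
have : ae_eq P D (fun x => (g x - f x)%:E) (cst 0%E).
  apply/ae_eq_integral_abs => //; first exact/measurable_EFinP.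
  rewrite -[RHS]Z; apply: eq_integral => x; rewrite inE => Dx.
  by rewrite gee0_abs// gf0.
move=> [N [mN N0 HN]]; apply/eqP; rewrite eq_le measure_ge0 andbT -N0.
apply: le_measure; rewrite ?inE// => x Dx; apply: HN => /= /(_ Dx) [].
by apply/eqP; rewrite gt_eqF// subr_gt0 fg.
Qed.

Section option_law.
Variable R : realType.

(* The pair (value, alive) encodes a state as a point of a measurable type. *)
Let code (o : option R) : R * bool := if o is Some r then (r, true) else (0, false).

Let code_measurable d (T : measurableType d) (Y : T -> option R) :
  (forall C, borel_state C -> measurable [set w | C (Y w)]) ->
  measurable_fun setT (code \o Y).
Proof.
move=> mY; rewrite (_ : code \o Y = fun w => ((code (Y w)).1, (code (Y w)).2))//.
  apply: measurable_fun_pair => _ B mB; rewrite setTI.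
    apply: (mY [set o | B (code o).1]).
    by rewrite /borel_state.
  apply: (mY [set o | B (code o).2]).
  rewrite /borel_state; have [Bt|Bt] := pselect (B true).
    by rewrite (_ : _ @^-1` _ = setT)//; apply/seteqP; split.
  by rewrite (_ : _ @^-1` _ = set0)//; apply/seteqP; split.
by apply/funext => w /=; case: code.
Qed.

(** Both sides are integrals against the image law of the coded state, and these image laws
    coincide. *)
Lemma integral_same_state d1 d2 (T1 : measurableType d1) (T2 : measurableType d2)
    (P1 : probability T1 R) (P2 : probability T2 R)
    (Y1 : T1 -> option R) (Y2 : T2 -> option R) (N : set R) (h : R -> \bar R) :
  (forall C, borel_state C -> measurable [set w | C (Y1 w)]) ->
  (forall C, borel_state C -> measurable [set w | C (Y2 w)]) ->
  (forall C, borel_state C -> P1 [set w | C (Y1 w)] = P2 [set w | C (Y2 w)]) ->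
  measurable N -> measurable_fun N h -> (forall x, N x -> (0 <= h x)%E) ->
  (\int[P1]_(w in [set w | (Some @` N) (Y1 w)]) h (odflt 0%R (Y1 w)) =
   \int[P2]_(w in [set w | (Some @` N) (Y2 w)]) h (odflt 0%R (Y2 w)))%E.
Proof.
move=> mY1 mY2 E mN mh h0.
pose D : set (R * bool) := N `*` [set true].
have mD : measurable D by apply: measurableX.
have mhD : measurable_fun D (h \o fst).
  apply: (measurable_comp mN) => //; first by move=> _ [[r b] [Nr _] <-].
  exact: measurable_funTS.
have hD0 : {in D, forall x, (0 <= (h \o fst) x)%E}.
  by move=> [r b]; rewrite inE /D => -[/= Nr _]; exact: h0.
have pre d (T : measurableType d) (Y : T -> option R) :
    [set w | (Some @` N) (Y w)] = (code \o Y) @^-1` D.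
  apply/seteqP; split => w /=; first by move=> [r Nr <-].
  by rewrite /D /code; case: (Y w) => [r|] [//= Nr _]; exists r.
have I d (T : measurableType d) (P : probability T R) (Y : T -> option R) :
    (forall C, borel_state C -> measurable [set w | C (Y w)]) ->
    (\int[P]_(w in [set w | (Some @` N) (Y w)]) h (odflt 0%R (Y w)) =
     \int[pushforward P (code \o Y)]_(x in D) (h \o fst) x)%E.
  move=> mY; rewrite ge0_integral_pushforward//; last exact: code_measurable.
  by rewrite pre; apply: eq_integral => w _; rewrite /= /code; case: (Y w).
rewrite (I _ _ P1)// (I _ _ P2)//; apply: eq_measure_integral => [||m2 m1 S mS SD]; [exact: code_measurable..|].
apply: (E [set o | S (code o)]); rewrite /borel_state.
have mc : measurable_fun setT (fun r : R => (r, true)) by exact: measurable_fun_pair.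
by have := mc measurableT S mS; rewrite setTI.
Qed.

End option_law.

Lemma open_setX (T U : topologicalType) (A : set T) (B : set U) :
  open A -> open B -> open (A `*` B).
Proof.
move=> oA oB; rewrite openE => -[a b] [/= Aa Bb].
by exists (A, B) => //=; split; apply: open_nbhs_nbhs.
Qed.

Lemma near_dist (R : realType) (x h : R) : 0 < h -> \forall z \near x, `|z - x| < h.
Proof.
by move=> h0; apply/nbhs_ballP; exists h => // u; rewrite /ball /= distrC.
Qed.

(** * The support of the process and the group law of the components *)

Section self_similar_process.
Variables (R : realType) (I : set R) (d : measure_display)
  (Omega : R -> measurableType d) (P : forall y, probability (Omega y) R)
  (X : forall y, Omega y -> R -> option R) (y0 : R) (f : R -> R -> R) (c : R -> R).
Arguments X : clear implicits.
Hypothesis oI : open I.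
Hypothesis iI : is_interval I.
Hypothesis hX : strong_Markov_process I P X.
Hypothesis hf : invariance_components I P X y0 f c.
Hypothesis hg : good_components I y0 f c.
Implicit Types (x y z s t : R) (C : set (option R)).

Let Iy0 : I y0 := Defs.inv_reference hf.

Let mI : measurable I. Proof. exact: open_measurable. Qed.

Lemma state_in y w t r : I y -> 0 <= t -> X y w t = Some r -> I r.
Proof. by move=> Iy t0; exact: (path_state (process_cadlag hX w Iy) t0). Qed.

Lemma f_in y x : I y -> I x -> I (f y x).
Proof. by move=> Iy Ix; have [ff _ _] := Defs.inv_bij hf Iy; exact: ff. Qed.

Let c_time y t : I y -> 0 <= t -> 0 <= c y * t.
Proof. by move=> Iy t0; rewrite mulr_ge0// ltW// (Defs.inv_pos hf). Qed.

Lemma f_inj y a b : I y -> I a -> I b -> f y a = f y b -> a = b.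
Proof.
by move=> Iy Ia Ib; have [_ fi _] := Defs.inv_bij hf Iy; apply: fi; rewrite inE.
Qed.

Lemma pinv_fK y x : I y -> I x -> pinv I (f y) (f y x) = x.
Proof.
move=> Iy Ix; have [_ fi _] := Defs.inv_bij hf Iy.
by apply: pinvKV; rewrite ?inE.
Qed.

Lemma f_pinvK y x : I y -> I x -> f y (pinv I (f y) x) = x.
Proof.
by move=> Iy Ix; have [_ _ fs] := Defs.inv_bij hf Iy; apply: surjpK fs _ _; rewrite inE.
Qed.

Lemma f_continuous2 y x : I y -> I x -> forall e, 0 < e -> exists2 h, 0 < h &
  forall y' x', `|y' - y| < h -> `|x' - x| < h ->
    [/\ I y', I x' & `|f y' x' - f y x| < e].
Proof.
move=> Iy Ix e e0.
have oII : open (I `*` I) by exact: open_setX.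
have := Defs.inv_continuous hf; rewrite continuous_open_subspace// => /(_ (y, x)).
rewrite inE => /(_ (conj Iy Ix)) /cvgrPdist_lt/(_ _ e0) cF.
have nII : nbhs (y, x) (I `*` I) by apply: open_nbhs_nbhs; split.
have [h /= h0 Hh] : exists2 h : R, 0 < h & ball (y, x) h `<=`
    (I `*` I) `&` [set p | `|f y x - f p.1 p.2| < e].
  by apply/nbhs_ballP; exact: (filterI nII cF).
exists h => // y' x' yh xh.
have [|[/= Iy' Ix'] H] := Hh (y', x').
  by split; rewrite /ball /= distrC.
by split => //; rewrite distrC.
Qed.

Lemma c_continuous y : I y -> c z @[z --> y] --> c y.
Proof.
move=> Iy; have := Defs.inv_cst_continuous hf.
by rewrite continuous_open_subspace// => /(_ y); rewrite inE; apply.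
Qed.

Lemma f_within_continuous y : I y -> {within I, continuous (f y)}.
Proof.
move=> Iy; rewrite continuous_open_subspace// => x; rewrite inE => Ix.
apply/cvgrPdist_lt => e e0; have [h h0 Hh] := f_continuous2 Iy Ix e0.
near=> z; rewrite distrC; have [| |//] := Hh y z.
  by rewrite subrr normr0.
by near: z; exact: near_dist.
Unshelve. all: end_near. Qed.

Lemma pinv_within_continuous y : I y -> {within I, continuous (pinv I (f y))}.
Proof.
move=> Iy; rewrite continuous_open_subspace// => x; rewrite inE => Ix.
have oII : open (I `*` I) by exact: open_setX.
have := Defs.inv_continuousV hf; rewrite continuous_open_subspace// => /(_ (y, x)).
rewrite inE => /(_ (conj Iy Ix)) cF.
have cyz : (fun z : R => (y, z)) @ x --> (y, x).
  exact: (cvg_pair (cvg_cst y) (@cvg_id _ (nbhs x))).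
exact: (cvg_comp _ _ cyz cF).
Qed.

(** For fixed [a < b] the continuous function [f z b - f z a] of [z] has no zero on the interval
    [I], by injectivity, and it is positive at [y0], where [f y0] is the identity. *)
Lemma f_mono y a b : I y -> I a -> I b -> a < b -> f y a < f y b.
Proof.
move=> Iy Ia Ib ab; rewrite ltNge; apply/negP => ba.
pose D z := f z b - f z a.
have [fy0 _ _] := hg.
have Dy0 : 0 < D y0 by rewrite /D !fy0// subr_gt0.
have Dy : D y <= 0 by rewrite /D subr_le0.
have Dc z : I z -> D u @[u --> z] --> D z.
  move=> Iz; apply: cvgB; apply/cvgrPdist_lt => e e0.
    have [h h0 Hh] := f_continuous2 Iz Ib e0.
    near=> u; rewrite distrC; have [| |//] := Hh u b.
      by near: u; exact: near_dist.
    by rewrite subrr normr0.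
  have [h h0 Hh] := f_continuous2 Iz Ia e0.
  near=> u; rewrite distrC; have [| |//] := Hh u a.
    by near: u; exact: near_dist.
  by rewrite subrr normr0.
have D0 z : I z -> D z != 0.
  move=> Iz; apply/eqP => /eqP; rewrite subr_eq0 => /eqP /(f_inj Iz Ib Ia) E.
  by move: ab; rewrite E ltxx.
have cD u v : I u -> I v -> {within `[u, v], continuous D}.
  move=> Iu Iv; apply: continuous_in_subspaceT => z; rewrite inE /= in_itv /=.
  by move=> zuv; apply: Dc; exact: iI zuv.
have [yy0|y0y] := leP y y0.
  have [|z zI Dz] := IVT (v := 0) yy0 (cD _ _ Iy Iy0).
    by rewrite min_l ?max_r ?(le_trans Dy (ltW Dy0))// Dy ltW.
  by have := D0 z (iI Iy Iy0 zI); rewrite Dz eqxx.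
have [|z zI Dz] := IVT (v := 0) (ltW y0y) (cD _ _ Iy0 Iy).
  by rewrite min_r ?max_l ?(le_trans Dy (ltW Dy0))// Dy ltW.
by have := D0 z (iI Iy0 Iy zI); rewrite Dz eqxx.
Unshelve. all: end_near. Qed.

(** The preimage under [f y], cut down to [I], where [f y] is continuous and the preimage is Borel;
    paths take no value outside [I]. *)
Definition pull y C : set (option R) :=
  [set o | if o is Some r then I r /\ C (Some (f y r)) else C None].

Lemma borel_pull y C : I y -> borel_state C -> borel_state (pull y C).
Proof.
move=> Iy mC; rewrite /borel_state.
have := subspace_continuous_measurable_fun mI (f_within_continuous Iy).
by move=> /(_ mI _ mC).
Qed.

Lemma pullP y C w t : I y -> 0 <= t ->
  pull y C (X y0 w t) <-> C (omap (f y) (X y0 w t)).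
Proof.
move=> Iy t0; rewrite /pull /=; case E : (X y0 w t) => [r|]//=.
by split=> [[]//|Cr]; split => //; exact: (state_in Iy0 t0 E).
Qed.

Definition law y t C : R := pr (P y) [set w | C (X y w t)].

Lemma measurable_state y t C : I y -> 0 <= t -> borel_state C ->
  measurable [set w | C (X y w t)].
Proof. exact: (process_measurable hX). Qed.

Lemma law_measurable t C : 0 <= t -> borel_state C ->
  measurable_fun I (fun y => law y t C).
Proof.
move=> t0 mC; have := process_kernel hX (n := 1) (s := fun=> t) (B := fun=> C)
  (fun=> t0) (fun=> mC).
move=> mk; have : measurable_fun I (fine \o fun z => fdd (P z) (X z) (fun=> t) (fun _ : 'I_1 => C)).
  by apply: measurableT_comp.
apply: eq_measurable_fun => y _ /=; rewrite /law /pr /fdd; congr (fine (P y _)).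
by apply/seteqP; split => w /=; [move=> /(_ ord0)|].
Qed.

Lemma same_pair_law y t1 t2 C1 C2 : I y -> 0 <= t1 -> 0 <= t2 ->
  borel_state C1 -> borel_state C2 ->
  P y [set w | C1 (X y w t1) /\ C2 (X y w t2)] =
  P y0 [set w | pull y C1 (X y0 w (c y * t1)) /\ pull y C2 (X y0 w (c y * t2))].
Proof.
move=> Iy t10 t20 mC1 mC2; have cy := ltW (Defs.inv_pos hf Iy).
have := Defs.inv_law hf Iy (n := 2) (s := fun i => if (i : nat) == 0%N then t1 else t2)
  (B := fun i => if (i : nat) == 0%N then C1 else C2).
rewrite /fdd => H.
rewrite (_ : [set w | _ /\ _] = [set w | forall i : 'I_2,
   (if (i : nat) == 0%N then C1 else C2) (X y w (if (i : nat) == 0%N then t1 else t2))]).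
  rewrite H; [congr (P y0 _)|by move=> i; case: ifP..].
  apply/seteqP; split => w /=.
    move=> Hw; split; [have := Hw ord0|have := Hw ord_max] => /=; move=> ?;
      by apply/pullP => //; rewrite mulr_ge0.
  move=> [/pullP H1 /pullP H2] i; case: ifP => _; [apply: H1|apply: H2] => //;
    by rewrite mulr_ge0.
by apply/seteqP; split => w /=; [move=> [H1 H2] i; case: ifP
  |move=> Hw; split; [exact: (Hw ord0)|exact: (Hw ord_max)]].
Qed.

Lemma same_state_law y t C : I y -> 0 <= t -> borel_state C ->
  P y [set w | C (X y w t)] = P y0 [set w | pull y C (X y0 w (c y * t))].
Proof.
move=> Iy t0 mC; have := same_pair_law Iy t0 t0 mC mC.
by congr (P y _ = P y0 _); apply/seteqP; split => w /=; tauto.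
Qed.

Lemma law_pull y t C : I y -> 0 <= t -> borel_state C ->
  law y t C = law y0 (c y * t) (pull y C).
Proof. by move=> Iy t0 mC; rewrite /law /pr same_state_law. Qed.

Lemma borel_state1 z : borel_state [set Some z].
Proof.
rewrite /borel_state (_ : _ @^-1` _ = [set z]); first exact: measurable_set1.
by apply/seteqP; split => r /= [->].
Qed.

Lemma law_start y : I y -> law y 0 [set Some y] = 1.
Proof. by move=> Iy; rewrite /law /pr (process_start hX). Qed.

(** At time 0, self-similarity compares [y] with the image under [f y] of the start [y0]. Two events
    of probability 1 share a sample point, and there the equality can be read. *)
Lemma f_start y : I y -> f y y0 = y.
Proof.
move=> Iy; have := law_start Iy; rewrite law_pull//; last exact: borel_state1.
rewrite mulr0 /law => H.
have m1 : measurable [set w | pull y [set Some y] (X y0 w 0)].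
  by apply: measurable_state => //; apply: borel_pull => //; exact: borel_state1.
have m2 : measurable [set w | [set Some y0] (X y0 w 0)].
  by apply: measurable_state => //; exact: borel_state1.
have := pr_full m1 m2 (law_start Iy0); rewrite H => H1.
have /set0P[w [/= H2 H3]] : [set w | pull y [set Some y] (X y0 w 0)] `&`
    [set w | [set Some y0] (X y0 w 0)] != set0.
  by apply/eqP => E; move: H1; rewrite E pr0 => /eqP; rewrite eq_sym oner_eq0.
by move: H2; rewrite /pull /= H3 => -[_ []].
Qed.

Definition in_set (N : set R) : set (option R) := Some @` N.

Lemma borel_in_set N : measurable N -> borel_state (in_set N).
Proof.
move=> mN; rewrite /borel_state (_ : _ @^-1` _ = N)//.
by apply/seteqP; split => r /=; [move=> [? ? [<-]]|exists r].
Qed.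

Let borel_in_ball x e : borel_state (in_set (ball x e)).
Proof. by apply: borel_in_set; apply: open_measurable; exact: ball_open. Qed.

Let start_pair z s N C : I z -> 0 <= s -> measurable N -> borel_state C ->
  P z [set w | in_set N (X z w 0) /\ C (X z w s)] =
  (if z \in N then (law z s C)%:E else 0)%E.
Proof.
move=> Iz s0 mN mC.
have mstart : measurable [set w | [set Some z] (X z w 0)].
  by apply: measurable_state => //; exact: borel_state1.
have mCs : measurable [set w | C (X z w s)] by exact: measurable_state.
have mNs : measurable [set w | in_set N (X z w 0)].
  by apply: measurable_state => //; exact: borel_in_set.
have mNC : measurable [set w | in_set N (X z w 0) /\ C (X z w s)] by exact: measurableI.
rewrite prE// -(pr_full mNC mstart (law_start Iz)).
case: ifPn; rewrite ?inE ?notin_setE => zN; congr EFin.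
  rewrite /law -(pr_full mCs mstart (law_start Iz)); congr pr.
  apply/seteqP; split => w /= [H E]; split => //; first by case: H.
  by split => //; rewrite E; exists z.
rewrite -(pr0 (P z)); congr pr; apply/seteqP; split => // w /= [[[r Nr E] _] E'].
by move: E; rewrite E' => -[rz]; apply: zN; rewrite -rz.
Qed.

(** The strong Markov property at a constant time, the one form of it used for the group law. *)
Lemma Markov_two_times y t s N C : I y -> 0 <= t -> 0 <= s -> measurable N ->
  N `<=` I -> borel_state C ->
  P y [set w | in_set N (X y w t) /\ C (X y w (t + s))] =
  (\int[P y]_(w in [set w | in_set N (X y w t)]) (law (odflt 0%R (X y w t)) s C)%:E)%E.
Proof.
move=> Iy t0 s0 mN NI mC.
have st : stopping_time (X y) (fun=> t%:E).
  split=> [w|u u0]; first by rewrite lee_fin.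
  have [tu|tu] := leP t u.
    rewrite (_ : [set w | _] = setT); first exact: (@measurableT _ (g_sigma_algebraType _)).
    by apply/seteqP; split => // w _ /=; rewrite lee_fin.
  rewrite (_ : [set w | _] = set0); first exact: (@measurable0 _ (g_sigma_algebraType _)).
  by apply/seteqP; split => // w /=; rewrite lee_fin leNgt tu.
have sT : stopped_event (X y) (fun=> t%:E) setT.
  split; first exact: measurableT.
  by move=> u u0; rewrite setTI; apply st.2.
(* The restriction to [N] at time [t] is imposed on the restarted process at its time 0;
   [start_pair] then turns it into an indicator in the integrand. *)
pose u (i : 'I_2) := if (i : nat) == 0%N then 0 else s.
pose B (i : 'I_2) := if (i : nat) == 0%N then in_set N else C.
have u0 i : 0 <= u i by rewrite /u; case: ifP.
have mB i : borel_state (B i) by rewrite /B; case: ifP => // _; exact: borel_in_set.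
have := process_strong_Markov hX Iy st sT u0 mB.
rewrite setTI /=.
have mD : measurable [set w | in_set N (X y w t)].
  by apply: measurable_state => //; exact: borel_in_set.
set D := [set w | _ /\ _]; have mDD : measurable D.
  rewrite (_ : D = [set w | [set o : option R | isSome o] (X y w t)]).
    by apply: measurable_state => //; exact: borel_state_alive.
  apply/seteqP; split => w; rewrite /D /=; first by case=> _; case: (X y w t).
  by case: (X y w t) => // r _; split; rewrite ?ltry.
have inD : [set w | in_set N (X y w t)] `<=` D.
  by move=> w /= [r Nr E]; rewrite /D /= ltry -E.
move=> H; transitivity (P y (D `&` [set w | forall i, B i (X y w (t + u i))])).
  congr (P y _); apply/seteqP; split => w /=.
    move=> [H1 H2]; split; first exact: inD.
    by move=> i; rewrite /B /u; case: ifP => _; rewrite ?addr0.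
  move=> [_ Hw]; have := Hw ord0; have := Hw ord_max.
  by rewrite /B /u /= addr0 => H2 H1; split.
rewrite H -(setIidr inD) [RHS]integral_mkcondr; apply: eq_integral => w; rewrite inE => Dw.
rewrite patchE; case E : (X y w t) => [z|] /=; last by case: Dw => _ /=; rewrite E.
have Iz := state_in Iy t0 E.
have := start_pair Iz s0 mN mC.
rewrite /fdd (_ : [set w0 | _ /\ _] = [set w0 | forall i, B i (X z w0 (u i))]); last first.
  apply/seteqP; split => w' /=.
    by move=> [H1 H2] i; rewrite /B /u; case: ifP.
  by move=> Hw; have := Hw ord0; have := Hw ord_max; rewrite /B /u.
move=> ->; congr (if _ then _ else _); apply/idP/idP; rewrite !inE /=.
  by move=> Nz; rewrite E; exists z.
by rewrite E => -[r Nr [<-]].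
Qed.

(* Right-continuity of the paths makes positivity stable to the right. *)
Lemma law_right_open t J : 0 <= t -> open J -> 0 < law y0 t (in_set J) ->
  exists2 e, 0 < e & forall u, t <= u -> u < t + e -> 0 < law y0 u (in_set J).
Proof.
move=> t0 oJ; apply: contraPP => /forall2NP H; apply/negP; rewrite -leNgt.
have {}H n : exists u, [/\ t <= u, u < t + n.+1%:R^-1 & law y0 u (in_set J) = 0].
  have [|/existsNP[u /not_implyP[tu /not_implyP[ut /negP]]]] := H n.+1%:R^-1.
    by rewrite invr_gt0 ltr0n.
  rewrite -leNgt => le0; exists u; split => //.
  by apply/eqP; rewrite eq_le le0 /law pr_ge0.
have [u Hu] := choice H.
have mJ : borel_state (in_set J) by apply: borel_in_set; exact: open_measurable.
have mu n : measurable [set w | in_set J (X y0 w (u n))].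
  by apply: measurable_state => //; have [tu _ _] := Hu n; exact: le_trans tu.
rewrite -(pr_bigcup0 (P := P y0) mu); last by move=> n; have [_ _] := Hu n.
apply: pr_le; [exact: measurable_state|exact: bigcup_measurable|].
move=> w /= [r Jr E].
have := path_right_continuous (process_cadlag hX w Iy0) t0.
rewrite -E => /(_ (Some @` J)) /=.
have nJ : nbhs r (Some @^-1` (Some @` J)).
  by apply: filterS (open_nbhs_nbhs (conj oJ Jr)) => z Jz /=; exists z.
move=> /(_ nJ) nX.
have /nbhs_ballP[h /= h0 Hh] : nbhs t [set u | t < u -> (Some @` J) (X y0 w u)] by exact: nX.
pose n := Num.truncn h^-1.
have nh : n.+1%:R^-1 < h.
  rewrite invf_plt ?posrE//.
  exact: truncnS_gt.
have [tu un _] := Hu n; exists n => //=.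
move: tu; rewrite le_eqVlt => /orP[/eqP <-|tu]; first by rewrite -E; exists r.
apply: Hh => //=; rewrite /ball /= distrC ger0_norm ?subr_ge0; last exact: ltW.
by rewrite ltrBlDl (lt_trans un)// ltrD2l.
Qed.

Local Notation S := (Supp I P X y0).

Lemma Supp_law x : S x <-> I x /\ forall e, 0 < e -> exists2 t, 0 <= t &
  0 < law y0 t (in_set (ball x e)).
Proof.
have E t e : 0 <= t -> (0 < P y0 [set w | (Some @` ball x e) (X y0 w t)])%E =
    (0 < law y0 t (in_set (ball x e))).
  move=> t0; rewrite /law -lte_fin -prE//.
  by apply: measurable_state => //; exact: borel_in_ball.
by split=> -[Ix H]; split => // e e0; have [t t0 Ht] := H e e0; exists t => //; rewrite ?E// -E.
Qed.

Lemma Supp_open x N : S x -> open N -> N x -> exists2 t, 0 <= t &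
  0 < law y0 t (in_set N).
Proof.
move=> /Supp_law[Ix H] oN Nx.
have /nbhs_ballP[e /= e0 He] := open_nbhs_nbhs (conj oN Nx).
have [t t0 Ht] := H e e0; exists t => //; apply: lt_le_trans Ht _.
apply: pr_le.
- by apply: measurable_state => //; exact: borel_in_ball.
- by apply: measurable_state => //; apply: borel_in_set; exact: open_measurable.
- by move=> w /= [r Br <-]; exists r => //; exact: He.
Qed.

(** Equal integrals of strictly ordered functions would make [N] negligible at every time, although
    it is a neighbourhood of a point of the support. *)
Lemma Supp_separates x N (h1 h2 : R -> R) : S x -> open N -> N x -> N `<=` I ->
  measurable_fun I h1 -> measurable_fun I h2 ->
  (forall z, N z -> 0 <= h1 z) -> (forall z, N z -> h1 z < h2 z) ->
  (forall z, N z -> h2 z <= 1) -> ~ forall t, 0 <= t ->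
  (\int[P y0]_(w in [set w | in_set N (X y0 w t)]) (h1 (odflt 0%R (X y0 w t)))%:E =
   \int[P y0]_(w in [set w | in_set N (X y0 w t)]) (h2 (odflt 0%R (X y0 w t)))%:E)%E.
Proof.
move=> Sx oN Nx NI m1 m2 h10 h12 h21 H; have [t t0 Ht] := Supp_open Sx oN Nx.
have mN : measurable N by exact: open_measurable.
have E := H t t0.
have mh (h : R -> R) : measurable_fun I h ->
    measurable_fun [set w | in_set N (X y0 w t)] (fun w => h (odflt 0 (X y0 w t))).
  move=> mh _ B mB.
  rewrite (_ : _ `&` _ = [set w | in_set (N `&` h @^-1` B) (X y0 w t)]).
    apply: measurable_state => //; apply: borel_in_set.
    have := measurable_funS mI NI mh; exact.
  apply/seteqP; split => w /=.
    by move=> [[r Nr <-]] /= Br; exists r.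
  by move=> [r [Nr Br] <-]; split => //; exists r.
move: Ht; rewrite /law /pr (integral_eq_null _ (mh _ m1) (mh _ m2) _ _ _ E) ?ltxx//.
- by apply: measurable_state => //; exact: borel_in_set.
- by move=> w [r Nr <-]; exact: h10.
- by move=> w [r Nr <-]; exact: h12.
- by move=> w [r Nr <-]; exact: h21.
Qed.

(** A single time [s] serves all [x] near [z]: [k * c z * s] is placed at [r0 + e / 2], in the
    middle of a window of times at which [J] is charged, and the continuity of [c] keeps
    [k * c x * s] in the window. *)
Lemma positive_law_near z k r0 J : I z -> 0 < k -> 0 <= r0 -> open J ->
  0 < law y0 r0 (in_set J) -> exists2 s, 0 <= s & exists2 h, 0 < h &
  forall x, `|x - z| < h -> I x /\ 0 < law y0 (k * c x * s) (in_set J).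
Proof.
move=> Iz k0 r00 oJ lJ; have [e e0 He] := law_right_open r00 oJ lJ.
have cz := Defs.inv_pos hf Iz; have kcz : 0 < k * c z by exact: mulr_gt0.
pose s := (r0 + e / 2) / (k * c z).
have s0 : 0 < s by rewrite divr_gt0//; lra.
have sE : k * c z * s = r0 + e / 2 by rewrite /s mulrC mulfVK ?gt_eqF.
exists s; first exact: ltW.
have ck : k * c x * s @[x --> z] --> k * c z * s.
  by apply: cvgMl; apply: cvgMr; exact: c_continuous.
have e2 : 0 < e / 2 by lra.
have nI : \forall x \near z, I x by exact: open_nbhs_nbhs.
have /nbhs_ballP[h /= h0 Hh] : nbhs z (I `&` [set x | `|k * c z * s - k * c x * s| < e / 2]).
  by apply: filterI => //; move/cvgrPdist_lt : ck => /(_ _ e2).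
exists h => // x xz; have [|Ix] := Hh x; first by rewrite /ball /= distrC.
rewrite sE /= ltr_norml => /andP[h1 h2]; split => //.
by apply: He; lra.
Qed.

(** The process visits neighbourhoods of [z]; from a point [x] nearby it moves like the image under
    [f x] of the process from [y0], and so visits neighbourhoods of [f z w]. If it did not, the
    positive function [law x s] would have integral 0 at all times, against [Supp_separates]. *)
Lemma Supp_f z w : S z -> S w -> S (f z w).
Proof.
move=> Sz Sw; have [Iz _] := Sz; have [Iw _] := Sw.
apply/Supp_law; split; first exact: f_in.
move=> e e0; have [h h0 Hh] := f_continuous2 Iz Iw e0.
have oB (x r : R) : open (ball x r) by exact: ball_open.
have [r0 r00 lr] := Supp_open Sw (oB w h) (ballxx w h0).
have [s s0 [h' h'0 Hh']] := positive_law_near Iz ltr01 r00 (oB w h) lr.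
set B := ball (f z w) e; have mB : borel_state (in_set B).
  exact: borel_in_ball.
pose hm := Num.min h h'; have hm0 : 0 < hm by rewrite lt_min h0.
have hN x : ball z hm x -> [/\ I x, `|x - z| < h & `|x - z| < h'].
  rewrite /ball /= distrC /hm lt_min => /andP[xh xh']; split => //.
  by have [] := Hh' x xh'.
have pos x : ball z hm x -> 0 < law x s (in_set B).
  move=> /hN[Ix xh xh']; rewrite law_pull//.
  have [_ lt0] := Hh' x xh'; rewrite mul1r in lt0.
  have cx0 : 0 <= c x * s by exact: c_time.
  apply: (lt_le_trans lt0); apply: pr_le.
  - by apply: measurable_state => //; apply: borel_in_set; exact: open_measurable.
  - by apply: measurable_state => //; exact: borel_pull.
  - move=> w' /= [r Br E]; have Ir := state_in Iy0 cx0 (esym E).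
    rewrite /pull -E; split => //; exists (f x r) => //.
    have [||_ _ H] := Hh x r => //; first by move: Br; rewrite /ball /= distrC.
    by rewrite /B /ball /= distrC.
have mN : measurable (ball z hm) by exact: open_measurable.
have NI : ball z hm `<=` I by move=> x /hN[].
apply: contrapT => /forall2NP H.
apply: (@Supp_separates z _ (fun=> 0) (fun x => law x s (in_set B)) Sz (oB _ _)
    (ballxx z hm0)) => //; first exact: law_measurable.
  by move=> x /NI Ix; apply: pr_le1; exact: measurable_state.
move=> t t0; have E : 0 = law y0 (t + s) (in_set B).
  by have [|/negP] := H (t + s); rewrite ?addr_ge0// lt_neqAle pr_ge0 andbT negbK => /eqP.
have ts0 : 0 <= t + s by exact: addr_ge0.
rewrite -Markov_two_times// integral0; apply/esym/eqP; rewrite eq_le measure_ge0 andbT.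
have mS : measurable [set w | in_set B (X y0 w (t + s))] by exact: measurable_state.
apply: (@le_trans _ _ (P y0 [set w | in_set B (X y0 w (t + s))])).
  apply: le_measure; rewrite ?inE//; last by move=> w' [].
  by apply: measurableI => //; apply: measurable_state => //; exact: borel_in_set.
by rewrite prE// -[pr _ _]/(law y0 (t + s) (in_set B)) -E.
Qed.

(** Under Assumption 2, [f y] carries the neighbourhood of [y] in its support back to one of [y0];
    [Supp_f] then spreads it around every point of the support. The support is thus open, and it is
    closed in the connected [I]. *)
Lemma Supp_full : assumption1 I P X y0 \/ assumption2 I P X -> forall x, I x -> S x.
Proof.
case=> [A1 x Ix|[y Iy Sy]]; first by rewrite -A1.
have pc z u e : I z -> I u -> 0 < e -> exists2 h, 0 < h &
    forall v, `|v - u| < h -> I v /\ `|pinv I (f z) v - pinv I (f z) u| < e.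
  move=> Iz Iu e0; have := pinv_within_continuous Iz.
  rewrite continuous_open_subspace// => /(_ u); rewrite inE => /(_ Iu) /cvgrPdist_lt/(_ _ e0) H.
  have nI : \forall x \near u, I x by exact: open_nbhs_nbhs.
  have /nbhs_ballP[h /= h0 Hh] : nbhs u (I `&` [set v | `|pinv I (f z) u - pinv I (f z) v| < e]).
    exact: filterI nI H.
  by exists h => // v vu; have [|Iv /=] := Hh v; rewrite ?/ball /= distrC.
(* Pulling back through [f y], with [f y y0 = y], gives a whole neighbourhood of [y0] inside the
   support. *)
have [d0 d00 Hd] : exists2 h, 0 < h & forall x, `|x - y0| < h -> S x.
  have /nbhs_ballP[e /= e0 He] : nbhs y (Supp I P X y) by exact: Sy.
  have [h h0 Hh] := f_continuous2 Iy Iy0 e0; exists h => // x xh.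
  have [||_ Ix] := Hh y x; rewrite ?subrr ?normr0// f_start// => fx.
  have [Ifx] : Supp I P X y (f y x) by apply: He; rewrite /ball /= distrC.
  move=> Hfx; apply/Supp_law; split => // e1 e10.
  have [h1 h10 Hh1] := pc y (f y x) e1 Iy Ifx e10.
  have [t t0 Pt] := Hfx h1 h10; exists (c y * t); first exact: c_time.
  have mB := borel_in_ball (f y x) h1.
  have ct0 : 0 <= c y * t by exact: c_time.
  have : 0 < law y t (in_set (ball (f y x) h1)).
    rewrite /law -lte_fin -prE//; exact: measurable_state.
  rewrite law_pull// => /lt_le_trans; apply; apply: pr_le.
  - by apply: measurable_state => //; exact: borel_pull.
  - by apply: measurable_state => //; exact: borel_in_ball.
  - move=> w /=; rewrite /pull; case E : (X y0 w (c y * t)) => [r|]; last by case.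
    move=> [Ir [r' Br [rE]]]; exists r => //.
    have [|_] := Hh1 (f y r); first by rewrite -rE; move: Br; rewrite /ball /= distrC.
    by rewrite !pinv_fK// /ball /= distrC.
have oS : open S.
  (* For [x] near [z], the point [pinv I (f z) x] is near [y0], hence in the support, and [Supp_f]
     sends it to [x]. *)
  rewrite openE => z Sz; have [Iz _] := Sz.
  have [h h0 Hh] := pc z z d0 Iz Iz d00.
  apply/nbhs_ballP; exists h => // x; rewrite /ball /= distrC => xz.
  have [Ix] := Hh x xz; rewrite -[X in `|_ - pinv _ _ X|](f_start Iz) pinv_fK// => /Hd Sx.
  by rewrite -(f_pinvK Iz Ix); exact: Supp_f.
have cI : connected I by apply/connected_intervalP.
have SI : S = I; last by move=> x Ix; rewrite SI.
apply: cI.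
- by exists y0; apply: Hd; rewrite subrr normr0.
- exists S => //; apply/seteqP; split => x; last by case.
  by move=> Sx; split => //; case: Sx.
- exists (closure S); first exact: closed_closure.
  apply/seteqP; split => x; first by move=> Sx; split; [case: Sx|exact: subset_closure].
  move=> [Ix cx]; apply/Supp_law; split => // e e0.
  have [z [Sz Bz]] := cx _ (nbhsx_ballx x e e0).
  exact: Supp_open Sz (ball_open _ _) Bz.
Qed.

(** Two computations of one two-time probability for the process started from [y]: the Markov
    property followed by self-similarity, or self-similarity followed by the Markov property from
    [y0]. *)
Lemma Markov_self_similar y M t s C : I y -> measurable M -> M `<=` I ->
  0 <= t -> 0 <= s -> borel_state C ->
  (\int[P y0]_(w in [set w | in_set M (X y0 w t)]) (law (f y (odflt 0%R (X y0 w t))) s C)%:E =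
   \int[P y0]_(w in [set w | in_set M (X y0 w t)])
     (law (odflt 0%R (X y0 w t)) (c y * s) (pull y C))%:E)%E.
Proof.
move=> Iy mM MI t0 s0 mC; have cy := Defs.inv_pos hf Iy.
(* The image of [M] under [f y], written as a preimage under the continuous inverse so that it is
   measurable. *)
pose N := [set z | I z /\ M (pinv I (f y) z)].
have mN : measurable N.
  have := subspace_continuous_measurable_fun mI (pinv_within_continuous Iy).
  by move=> /(_ mI M mM).
have NI : N `<=` I by move=> z [].
have t'0 : 0 <= t / c y by rewrite divr_ge0// ltW.
have ct : c y * (t / c y) = t by rewrite mulrC mulfVK// gt_eqF.
have pullN w : pull y (in_set N) (X y0 w t) <-> in_set M (X y0 w t).
  rewrite /pull; case E : (X y0 w t) => [r|]; last by split => -[].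
  split=> [[Ir [z [Iz Mz] [zE]]]|[z Mz [zr]]].
    by exists r => //; rewrite zE pinv_fK in Mz.
  have Ir : I r by rewrite -zr; exact: MI.
  split => //; exists (f y r) => //; split; first exact: f_in.
  by rewrite pinv_fK// -zr.
have mNs : borel_state (in_set N) by exact: borel_in_set.
have <- : P y [set w | in_set N (X y w (t / c y)) /\ C (X y w (t / c y + s))] =
    (\int[P y0]_(w in [set w | in_set M (X y0 w t)])
      (law (odflt 0%R (X y0 w t)) (c y * s) (pull y C))%:E)%E.
  have cs0 : 0 <= c y * s by exact: c_time.
  rewrite same_pair_law// ?addr_ge0// mulrDr ct -Markov_two_times//; last exact: borel_pull.
  by congr (P y0 _); apply/seteqP; split => w /= [/pullN].
rewrite Markov_two_times//.
pose h z := (law z s C)%:E.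
have mh : measurable_fun N h.
  by apply/measurable_EFinP; exact: measurable_funS mI NI (law_measurable s0 mC).
rewrite [RHS](integral_same_state (h := h) (P2 := P y0) (Y2 := fun w => omap (f y) (X y0 w t)))//.
- have -> : [set w | (Some @` N) (omap (f y) (X y0 w t))] = [set w | in_set M (X y0 w t)].
    apply/seteqP; split => w /=.
      by move=> H; apply/pullN/pullP.
    by move=> /pullN/pullP; apply.
  by apply: eq_integral => w; rewrite inE => -[r Mr <-].
- by move=> C' mC'; exact: measurable_state.
- move=> C' mC'; rewrite (_ : [set w | _] = [set w | pull y C' (X y0 w t)]).
    by apply: measurable_state => //; exact: borel_pull.
  by apply/seteqP; split => w /=; move=> H; apply/pullP.
- move=> C' mC'; rewrite same_state_law// ct; congr (P y0 _).
  by apply/seteqP; split => w /=; move=> H; apply/pullP.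
- by move=> z _; rewrite lee_fin pr_ge0.
Qed.

Hypothesis hA : assumption1 I P X y0 \/ assumption2 I P X.

Let le_set a : set (option R) := [set o | if o is Some r then r <= a else False].

Let borel_le_set a : borel_state (le_set a).
Proof.
rewrite /borel_state (_ : _ @^-1` _ = `]-oo, a]%classic); first exact: measurable_itv.
by apply/seteqP; split => r; rewrite /= in_itv.
Qed.

Let law_lt r J C1 C2 : 0 <= r -> open J -> borel_state C1 -> borel_state C2 ->
  0 < law y0 r (in_set J) ->
  (forall q, I q -> C1 (Some q) -> C2 (Some q)) -> ~ C1 None ->
  (forall q, I q -> J q -> C2 (Some q) /\ ~ C1 (Some q)) ->
  law y0 r C1 < law y0 r C2.
Proof.
move=> r0 oJ mC1 mC2 lJ C12 C1N J21.
have mJ : borel_state (in_set J) by apply: borel_in_set; exact: open_measurable.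
have m1 := measurable_state Iy0 r0 mC1; have m2 := measurable_state Iy0 r0 mC2.
have m3 := measurable_state Iy0 r0 mJ.
rewrite /law (prID (P y0) m2 m1).
have -> : [set w | C2 (X y0 w r)] `&` [set w | C1 (X y0 w r)] = [set w | C1 (X y0 w r)].
  apply/seteqP; split => [w []//|w /= H]; split => //=.
  by move: H; case E : (X y0 w r) => [q|//] H; apply: C12 => //; exact: state_in E.
rewrite ltrDl; apply: (lt_le_trans lJ); apply: pr_le => //; first exact: measurableD.
move=> w /= [q Jq E]; have Iq := state_in Iy0 r0 (esym E).
by have [H1 H2] := J21 q Iq Jq; rewrite -E.
Qed.

Lemma f_comp y x w : I y -> I x -> I w -> f y (f x w) = f (f y x) w.
Proof.
move=> Iy Ix Iw.
have [_ _ cM] := hg.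
have Sall := Supp_full hA.
have near_f u v (e : R) : I u -> I v -> 0 < e -> exists2 h, 0 < h & forall u' v',
    `|u' - u| < h -> `|v' - v| < h -> [/\ I u', I v' & `|f u' v' - f u v| < e].
  by move=> Iu Iv; exact: f_continuous2.
(* If the two sides are separated by [a] near [(x, w)], then on a neighbourhood
   of [x] the two sides of [Markov_self_similar] have strictly ordered integrands. *)
pose T1 x' w' := f (f y x') w'; pose T2 x' w' := f y (f x' w').
have nT1 e : 0 < e -> exists2 h, 0 < h & forall x' w', `|x' - x| < h -> `|w' - w| < h ->
    [/\ I x', I w' & `|T1 x' w' - T1 x w| < e].
  move=> e0; have [h1 h10 H1] := near_f (f y x) w e (f_in Iy Ix) Iw e0.
  have [h2 h20 H2] := near_f y x h1 Iy Ix h10.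
  exists (Num.min h1 h2); first by rewrite lt_min h10.
  move=> x' w'; rewrite !lt_min => /andP[_ x2] /andP[w1 _].
  have yy : `|y - y| < h2 by rewrite subrr normr0.
  have [_ Ix' fx'] := H2 y x' yy x2.
  by have [_ Iw' H] := H1 _ _ fx' w1.
have nT2 e : 0 < e -> exists2 h, 0 < h & forall x' w', `|x' - x| < h -> `|w' - w| < h ->
    [/\ I x', I w' & `|T2 x' w' - T2 x w| < e].
  move=> e0; have [h1 h10 H1] := near_f y (f x w) e Iy (f_in Ix Iw) e0.
  have [h2 h20 H2] := near_f x w h1 Ix Iw h10.
  exists h2 => // x' w' xx' ww'; have [Ix' Iw' fx'] := H2 _ _ xx' ww'.
  have yy : `|y - y| < h1 by rewrite subrr normr0.
  by have [_ _ H] := H1 y (f x' w') yy fx'.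
have mono1 x' a b : I x' -> I a -> I b -> a < b -> T1 x' a < T1 x' b.
  by move=> Ix' Ia Ib; apply: f_mono => //; exact: f_in.
have mono2 x' a b : I x' -> I a -> I b -> a < b -> T2 x' a < T2 x' b.
  by move=> Ix' Ia Ib ab; apply: f_mono => //; [exact: f_in..|exact: f_mono].
have mle1 x' a b : I x' -> I a -> I b -> a <= b -> T1 x' a <= T1 x' b.
  by move=> Ix' Ia Ib; rewrite le_eqVlt => /orP[/eqP ->//|ab]; apply/ltW/mono1.
have mle2 x' a b : I x' -> I a -> I b -> a <= b -> T2 x' a <= T2 x' b.
  by move=> Ix' Ia Ib; rewrite le_eqVlt => /orP[/eqP ->//|ab]; apply/ltW/mono2.
rewrite -/(T1 x w) -/(T2 x w); apply/eqP/negPn/negP => neq.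
(* [a] is the midpoint and [e] the distance from it to either value: staying within [e] of its value
   keeps each side strictly on its side of [a]. *)
pose a := (T1 x w + T2 x w) / 2.
pose e := `|T1 x w - T2 x w| / 2.
have e0 : 0 < e by rewrite divr_gt0// normr_gt0 subr_eq0 eq_sym.
have [h1 h10 H1] := nT1 e e0; have [h2 h20 H2] := nT2 e e0.
pose h := Num.min h1 h2; have h0 : 0 < h by rewrite lt_min h10.
have oJ : open (ball w h) by exact: ball_open.
have [r0 r00 lr] := Supp_open (Sall w Iw) oJ (ballxx w h0).
have cy := Defs.inv_pos hf Iy.
have [s s0 [h' h'0 Hh']] := positive_law_near Ix cy r00 oJ lr.
pose hm := Num.min h h'; have hm0 : 0 < hm by rewrite lt_min h0.
have hN x' : ball x hm x' -> [/\ I x', `|x' - x| < h & `|x' - x| < h'].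
  rewrite /ball /= distrC /hm lt_min => /andP[xh xh']; split => //.
  by have [] := Hh' x' xh'.
have oN : open (ball x hm) by exact: ball_open.
have mN : measurable (ball x hm) by exact: open_measurable.
have NI : ball x hm `<=` I by move=> x' /hN[].
have sep x' w' : ball x hm x' -> ball w h w' -> I w' /\
    `|T1 x' w' - T1 x w| < e /\ `|T2 x' w' - T2 x w| < e.
  move=> /hN[Ix' xh _]; rewrite /ball /= distrC => wh.
  move: xh wh; rewrite /h !lt_min => /andP[x1 x2] /andP[w1 w2].
  by have [_ Iw' ?] := H1 _ _ x1 w1; have [] := H2 _ _ x2 w2.
pose g1 x' := law (f y x') s (le_set a); pose g2 x' := law x' (c y * s) (pull y (le_set a)).
have cs0 : 0 <= c y * s by exact: c_time.
have mg1 : measurable_fun I g1.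
  apply: (measurable_comp mI _ (law_measurable s0 (borel_le_set a))).
    by move=> _ [x' Ix' <-]; exact: f_in.
  exact: (subspace_continuous_measurable_fun mI (f_within_continuous Iy)).
have mg2 : measurable_fun I g2.
  by apply: law_measurable => //; exact: borel_pull.
have MSS t (t0 : 0 <= t) := Markov_self_similar Iy mN NI t0 s0 (borel_le_set a).
have pos x' : ball x hm x' -> 0 <= c y * c x' * s.
  by move=> /NI Ix'; rewrite !mulr_ge0// ltW// (Defs.inv_pos hf).
(* The goodness relation [c (f y x') = c y * c x'] enters here: both sides become laws from [y0] at
   the same time [c y * c x' * s], so only the events differ. *)
have g1E x' : ball x hm x' -> g1 x' = law y0 (c y * c x' * s) (pull (f y x') (le_set a)).
  by move=> /NI Ix'; rewrite /g1 law_pull ?cM//; exact: f_in.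
have g2E x' : ball x hm x' -> g2 x' = law y0 (c y * c x' * s) (pull x' (pull y (le_set a))).
  move=> /NI Ix'; rewrite /g2 law_pull//; last exact: borel_pull.
  by have -> : c x' * (c y * s) = c y * c x' * s by ring.
have b1 x' : ball x hm x' -> borel_state (pull (f y x') (le_set a)).
  by move=> /NI Ix'; apply: borel_pull => //; exact: f_in.
have b2 x' : ball x hm x' -> borel_state (pull x' (pull y (le_set a))).
  by move=> /NI Ix'; apply: borel_pull => //; exact: borel_pull.
have ww : ball w h w by exact: ballxx.
have [lt12|lt21] := ltP (T1 x w) (T2 x w).
  have eE : e = (T2 x w - T1 x w) / 2 by rewrite /e distrC ger0_norm// subr_ge0 ltW.
  have MSS' t (t0 : 0 <= t) := esym (MSS t t0).
  apply: (Supp_separates (Sall x Ix) oN (ballxx x hm0) NI mg2 mg1) MSS'.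
  - by move=> x' _; exact: pr_ge0.
  - move=> x' Bx'; rewrite g1E// g2E//; have [Ix' _ xh'] := hN _ Bx'.
    have [_ lpos] := Hh' x' xh'.
    apply: (law_lt (pos _ Bx') oJ (b2 _ Bx') (b1 _ Bx') lpos) => //.
      move=> q Iq [_ [Ifq le2]]; split => //=; rewrite -/(T1 x' q).
      rewrite /= -/(T2 x' q) in le2.
      (* The estimates hold near [w] only; monotonicity in the last variable extends the inclusion
         of the two events to all [q] in [I]. *)
      have qw : q <= w.
        rewrite leNgt; apply/negP => wq.
        have := mono2 x' w q Ix' Iw Iq wq; have [_ [_]] := sep _ _ Bx' ww.
        rewrite ltr_norml eE /a in le2 *; lra.
      have := mle1 x' q w Ix' Iq Iw qw; have [_ [+ _]] := sep _ _ Bx' ww.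
      by rewrite ltr_norml eE /a; lra.
    move=> q Iq Jq; have [_ [d1 d2]] := sep _ _ Bx' Jq.
    move: d1 d2; rewrite !ltr_norml eE => d1 d2; split.
      by split => //=; rewrite -/(T1 x' q) /a; lra.
    by move=> [_ [_]] /=; rewrite -/(T2 x' q) /a; lra.
  - move=> x' Bx'; rewrite g1E//; apply: pr_le1; apply: measurable_state => //.
      exact: pos.
    exact: b1.
have {}lt21 : T2 x w < T1 x w by rewrite lt_neqAle neq lt21.
have eE : e = (T1 x w - T2 x w) / 2 by rewrite /e ger0_norm// subr_ge0 ltW.
apply: (Supp_separates (Sall x Ix) oN (ballxx x hm0) NI mg1 mg2) MSS.
- by move=> x' _; exact: pr_ge0.
- move=> x' Bx'; rewrite g1E// g2E//; have [Ix' _ xh'] := hN _ Bx'.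
  have [_ lpos] := Hh' x' xh'.
  apply: (law_lt (pos _ Bx') oJ (b1 _ Bx') (b2 _ Bx') lpos) => //.
    move=> q Iq [_ le1]; rewrite /= -/(T1 x' q) in le1.
    split => //; split; first exact: f_in.
    rewrite /= -/(T2 x' q).
    have qw : q <= w.
      rewrite leNgt; apply/negP => wq.
      have := mono1 x' w q Ix' Iw Iq wq; have [_ [+ _]] := sep _ _ Bx' ww.
      rewrite ltr_norml eE /a in le1 *; lra.
    have := mle2 x' q w Ix' Iq Iw qw; have [_ [_]] := sep _ _ Bx' ww.
    by rewrite ltr_norml eE /a; lra.
  move=> q Iq Jq; have [_ [d1 d2]] := sep _ _ Bx' Jq.
  move: d1 d2; rewrite !ltr_norml eE => d1 d2; split.
    by split => //; split; [exact: f_in|rewrite /= -/(T2 x' q) /a; lra].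
  by move=> [_] /=; rewrite -/(T1 x' q) /a; lra.
- move=> x' Bx'; rewrite g2E//; apply: pr_le1; apply: measurable_state => //.
    exact: pos.
  exact: b2.
Qed.

End self_similar_process.

(** * Functions of class C^k of one real variable *)

Section one_dimensional_Ck.
Variable R : realType.
Implicit Types (U V : set R) (f g h : R -> R) (k : nat).

(** Iterated derivatives in place of differentials: closure under products, inverses and composition
    is a direct induction here, and [Ck_C1d] transfers it to [Ck] on open sets. *)
Fixpoint C1d k U h : Prop :=
  if k is k'.+1 then (forall x, U x -> derivable h x 1) /\ C1d k' U (derive1 h)
  else forall x, U x -> {for x, continuous h}.

Lemma near_open (T : topologicalType) (U Q : set T) x : open U -> U x ->
  (forall z, U z -> Q z) -> \forall z \near x, Q z.
Proof.
by move=> oU Ux UQ; apply: filterS (open_nbhs_nbhs (conj oU Ux)) => z; exact: UQ.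
Qed.

Lemma C1d_ext k U g h : open U -> (forall x, U x -> g x = h x) -> C1d k U g -> C1d k U h.
Proof.
move=> oU; elim: k g h => [|k IH] g h E /=.
  move=> H x Ux; have : g @ x --> g x by exact: H.
  rewrite (E x Ux); apply: cvg_trans; apply: near_eq_cvg.
  exact: near_open E.
move=> [dg H]; split=> [x Ux|].
  by apply: near_eq_derivable (dg x Ux); exact: near_open E.
apply: (IH (derive1 g)) H => x Ux.
by rewrite !derive1E; apply: near_eq_derive; exact: near_open E.
Qed.

Lemma C1d_weaken k U h : C1d k.+1 U h -> C1d k U h.
Proof.
elim: k h => [|k IH] h [dh H].
  move=> x Ux; apply: differentiable_continuous.
  by apply/derivable1_diffP; exact: dh.
by split => //; exact: IH.
Qed.

Lemma C1d_continuous k U h : C1d k U h -> forall x, U x -> {for x, continuous h}.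
Proof. by elim: k => //= k IH /C1d_weaken; exact: IH. Qed.

Lemma C1d_intro k U h h' : open U -> (forall x, U x -> is_derive x 1 h (h' x)) ->
  C1d k U h' -> C1d k.+1 U h.
Proof.
move=> oU dh H; split=> [x Ux|]; first exact: (@ex_derive _ _ _ _ _ _ _ (dh x Ux)).
apply: C1d_ext H => // x Ux; rewrite derive1E.
by rewrite (@derive_val _ _ _ _ _ _ _ (dh x Ux)).
Qed.

Lemma C1d_is_derive k U h x : C1d k.+1 U h -> U x -> is_derive x 1 h (derive1 h x).
Proof. by move=> [dh _] Ux; rewrite derive1E; apply: derivableP; exact: dh. Qed.

Lemma C1d_cst k U (a : R) : open U -> C1d k U (fun=> a).
Proof.
move=> oU; elim: k a => [|k IH] a; first by move=> x _; exact: cvg_cst.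
by apply: (C1d_intro (h' := fun=> 0)) => // x _; exact: is_derive_cst.
Qed.

Lemma C1d_add k U f g : open U -> C1d k U f -> C1d k U g -> C1d k U (fun x => f x + g x).
Proof.
move=> oU; elim: k f g => [|k IH] f g cf cg.
  by move=> x Ux; apply: cvgD; [exact: cf|exact: cg].
apply: (C1d_intro (h' := fun x => derive1 f x + derive1 g x)) => //.
  move=> x Ux; have df := C1d_is_derive cf Ux; have dg := C1d_is_derive cg Ux.
  exact: is_deriveD.
by apply: IH; [case: cf|case: cg].
Qed.

Lemma C1d_mul k U f g : open U -> C1d k U f -> C1d k U g -> C1d k U (fun x => f x * g x).
Proof.
move=> oU; elim: k f g => [|k IH] f g cf cg.
  by move=> x Ux; apply: cvgM; [exact: cf|exact: cg].
apply: (C1d_intro (h' := fun x => f x * derive1 g x + g x * derive1 f x)) => //.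
  move=> x Ux; have df := C1d_is_derive cf Ux; have dg := C1d_is_derive cg Ux.
  exact: is_deriveM.
apply: C1d_add => //; apply: IH; [exact: C1d_weaken|by case: cg|exact: C1d_weaken|by case: cf].
Qed.

Lemma C1d_inv k U f : open U -> (forall x, U x -> f x != 0) -> C1d k U f ->
  C1d k U (fun x => (f x)^-1).
Proof.
move=> oU f0; elim: k => [|k IH] cf.
  by move=> x Ux; apply: cvgV; [exact: f0|exact: cf].
have ci := IH (C1d_weaken cf).
apply: (C1d_intro (h' := fun x => (- 1) * ((f x)^-1 * ((f x)^-1 * derive1 f x)))) => //.
  move=> x Ux; have df := C1d_is_derive cf Ux.
  have dfx := @ex_derive _ _ _ _ _ _ _ df.
  split; first by apply: derivableV dfx; exact: f0.
  rewrite deriveV//; last exact: f0.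
  by rewrite derive_val /GRing.scale /= expr2 invfM mulN1r mulNr mulrA.
apply: C1d_mul => //; first exact: C1d_cst.
by do 2 apply: C1d_mul => //; case: cf.
Qed.

Lemma C1d_comp k U V f h : open U -> open V -> (forall x, U x -> V (h x)) ->
  C1d k V f -> C1d k U h -> C1d k U (f \o h).
Proof.
move=> oU oV hUV; elim: k f => [|k IH] f cf ch.
  by move=> x Ux; apply: continuous_comp; [exact: ch|exact/cf/hUV].
apply: (C1d_intro (h' := fun x => (derive1 f \o h) x * derive1 h x)) => //.
  move=> x Ux; have df := C1d_is_derive cf (hUV x Ux); have dh := C1d_is_derive ch Ux.
  have dfh := @ex_derive _ _ _ _ _ _ _ df; have dhx := @ex_derive _ _ _ _ _ _ _ dh.
  split; last by rewrite -derive1E derive1_comp.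
  by apply/derivable1_diffP; apply: differentiable_comp; apply/derivable1_diffP.
apply: C1d_mul => //; last by case: ch.
by apply: IH; [case: cf|exact: C1d_weaken].
Qed.

Lemma Ck_C1d k U h : open U -> Ck k U h <-> C1d k U h.
Proof.
move=> oU; elim: k h => [|k IH] h //=; split.
  move=> [dh H]; split=> [x Ux|]; first by apply/derivable1_diffP; exact: dh.
  apply: C1d_ext (_ : C1d k U (fun p => 'd h p 1)) => //.
    by move=> x Ux; rewrite diff1E ?scale1r//; exact: dh.
  by apply/IH; exact: H.
move=> [dh H]; have diffh p : U p -> differentiable h p.
  by move=> Up; apply/derivable1_diffP; exact: dh.
split => // v; apply/IH.
apply: C1d_ext (_ : C1d k U (fun p => v * derive1 h p)) => //.
  by move=> x Ux; rewrite diff1E//; exact: diffh.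
by apply: C1d_mul => //; exact: C1d_cst.
Qed.

(** The derivative of the slice is the slice of the differential in direction [(1, 0)], to which the
    induction applies. *)
Lemma Ck_slice k (W : set (R * R)) U (G : R * R -> R) (b : R) : open U ->
  (forall z, U z -> W (z, b)) -> Ck k W G -> C1d k U (fun z => G (z, b)).
Proof.
move=> oU UW; elim: k G => [|k IH] G /=.
  move=> cG x Ux; have cxb : (fun z : R => (z, b)) @ x --> (x, b).
    exact: (cvg_pair (@cvg_id _ (nbhs x)) (cvg_cst b)).
  exact: (cvg_comp _ _ cxb (cG _ (UW x Ux))).
move=> [dG H]; apply: (C1d_intro (h' := fun z => 'd G (z, b) (1, 0))) => //; last exact: (IH (fun p => 'd G p (1, 0)) (H (1, 0))).
move=> x Ux.
have d1 : differentiable (fun z : R => (z, b)) x.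
  by apply: differentiable_pair.
have d2 := dG _ (UW x Ux).
have dc : differentiable (G \o fun z : R => (z, b)) x by exact: differentiable_comp.
split; first by apply/derivable1_diffP.
rewrite deriveE// diff_comp//= diff_pair//=.
by rewrite diff_cst (diff_val (f := id)).
Qed.

End one_dimensional_Ck.

Lemma derive_of_is_derive (R : realType) (h : R -> R) (x l : R) :
  is_derive x 1 h l -> derivable h x 1 /\ derive1 h x = l.
Proof. by move=> dh; split; [exact: (@ex_derive _ _ _ _ _ _ _ dh)|rewrite derive1E derive_val]. Qed.

Lemma is_derive_of_derivable (R : realType) (h : R -> R) (x : R) :
  derivable h x 1 -> is_derive x 1 h (derive1 h x).
Proof. by move=> dh; rewrite derive1E; exact: derivableP. Qed.

Lemma is_derive_chain (R : realType) (f h : R -> R) (x df dh : R) :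
  is_derive x 1 h dh -> is_derive (h x) 1 f df -> is_derive x 1 (f \o h) (df * dh).
Proof.
move=> /derive_of_is_derive[dh1 <-] /derive_of_is_derive[df1 <-].
split; last by rewrite -derive1E derive1_comp.
by apply/derivable1_diffP; apply: differentiable_comp; apply/derivable1_diffP.
Qed.

Lemma is_derive_continuous (R : realType) (h : R -> R) (x l : R) :
  is_derive x 1 h l -> {for x, continuous h}.
Proof.
move=> /derive_of_is_derive[dh _]; apply: differentiable_continuous.
exact/derivable1_diffP.
Qed.

(** * Calculus on an open interval *)

Section interval_calculus.
Variables (R : realType) (I : set R).
Hypothesis oI : open I.
Hypothesis iI : is_interval I.

Lemma itv_within_continuous (h : R -> R) (a b : R) : I a -> I b ->
  (forall x, I x -> {for x, continuous h}) -> {within `[a, b], continuous h}.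
Proof.
move=> Ia Ib ch; apply: continuous_in_subspaceT => z; rewrite inE /= in_itv /= => zab.
exact/ch/(iI Ia Ib).
Qed.

Lemma MVT_interval (h dh : R -> R) (a b : R) : I a -> I b -> a < b ->
  (forall x, I x -> is_derive x 1 h (dh x)) ->
  exists2 z, I z & h b - h a = dh z * (b - a).
Proof.
move=> Ia Ib ab dI; have [||z zab ->] := MVT ab (f := h) (df := dh).
- move=> x; rewrite in_itv /= => /andP[ax xb]; apply/dI/(iI Ia Ib).
  by rewrite !ltW.
- by apply: (itv_within_continuous Ia Ib) => x Ix; exact: is_derive_continuous (dI x Ix).
- exists z => //; move: zab; rewrite in_itv /= => /andP[az zb].
  by apply: (iI Ia Ib); rewrite !ltW.
Qed.

Lemma derive0_cst (h : R -> R) : (forall x, I x -> is_derive x 1 h 0) ->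
  forall a b, I a -> I b -> h a = h b.
Proof.
move=> dh; suff H (a b : R) : I a -> I b -> a < b -> h a = h b.
  move=> a b Ia Ib; have [ab|ba|->//] := ltgtP a b; first exact: H.
  by apply/esym/H.
move=> Ia Ib ab; have [z _] := MVT_interval Ia Ib ab dh.
by rewrite mul0r => /eqP; rewrite subr_eq0 => /eqP.
Qed.

Lemma open_interval_lt x : I x -> exists2 a, I a & a < x.
Proof.
move=> Ix; have /nbhs_ballP[e /= e0 He] : nbhs x I by exact: open_nbhs_nbhs.
by exists (x - e / 2); [apply: He; rewrite /ball /= opprB addrC subrK ger0_norm|]; lra.
Qed.

Lemma open_interval_gt x : I x -> exists2 a, I a & x < a.
Proof.
move=> Ix; have /nbhs_ballP[e /= e0 He] : nbhs x I by exact: open_nbhs_nbhs.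
exists (x + e / 2); [apply: He; rewrite /ball /= opprD addrA subrr sub0r normrN ger0_norm|]; lra.
Qed.

Lemma itv_integrable (h : R -> R) (a b : R) : I a -> I b ->
  (forall x, I x -> {for x, continuous h}) ->
  (@lebesgue_measure R).-integrable `[a, b] (EFin \o h).
Proof.
move=> Ia Ib ch; apply: continuous_compact_integrable; first exact: segment_compact.
exact: itv_within_continuous.
Qed.

Lemma oriented_integral_derive (h : R -> R) (y0 y : R) : I y0 -> I y ->
  (forall x, I x -> {for x, continuous h}) ->
  is_derive y 1 (fun y => oriented_integral y0 y h) (h y).
Proof.
move=> Iy0 Iy ch.
(* [a] and [u] enclose both [y0] and [y] strictly, so that the primitive [F] based at [a] covers
   both orientations of the integral. *)
have [a Ia am] : exists2 a, I a & a < Num.min y0 y.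
  by apply: open_interval_lt; rewrite minEle; case: ifP.
have [u Iu um] : exists2 u, I u & Num.max y0 y < u.
  by apply: open_interval_gt; rewrite maxEle; case: ifP.
move: am um; rewrite lt_min gt_max => /andP[ay0 ay] /andP[y0u yu].
have iau := itv_integrable Ia Iu ch.
have [|dF F'] := continuous_FTC1 yu iau _ (ch _ Iy); first by rewrite ?bnd_simp ?lte_fin ?ltW.
pose F x := \int[@lebesgue_measure R]_(t in `[a, x]) h t.
have dFy : is_derive y 1 F (h y) by rewrite -F'; exact: is_derive_of_derivable.
have inc v w : a <= v -> v <= w -> w <= u ->
    \int[@lebesgue_measure R]_(t in `[v, w]) h t = F w - F v.
  move=> av vw wu; have Iv : I v by apply: (iI Ia Iu); lra.
  have Iw : I w by apply: (iI Ia Iu); lra.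
  rewrite -Rintegral_itv_obnd_cbnd; last first.
    by apply: integrableS (itv_integrable Iv Iw ch) => //; exact: subset_itv_oc_cc.
  rewrite -(Rintegral_itvB (a := BLeft a))//.
  exact: itv_integrable.
apply: (near_eq_is_derive (f := fun x => F x - F y0)).
  have : \forall x \near y, a < x /\ x < u.
    apply: (@near_open R^o [set x | a < x /\ x < u] (fun x => a < x /\ x < u) y) => //.
    by apply: openI; [exact: open_gt|exact: open_lt].
  apply: filterS => x [ax xu]; rewrite /oriented_integral.
  have [y0x|xy0] := leP y0 x; rewrite inc ?opprB//; exact: ltW.
rewrite -[h y]subr0; exact: is_deriveB.
Qed.

End interval_calculus.

(** * The isomorphism [g] onto the additive group and the exponential form of [c] *)

Section smooth_components.
Variables (R : realType) (k : nat) (I : set R) (y0 : R) (f : R -> R -> R) (c : R -> R).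
Hypothesis oI : open I.
Hypothesis iI : is_interval I.
Hypothesis Iy0 : I y0.
Hypothesis f_in : forall y x, I y -> I x -> I (f y x).
Hypothesis pinv_fK : forall y x, I y -> I x -> pinv I (f y) (f y x) = x.
Hypothesis f_pinvK : forall y x, I y -> I x -> f y (pinv I (f y) x) = x.
Hypothesis f_comp : forall y x w, I y -> I x -> I w -> f y (f x w) = f (f y x) w.
Hypothesis f_id : forall x, I x -> f y0 x = x.
Hypothesis f_start : forall y, I y -> f y y0 = y.
Hypothesis cM : forall y z, I y -> I z -> c (f y z) = c y * c z.
Hypothesis c_gt0 : forall y, I y -> 0 < c y.
Hypothesis smooth : Ck_components k.+1 I f c.

Let F (p : R * R) := f p.1 p.2.
Let slope z := derive1 (f z) y0.

Let oII : open (I `*` I). Proof. exact: open_setX. Qed.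

Let near_I (Q : R -> Prop) x : I x -> (forall z, I z -> Q z) -> \forall z \near x, Q z.
Proof. by move=> Ix; exact: (@near_open R^o I Q x oI Ix). Qed.

Let partial_derive (G : R -> R -> R) (z x : R) :
  (forall p, (I `*` I) p -> differentiable (fun p : R * R => G p.1 p.2) p) -> I z -> I x ->
  is_derive x 1 (G z) ('d (fun p : R * R => G p.1 p.2) (z, x) (0, 1)).
Proof.
move=> dG Iz Ix.
have d1 : differentiable (fun x : R => (z, x)) x by apply: differentiable_pair.
have d2 := dG (z, x) (conj Iz Ix).
have dc : differentiable ((fun p : R * R => G p.1 p.2) \o fun x : R => (z, x)) x.
  exact: differentiable_comp.
split; first by apply/derivable1_diffP.
rewrite (deriveE (1 : R) dc) diff_comp//= diff_pair//=.
by rewrite diff_cst (diff_val (f := id)).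
Qed.

Lemma f_derivable z x : I z -> I x -> is_derive x 1 (f z) (derive1 (f z) x).
Proof.
move=> Iz Ix; have [[dF _] _ _] := smooth.
by apply: is_derive_of_derivable; have [] := derive_of_is_derive (partial_derive dF Iz Ix).
Qed.

(** One order of smoothness is spent on the derivative in the second variable; the integral defining
    [g] gives it back. *)
Lemma slope_C1d : C1d k I slope.
Proof.
have [[dF HF] _ _] := smooth.
apply: (@C1d_ext _ k I (fun z => 'd F (z, y0) (0, 1))) => //.
  by move=> z Iz; have [_] := derive_of_is_derive (partial_derive dF Iz Iy0).
apply: (Ck_slice (W := I `*` I) (G := fun p => 'd F p (0, 1)) oI); last exact: HF.
by move=> z Iz; split.
Qed.

(** The inverse components are differentiable too, so the chain rule on [pinv I (f z) \o f z], the
    identity near [y0], makes the slope a factor of 1. *)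
Lemma slope_neq0 z : I z -> slope z != 0.
Proof.
move=> Iz; have [_ [dV _] _] := smooth.
have df := f_derivable Iz Iy0.
have dp := partial_derive (G := fun z => pinv I (f z)) dV Iz (f_in Iz Iy0).
have dc := is_derive_chain df dp.
have : is_derive y0 1 id (1 : R) by exact: is_derive_id.
have did : is_derive y0 1 (pinv I (f z) \o f z) 1.
  apply: (near_eq_is_derive (f := id)).
  by apply: near_I => // x Ix /=; rewrite pinv_fK.
move=> _; apply/eqP => s0.
have [_ E1] := derive_of_is_derive did; have [_ E2] := derive_of_is_derive dc.
by move: E2; rewrite E1 -/(slope z) s0 mulr0 => /eqP; rewrite oner_eq0.
Qed.

Lemma slope_y0 : slope y0 = 1.
Proof.
have did : is_derive y0 1 (f y0) 1.
  apply: (near_eq_is_derive (f := id)).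
  by apply: near_I => // x Ix /=; rewrite f_id.
by have [_] := derive_of_is_derive did.
Qed.

(** By continuity on an interval: the slope never vanishes and equals 1 at [y0]. *)
Lemma slope_gt0 z : I z -> 0 < slope z.
Proof.
move=> Iz; rewrite ltNge; apply/negP => sz.
have cs := C1d_continuous slope_C1d.
have [zy0|y0z] := leP z y0.
  have [|x xzy s0] := IVT (v := 0) zy0 (itv_within_continuous iI Iz Iy0 cs).
    by rewrite slope_y0 ge_min le_max sz ler01 ?orbT.
  by have := slope_neq0 (iI Iz Iy0 xzy); rewrite s0 eqxx.
have [|x xzy s0] := IVT (v := 0) (ltW y0z) (itv_within_continuous iI Iy0 Iz cs).
  by rewrite slope_y0 ge_min le_max sz ler01 ?orbT.
by have := slope_neq0 (iI Iy0 Iz xzy); rewrite s0 eqxx.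
Qed.

Local Notation g := (g_of y0 f).

Let inv_slope_C1d : C1d k I (fun z => (slope z)^-1).
Proof. by apply: C1d_inv => //; [exact: slope_neq0|exact: slope_C1d]. Qed.

Lemma g_derive y : I y -> is_derive y 1 g (slope y)^-1.
Proof.
move=> Iy; apply: (oriented_integral_derive oI iI (h := fun z => (slope z)^-1)) => //.
exact: C1d_continuous inv_slope_C1d.
Qed.

Lemma g_wd : g_well_defined I y0 f.
Proof.
split=> [z Iz|y Iy].
  split; last exact: slope_neq0.
  by have [] := derive_of_is_derive (f_derivable Iz Iy0).
have Imin : I (Num.min y0 y) by rewrite minEle; case: ifP.
have Imax : I (Num.max y0 y) by rewrite maxEle; case: ifP.
by apply: (itv_integrable iI Imin Imax); exact: C1d_continuous inv_slope_C1d.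
Qed.

Lemma g_y0 : g y0 = 0.
Proof. by rewrite /g_of /oriented_integral lexx set_itv1 Rintegral_set1. Qed.

Lemma g_C1d : C1d k.+1 I g.
Proof. by apply: (C1d_intro oI) inv_slope_C1d => x; exact: g_derive. Qed.

(** The group law [f y (f z x) = f (f y z) x], differentiated in [x] at [y0], where [f z y0 = z]. *)
Let slope_comp y z : I y -> I z -> derive1 (f y) z * slope z = slope (f y z).
Proof.
move=> Iy Iz; have df := f_derivable Iz Iy0.
have dy : is_derive (f z y0) 1 (f y) (derive1 (f y) z).
  by rewrite f_start//; exact: f_derivable.
have [_ <-] := derive_of_is_derive (is_derive_chain df dy).
rewrite /slope !derive1E; apply: near_eq_derive.
by apply: near_I => // x Ix /=; rewrite f_comp.
Qed.

(** [slope_comp] says that [g (f y z) - g z] has derivative 0 in [z]; at [z = y0] it equals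
    [g y]. *)
Lemma g_morph y z : I y -> I z -> g (f y z) = g y + g z.
Proof.
move=> Iy Iz; pose D z := g (f y z) - g z.
have dD x : I x -> is_derive x 1 D 0.
  move=> Ix; have d1 := is_derive_chain (f_derivable Iy Ix) (g_derive (f_in Iy Ix)).
  have d2 := g_derive Ix.
  have -> : 0 = (slope (f y x))^-1 * derive1 (f y) x - (slope x)^-1.
    rewrite -slope_comp// invfM mulrAC mulVf ?mul1r ?subrr//.
    by have := slope_neq0 (f_in Iy Ix); rewrite -slope_comp// mulf_eq0 negb_or => /andP[].
  exact: is_deriveB.
have := derive0_cst iI dD Iz Iy0; rewrite /D f_start// g_y0 subr0 => E.
by rewrite -E subrK.
Qed.

Lemma g_lt a b : I a -> I b -> a < b -> g a < g b.
Proof.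
move=> Ia Ib ab; have [z Iz E] := MVT_interval iI Ia Ib ab g_derive.
by rewrite -subr_gt0 E mulr_gt0 ?subr_gt0// invr_gt0 slope_gt0.
Qed.

Lemma g_inj a b : I a -> I b -> g a = g b -> a = b.
Proof.
move=> Ia Ib E; have [ab|ba|//] := ltgtP a b.
  by have := g_lt Ia Ib ab; rewrite E ltxx.
by have := g_lt Ib Ia ba; rewrite E ltxx.
Qed.

(* The image of [g] is an interval stable under addition. *)
Lemma g_surj u : exists2 y, I y & g y = u.
Proof.
have pow y n : I y -> I (iter n (f y) y0) /\ g (iter n (f y) y0) = n%:R * g y.
  move=> Iy; elim: n => [|n [IH1 IH2]] /=; first by rewrite g_y0 mul0r.
  by split; [exact: f_in|rewrite g_morph// IH2 -natr1; ring].
have [a Ia ay] := open_interval_lt oI Iy0; have [b Ib yb] := open_interval_gt oI Iy0.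
have ga : 0 < - g a by rewrite oppr_gt0 -g_y0 g_lt.
have gb : 0 < g b by rewrite -g_y0 g_lt.
have big e : 0 < e -> exists n : nat, `|u| <= n%:R * e.
  move=> e0; exists (Num.truncn (`|u| / e)).+1; rewrite -ler_pdivrMr//.
  exact/ltW/truncnS_gt.
have [n Hn] := big _ ga; have [m Hm] := big _ gb.
have [Ian gan] := pow a n Ia; have [Ibm gbm] := pow b m Ib.
set a' := iter n _ _ in Ian gan; set b' := iter m _ _ in Ibm gbm.
have ua : g a' <= u.
  by rewrite gan; move: Hn; rewrite mulrN => Hn; have := ler_norm (- u); rewrite normrN; lra.
have ub : u <= g b' by rewrite gbm; apply: le_trans Hm; exact: ler_norm.
have ab : a' <= b'.
  by rewrite leNgt; apply/negP => /(g_lt Ibm Ian); rewrite ltNge (le_trans ua).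
have cg : {within `[a', b'], continuous g}.
  by apply: (itv_within_continuous iI Ian Ibm) => x Ix; exact: is_derive_continuous (g_derive Ix).
have [|y yab <-] := IVT (v := u) ab cg.
  by rewrite min_l ?max_r ?(le_trans ua)// ua.
by exists y => //; exact: (iI Ian Ibm yab).
Qed.

Lemma g_bij : set_bij I setT g.
Proof.
split=> //; first by move=> a b; rewrite !inE; exact: g_inj.
by move=> u _; have [y Iy <-] := g_surj u; exists y.
Qed.

Local Notation ginv := (pinv I g).

Lemma gK y : I y -> ginv (g y) = y.
Proof.
by move=> Iy; have [_ gi _] := g_bij; apply: pinvKV; rewrite ?inE.
Qed.

Lemma ginv_in u : I (ginv u).
Proof. by have [y Iy <-] := g_surj u; rewrite gK. Qed.

Lemma ginvK u : g (ginv u) = u.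
Proof. by have [y Iy <-] := g_surj u; rewrite gK. Qed.

Lemma ginv_derive (u : R) : is_derive u 1 ginv (slope (ginv u)).
Proof.
rewrite -[X in is_derive X](ginvK u) -[slope _]invrK.
apply: is_derive_inverse.
- by apply: (near_I (ginv_in u)) => z Iz; exact: gK.
- by apply: (near_I (ginv_in u)) => z Iz; exact: is_derive_continuous (g_derive Iz).
- exact: g_derive (ginv_in u).
- by rewrite invr_eq0 slope_neq0//; exact: ginv_in.
Qed.

(** A bootstrap on the differential equation satisfied by [ginv], whose derivative is the slope
    composed with [ginv]: each order gained by [ginv] passes to the right-hand side. *)
Lemma ginv_C1d : C1d k.+1 setT ginv.
Proof.
suff H j : (j <= k)%N -> C1d j I slope -> C1d j.+1 setT ginv.
  exact: H (leqnn _) slope_C1d.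
elim: j => [|j IH] jk cs; apply: (C1d_intro openT (fun x _ => ginv_derive x)).
  move=> x _; apply: continuous_comp; first exact: is_derive_continuous (ginv_derive x).
  by apply: cs; exact: ginv_in.
apply: (C1d_comp openT oI) => //; first by move=> x _; exact: ginv_in.
by apply: IH; [exact: ltnW|exact: C1d_weaken].
Qed.

Lemma g_diffeo : Ck_diffeo_to_R k.+1 I g.
Proof.
split; first exact: g_bij.
- by apply/Ck_C1d => //; exact: g_C1d.
- by apply/Ck_C1d; [exact: openT|exact: ginv_C1d].
Qed.

(** Through [ginv], the logarithm of [c] is an additive function of a real variable. Being
    differentiable, it has a constant derivative, hence is linear, and its coefficient is its value
    at 1. *)
Lemma c_exp y : I y -> c y = expR (ln (c (ginv 1)) * g y).
Proof.
pose L u := ln (c (ginv u)).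
have LD u v : L (u + v) = L u + L v.
  rewrite /L -lnM ?posrE ?c_gt0//; try exact: ginv_in.
  rewrite -cM; try exact: ginv_in.
  rewrite -[in LHS](ginvK u) -[in LHS](ginvK v) -g_morph ?gK//; try exact: ginv_in.
  by apply: f_in; exact: ginv_in.
have [_ _ /(Ck_C1d _ _ oI) cC] := smooth.
have dL (u : R) : is_derive u 1 L (derive1 L u).
  apply: is_derive_of_derivable.
  have Iu := ginv_in u.
  have d1 := is_derive_chain (ginv_derive u) (C1d_is_derive cC Iu).
  have d2 := is_derive_chain d1 (is_derive1_ln (c_gt0 Iu)).
  by have [] := derive_of_is_derive d2.
have L' u : derive1 L u = derive1 L 0.
  have dt : is_derive (0 : R) 1 (fun v : R => u + v) (1 : R).
    by rewrite -[X in is_derive _ _ _ X]add0r; apply: is_deriveD.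
  have dLu : is_derive (u + 0) 1 L (derive1 L u) by rewrite addr0.
  have [_] := derive_of_is_derive (is_derive_chain dt dLu).
  rewrite mulr1 => <-.
  have E : L \o (fun v => u + v) = (fun v => L u + L v).
    by apply/funext => v /=; exact: LD.
  rewrite E; have dc : is_derive (0 : R) 1 (fun v => L u + L v) (0 + derive1 L 0).
    by apply: is_deriveD; exact: dL.
  by have [_ ->] := derive_of_is_derive dc; rewrite add0r.
have L0 : L 0 = 0 by have := LD 0 0; rewrite addr0; lra.
have Llin u : L u = derive1 L 0 * u.
  pose D u := L u - derive1 L 0 * u.
  have dD (x : R) : is_derive x 1 D 0.
    have -> : 0 = derive1 L x - derive1 L 0 * 1 by rewrite mulr1 L' subrr.
    have d1 : is_derive x 1 (fun u : R => derive1 L 0 * u) (derive1 L 0 * 1).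
      exact: (@is_deriveZ _ _ _ (id : R -> R) (derive1 L 0) x 1 1 (is_derive_id _ _)).
    exact: is_deriveB.
  have := is_derive_0_is_cst u 0 dD; rewrite /D L0 mulr0 subr0 => /eqP.
  by rewrite subr_eq0 => /eqP.
move=> Iy; rewrite -/(L 1) [L 1]Llin mulr1 -Llin /L gK// lnK// posrE.
exact: c_gt0.
Qed.

End smooth_components.

(** * Cadlag paths on [I] as real paths *)

Section real_path_of_cadlag.
Variables (R : realType) (I : set R) (g ginv : R -> R).
Hypothesis g_cont : forall y, I y -> {for y, continuous g}.
Hypothesis ginv_cont : continuous ginv.
Hypothesis gK : forall y, I y -> ginv (g y) = y.
Hypothesis ginv_in : forall u, I (ginv u).
Variable x : R -> option R.
Hypothesis hx : cadlag_path I x.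

Let compact_bounded K : compact K -> K `<=` I -> exists M, forall y, K y -> `|g y| <= M.
Proof.
move=> cK KI; have : compact (g @` K).
  apply: continuous_compact => //; apply: continuous_in_subspaceT => y.
  by rewrite inE => /KI; exact: g_cont.
move=> /compact_bounded[M [_ HM]]; exists (M + 1) => y Ky.
by apply: (HM (M + 1)); [rewrite ltrDl|exists y].
Qed.

Let compact_ginv M : compact (ginv @` `[- M, M]).
Proof.
apply: continuous_compact; last exact: segment_compact.
exact: continuous_subspaceT.
Qed.

(** The life-time is a supremum of exit times, so if it exceeds [t], the exit time of one compact
    set already does. *)
Lemma lifetime_gt t : 0 <= t -> x t -> exists K, [/\ compact K, K `<=` I &
  forall u, 0 <= u -> u <= t -> (Some @` K) (x u)].
Proof.
move=> t0 xt; have : (t%:E < lifetime I x)%E.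
  rewrite ltNge; apply/negP => /(path_lifetime hx t0) E.
  by rewrite E in xt.
move=> /ereal_sup_gt[_ [K [cK KI] <-]] tK; exists K; split => // u u0 ut.
apply: contrapT => nK; move: tK; rewrite ltNge => /negP; apply.
apply: ereal_inf_le; exists u%:E; last by rewrite lee_fin.
by exists u.
Qed.

Let rpath_dead s t : 0 <= s -> s <= t -> x s = None -> x t = None.
Proof.
move=> s0 st /(path_lifetime hx s0) H.
apply/(path_lifetime hx (le_trans s0 st)); apply: le_trans H _.
by rewrite lee_fin.
Qed.

Let near_g r e : I r -> 0 < e -> nbhs r [set y | `|g y - g r| <= e].
Proof.
move=> Ir e0; have /cvgrPdist_le/(_ _ e0) := g_cont Ir.
by apply: filterS => y /=; rewrite distrC.
Qed.

(** Before death the path stays in a compact subset of [I], on which [g] is bounded. For the death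
    field: if the values of [g] were bounded by [M], the path would stay in the compact set [ginv @]
    [[- M, M]] until it dies, against the continuous approach to the cemetery. *)
Lemma real_path_omap : real_path (fun t => omap g (x t)).
Proof.
split.
- move=> t r t0; case xt : (x t) => [y|//] /= [<-] e e0.
  have Iy := path_state hx t0 xt.
  have := path_right_continuous hx t0; rewrite xt => /(_ (Some @` [set z | `|g z - g y| <= e])).
  have nJ : nbhs y (Some @^-1` (Some @` [set z | `|g z - g y| <= e])).
    by apply: filterS (near_g Iy e0) => z Jz /=; exists z.
  move=> /(_ nJ) nX.
  have /nbhs_ballP[h /= h0 Hh] : nbhs t [set u | t < u ->
    (Some @` [set z | `|g z - g y| <= e]) (x u)] by exact: nX.
  exists h => // u; rewrite le_eqVlt => /orP[/eqP <- _|tu ut].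
    by rewrite xt; exists (g y); rewrite ?subrr ?normr0 ?ltW.
  have [|//|z /= Jz <-] := Hh u; last by exists (g z).
  by rewrite /ball /= distrC ger0_norm ?subr_ge0 ?ltW// ltrBlDl.
- move=> s t s0 st; case xs : (x s) => //= _.
  by rewrite (rpath_dead s0 st xs).
- move=> t r t0; case xt : (x t) => [y|//] /= _.
  have [|K [cK KI HK]] := lifetime_gt (ltW t0); first by rewrite xt.
  have [[l|] [Il Hl]] := path_left_limit hx t0; last first.
    (* The left limit cannot be the cemetery, as the path remains in [K] up to [t]. *)
    have : (x @ t^'-) (~` (Some @` K)) by apply: Hl; exists K; split.
    move=> nX; have /nbhs_ballP[h /= h0 Hh] : nbhs t [set u | u < t ->
      (~` (Some @` K)) (x u)] by exact: nX.
    pose m := Num.min h t; have m0 : 0 < m by rewrite lt_min h0.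
    have mt : m <= t by rewrite ge_min lexx orbT.
    have mh : m <= h by rewrite ge_min lexx.
    exfalso; apply: (Hh (t - m / 2)).
    - by rewrite /ball /= opprB addrC subrK ger0_norm; lra.
    - by lra.
    - by apply: HK; lra.
  exists (g l) => e e0.
  have nX : (x @ t^'-) (Some @` [set z | `|g z - g l| <= e]).
    by apply: Hl; apply: filterS (near_g (Il _ erefl) e0) => z Jz /=; exists z.
  have /nbhs_ballP[h /= h0 Hh] : nbhs t [set u | u < t ->
    (Some @` [set z | `|g z - g l| <= e]) (x u)] by exact: nX.
  exists h => // u u0 tu ut; have [|//|z /= Jz <-] := Hh u; last by exists (g z).
  by rewrite /ball /= ger0_norm; lra.
- move=> t r t0; case xt : (x t) => [y|//] /= _.
  have [|K [cK KI HK]] := lifetime_gt t0; first by rewrite xt.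
  have [M HM] := compact_bounded cK KI; exists M => u u0 ut.
  by have [z Kz <-] := HK u u0 ut; exists (g z) => //; exact: HM.
- move=> t r t0; case x0 : (x 0) => [y|//] _; case xt : (x t) => [//|] _ M.
  apply: contrapT => H.
  have HM u z : 0 <= u -> x u = Some z -> `|g z| <= M.
    move=> u0 xu; rewrite leNgt; apply/negP => Mz; apply: H.
    by exists u, (g z); rewrite xu.
  pose K := ginv @` `[- M, M].
  have KI : K `<=` I by move=> _ [u _ <-].
  have cK : compact K by exact: compact_ginv.
  have inK u : 0 <= u -> x u -> (Some @` K) (x u).
    move=> u0 /isSomeP[z xu]; rewrite xu; exists z => //; exists (g z).
      by rewrite /= in_itv /= -ler_norml; exact: HM xu.
    by rewrite gK//; exact: path_state hx _ _ u0 xu.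
  pose D := [set u | 0 <= u /\ x u = None].
  have lD : has_inf D by split; [exists t|exists 0 => u []].
  (* The first death time: right-continuity makes the path dead at [zeta], and it is alive, hence in
     [K], at all times before. There [path_no_killing] gives the contradiction. *)
  pose zeta := inf D.
  have z0 : 0 <= zeta by apply: lb_le_inf; [exists t|move=> u []].
  have Dz : x zeta = None.
    case xz : (x zeta) => [z|//]; exfalso.
    have nJ : nbhs z (Some @^-1` (Some @` setT)).
      by apply: filterS (@filterT _ (nbhs z) _) => v _ /=; exists v.
    have nX : (x @ zeta^'+) (Some @` setT).
      by have := path_right_continuous hx z0; rewrite xz; apply.
    have /nbhs_ballP[h /= h0 Hh] : nbhs zeta [set u | zeta < u -> (Some @` setT) (x u)] by exact: nX.
    have [v [v0 xv] vz] := inf_adherent h0 lD.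
    move: vz; rewrite -/zeta => vz.
    have : zeta <= v by apply: ge_inf => //; exists 0 => u [].
    rewrite le_eqVlt => /orP[/eqP E|zv]; first by rewrite E xv in xz.
    have [|//|a _] := Hh v; last by rewrite xv.
    by rewrite /ball /= distrC ger0_norm; lra.
  have zp : 0 < zeta.
    by rewrite lt_neqAle z0 andbT; apply/eqP => E; rewrite -E x0 in Dz.
  have nX : (x @ zeta^'-) (~` (Some @` K)).
    by apply: (path_no_killing hx zp Dz); exists K; split.
  have /nbhs_ballP[h /= h0 Hh] : nbhs zeta [set u | u < zeta -> (~` (Some @` K)) (x u)] by exact: nX.
  pose m := Num.min h zeta; have m0 : 0 < m by rewrite lt_min h0.
  have mt : m <= zeta by rewrite ge_min lexx orbT.
  have mh : m <= h by rewrite ge_min lexx.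
  have v0 : 0 <= zeta - m / 2 by lra.
  apply: (Hh (zeta - m / 2)).
  + by rewrite /ball /= opprB addrC subrK ger0_norm; lra.
  + by lra.
  + apply: inK => //; case xv : (x _) => //.
    have : zeta <= zeta - m / 2 by apply: ge_inf => //; exists 0 => u [].
    lra.
Qed.

End real_path_of_cadlag.

(** * Image laws and Dynkin classes *)

Section image_law.
Context (R : realType) d d' (T : measurableType d) (T' : measurableType d')
  (P : probability T R) (F : T -> T') (mF : measurable_fun setT F).

Let mF_mixin := isMeasurableFun.Build _ _ _ _ F mF.
Let mF_pack : {mfun T >-> T'} := HB.pack F mF_mixin.

Definition image_law : probability T' R := distribution P mF_pack.

Lemma image_lawE A : image_law A = P (F @^-1` A). Proof. by []. Qed.

Lemma integral_image_law (D : set T') (h : T' -> \bar R) : measurable D ->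
  measurable_fun D h -> (forall y, D y -> (0 <= h y)%E) ->
  (\int[image_law]_(y in D) h y = \int[P]_(w in F @^-1` D) h (F w))%E.
Proof.
move=> mD mh h0.
rewrite -[RHS](ge0_integral_pushforward mF)//; last by move=> y; rewrite inE; exact: h0.
Qed.

End image_law.

(** The default path makes this total; for processes started in [I] it never occurs. *)
Definition mkpath (R : realType) (x : R -> option R) : path_space R :=
  if pselect (real_path x) is left hx then exist _ x hx else point.

Lemma coord_mkpath (R : realType) (x : R -> option R) : real_path x -> coord (mkpath x) = x.
Proof. by move=> hx; rewrite /mkpath; case: pselect. Qed.

Lemma path_space_eq (R : realType) (p q : path_space R) : coord p = coord q -> p = q.
Proof. by case: p q => [x hx] [y hy] /= E; subst y; congr exist; exact: Prop_irrelevance. Qed.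

Lemma dynkin_eq_probability (R : realType) d (T : measurableType d) (m1 m2 : probability T R) :
  dynkin [set A | measurable A /\ m1 A = m2 A].
Proof.
split.
- by split; [exact: measurableT|rewrite !probability_setT].
- move=> A [mA E]; split; first exact: measurableC.
  by rewrite !probability_setC// E.
- move=> F tF HF; have mF n : measurable (F n) by have [] := HF n.
  split; first exact: bigcup_measurable.
  rewrite !measure_bigcup//; apply: eq_eseriesr => n _.
  by have [] := HF n.
Qed.

Lemma dynkin_measurable_kernel (R : realType) d (T : measurableType d)
    (Q : R -> probability T R) :
  dynkin [set A | measurable A /\ measurable_fun setT (fun z => Q z A)].
Proof.
split.
- split; first exact: measurableT.
  rewrite (_ : (fun _ => _) = cst 1%E); first exact: measurable_cst.
  by apply/funext => z; exact: probability_setT.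
- move=> A [mA mQ]; split; first exact: measurableC.
  rewrite (_ : (fun _ => _) = (fun z => 1 - Q z A)%E); first exact: emeasurable_funB.
  by apply/funext => z; exact: probability_setC.
- move=> F tF HF; have mF n : measurable (F n) by have [] := HF n.
  split; first exact: bigcup_measurable.
  rewrite (_ : (fun _ => _) = (fun z => \sum_(n <oo) Q z (F n))%E).
    by apply: ge0_emeasurable_sum => // n _; have [] := HF n.
  by apply/funext => z; apply: measure_semi_bigcup => //; exact: bigcup_measurable.
Qed.

(** Lets the Markov identity be checked on finite-dimensional cylinders only. Complements use that
    the integral of [Q (v p) A] over [D] is finite. *)
Lemma dynkin_integral_kernel (R : realType) d (T : measurableType d)
    d' (T' : measurableType d') (m : probability T' R) (D : set T')
    (F : T' -> T) (v : T' -> R) (Q : R -> probability T R) :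
  measurable D -> measurable_fun setT F -> measurable_fun setT v ->
  (forall A, measurable A -> measurable_fun setT (fun z => Q z A)) ->
  dynkin [set A | measurable A /\
    m (D `&` F @^-1` A) = (\int[m]_(p in D) Q (v p) A)%E].
Proof.
move=> mD mF mv mQ.
have mFA A : measurable A -> measurable (D `&` F @^-1` A).
  by move=> mA; apply: measurableI => //; exact: measurable_preimage.
have mQv A : measurable A -> measurable_fun D (fun p => Q (v p) A).
  by move=> mA; apply: measurable_funTS; exact: measurableT_comp (mQ A mA) mv.
have mDfin : (m D < +oo)%E by apply: le_lt_trans (probability_le1 m mD) _; rewrite ltry.
split.
- split; first exact: measurableT.
  rewrite preimage_setT setIT; under eq_integral do rewrite probability_setT.
  by rewrite integral_cst// mul1e.
- move=> A [mA E]; split; first exact: measurableC.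
  have S1 : (m (D `&` F @^-1` A) + m (D `&` F @^-1` (~` A)) = m D)%E.
    rewrite preimage_setC -setDE [RHS](measureDI m mD (B := F @^-1` A)) 1?addeC//.
    exact: measurable_preimage.
  have S2 : (\int[m]_(p in D) Q (v p) A + \int[m]_(p in D) Q (v p) (~` A) = m D)%E.
    rewrite -ge0_integralD//; [|exact: mQv|by apply: mQv; exact: measurableC].
    rewrite -[RHS]mul1e -integral_cst//; apply: eq_integral => p _.
    by rewrite probability_setC// addeCA subee ?adde0// fin_num_measure.
  move: S1; rewrite E -S2.
  have : (\int[m]_(p in D) Q (v p) A)%E \is a fin_num.
    by rewrite -E fin_num_measure//; exact: mFA.
  case: (\int[m]_(p in D) Q (v p) A)%E => // r _.
  have : m (D `&` F @^-1` (~` A)) \is a fin_num.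
    by rewrite fin_num_measure//; apply: mFA; exact: measurableC.
  case: (m (D `&` F @^-1` (~` A))) => // s _.
  case: (\int[m]_(p in D) Q (v p) (~` A))%E => // t; rewrite -!EFinD => -[].
  by move=> /addrI ->.
- move=> G tG HG; have mG n : measurable (G n) by have [] := HG n.
  split; first exact: bigcup_measurable.
  transitivity (\sum_(n <oo) m (D `&` F @^-1` G n))%E.
    rewrite preimage_bigcup setI_bigcupr; apply: measure_semi_bigcup.
    - by move=> n; exact: mFA.
    - apply/trivIsetP => i j _ _ ij; move/trivIsetP : tG => /(_ i j I I ij) E.
      by rewrite setIACA setIid -preimage_setI E preimage_set0 setI0.
    - by apply: bigcup_measurable => n _; exact: mFA.
  transitivity (\sum_(n <oo) \int[m]_(p in D) Q (v p) (G n))%E.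
    by apply: eq_eseriesr => n _; have [] := HG n.
  rewrite -integral_nneseries//; last by move=> n; exact: mQv.
  apply: eq_integral => p _; apply/esym.
  by apply: measure_semi_bigcup => //; exact: bigcup_measurable.
Qed.

Lemma measurable_fdd_cylinder (R : realType) n (s : 'I_n -> R)
    (B : 'I_n -> set (option R)) :
  (forall i, 0 <= s i) -> (forall i, borel_state (B i)) -> measurable (fdd_cylinder s B).
Proof.
by move=> s0 mB; apply: measurable_forall_ord => i; exact: measurable_coord.
Qed.

Lemma ereal_eq_ge0 (R : realType) (a b : \bar R) : (0 <= a)%E -> (0 <= b)%E ->
  (forall t, 0 <= t -> (t%:E < a)%E <-> (t%:E < b)%E) -> a = b.
Proof.
move=> + + H; suff le (u v : \bar R) : (0 <= u)%E -> (0 <= v)%E ->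
    (forall t, 0 <= t -> (t%:E < u)%E -> (t%:E < v)%E) -> (u <= v)%E.
  move=> a0 b0; apply/eqP; rewrite eq_le; apply/andP.
  by split; apply: le => // t t0; have [] := H t t0.
move=> u0; case: v => [v| |] v0 Huv; rewrite ?leey//.
rewrite leNgt; apply/negP => vu; rewrite lee_fin in v0.
by have := Huv _ v0 vu; rewrite ltxx.
Qed.

(** * The Levy process attached to [X] and the representation of [X] *)

Section lamperti_representation.
Variables (R : realType) (k : nat) (I : set R) (d : measure_display)
  (Omega : R -> measurableType d) (P : forall y, probability (Omega y) R)
  (X : forall y, Omega y -> R -> option R) (y0 : R) (f : R -> R -> R) (c : R -> R).
Arguments X : clear implicits.
Hypothesis oI : open I.
Hypothesis iI : is_interval I.
Hypothesis hX : strong_Markov_process I P X.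
Hypothesis hf : invariance_components I P X y0 f c.
Hypothesis hk : Ck_components k.+1 I f c.
Hypothesis hg : good_components I y0 f c.
Hypothesis hA : assumption1 I P X y0 \/ assumption2 I P X.

Local Notation g := (g_of y0 f).
Local Notation ginv := (pinv I g).
Local Notation alpha := (- ln (c (ginv 1))).

Let Iy0 : I y0 := Defs.inv_reference hf.
Let h_in y x : I y -> I x -> I (f y x). Proof. exact: (f_in hf). Qed.
Let h_pinv_fK y x : I y -> I x -> pinv I (f y) (f y x) = x. Proof. exact: (pinv_fK hf). Qed.
Let h_comp y x w : I y -> I x -> I w -> f y (f x w) = f (f y x) w.
Proof. exact: (f_comp oI iI hX hf hg hA). Qed.
Let h_id x : I x -> f y0 x = x. Proof. by have [+ _ _] := hg; apply. Qed.
Let h_start y : I y -> f y y0 = y. Proof. exact: (f_start oI hX hf). Qed.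
Let h_cM y z : I y -> I z -> c (f y z) = c y * c z. Proof. by have [_ _] := hg; apply. Qed.
Let h_c0 y : I y -> 0 < c y. Proof. exact: (Defs.inv_pos hf). Qed.

Let hg_wd : g_well_defined I y0 f. Proof. by apply: (g_wd (k := k) (c := c)). Qed.
Let hg_diffeo : Ck_diffeo_to_R k.+1 I g. Proof. by apply: (g_diffeo (k := k) (c := c)). Qed.
Let hgK y : I y -> ginv (g y) = y. Proof. by apply: (gK (k := k) (c := c)). Qed.
Let hginvK u : g (ginv u) = u. Proof. by apply: (ginvK (k := k) (c := c)). Qed.
Let hginv_in u : I (ginv u). Proof. by apply: (ginv_in (k := k) (c := c)). Qed.
Let hg_morph y z : I y -> I z -> g (f y z) = g y + g z.
Proof. by apply: (g_morph (k := k) (c := c)). Qed.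
Let hg0 : g y0 = 0. Proof. exact: g_y0. Qed.
Let hc y : I y -> c y = expR (- alpha * g y).
Proof. by move=> Iy; rewrite opprK; apply: (c_exp (k := k)). Qed.
Let hg_cont y : I y -> {for y, continuous g}.
Proof. by have [_ + _] := hg_diffeo; move=> /(Ck_C1d _ _ oI)/C1d_continuous; apply. Qed.
Let hginv_cont : continuous ginv.
Proof.
have [_ _ H] := hg_diffeo; move: H => /(Ck_C1d _ _ openT)/C1d_continuous H x.
exact: H.
Qed.
Definition Lamperti_path y (w : Omega y) : path_space R :=
  mkpath (fun t => omap g (X y w t)).
Local Notation Y := (@Lamperti_path).

Lemma coord_Lamperti_path y w : I y -> coord (Y y w) = fun t => omap g (X y w t).
Proof.
move=> Iy; apply: coord_mkpath; apply: (real_path_omap (I := I) (ginv := ginv)) => //.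
exact: process_cadlag hX _ _ Iy.
Qed.

Definition pull_g (B : set (option R)) : set (option R) :=
  [set o | if o is Some r then I r /\ B (Some (g r)) else B None].

Lemma borel_pull_g B : borel_state B -> borel_state (pull_g B).
Proof.
move=> mB; rewrite /borel_state.
have gw : {within I, continuous g}.
  by rewrite continuous_open_subspace// => x; rewrite inE; exact: hg_cont.
have mI : measurable I by exact: open_measurable.
by have := subspace_continuous_measurable_fun mI gw; move=> /(_ mI _ mB).
Qed.

Lemma pull_gP y w t B : I y -> 0 <= t -> B (coord (Y y w) t) <-> pull_g B (X y w t).
Proof.
move=> Iy t0; rewrite coord_Lamperti_path// /pull_g.
case E : (X y w t) => [r|] //=; split=> [|[]//] H; split => //.
exact: (state_in hX Iy t0 E).
Qed.

Lemma measurable_Lamperti_path y : I y -> measurable_fun setT (Y y).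
Proof.
move=> Iy; apply: measurable_to_path_space => s B s0 mB.
rewrite (_ : [set w | _] = [set w | pull_g B (X y w s)]).
  by apply: (process_measurable hX) => //; exact: borel_pull_g.
by apply/seteqP; split => w /= H; apply/pull_gP.
Qed.

(** Carries stopping times of the path space back to the natural filtration of [X y], where the
    strong Markov property is available. *)
Lemma natural_filtration_Lamperti_path y t (A : set (path_upto t)) : I y ->
  measurable A -> natural_filtration (X y) t (Y y @^-1` A).
Proof.
move=> Iy; pose G := [set A : set (Omega y) | exists (s : R) (B : set (option R)),
  [/\ 0 <= s, s <= t, borel_state B & A = [set w | B (X y w s)]]].
have : <<s @cylinders_upto R t >> `<=`
    [set A : set (path_upto t) | <<s G >> (Y y @^-1` A)].
  apply: smallest_sub.
    split.
    - by rewrite /= preimage_set0; exact: (@measurable0 _ (g_sigma_algebraType G)).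
    - move=> B /= mB; rewrite setTD preimage_setC.
      exact: (@measurableC _ (g_sigma_algebraType G)).
    - move=> F mF /=; rewrite preimage_bigcup.
      by apply: (@bigcup_measurable _ (g_sigma_algebraType G)) => i _; exact: mF.
  move=> _ [s [B [s0 st mB ->]]] /=; apply: sub_sigma_algebra.
  exists s, (pull_g B); split => //; first exact: borel_pull_g.
  by apply/seteqP; split => w /= H; apply/pull_gP.
by move=> H /H.
Qed.

Lemma scale_at0 (p : path_space R) : scale_at alpha 0 p = p.
Proof.
apply: path_space_eq; apply/funext => t; rewrite coord_scale_at /scale_path.
rewrite mulr0 expR0 mul1r; case: (coord p t) => //= r.
by rewrite addr0.
Qed.

Definition scaled_path z (w : Omega y0) : path_space R := scale_at alpha z (Y y0 w).

Lemma measurable_scaled_path z : measurable_fun setT (scaled_path z).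
Proof.
apply: (measurableT_comp (measurable_scale_at alpha z)).
exact: measurable_Lamperti_path.
Qed.

(** Built from [P y0] alone for every real [z], which makes [Q_scale] immediate; [Q_law] identifies
    it with the law of the process started from the point of coordinate [z]. *)
Definition Lamperti_law z : probability (path_space R) R :=
  image_law (P y0) (measurable_scaled_path z).
Local Notation Q := Lamperti_law.

Lemma Lamperti_lawE z A : Q z A = P y0 (scaled_path z @^-1` A). Proof. by []. Qed.

Lemma Q0E A : Q 0 A = P y0 (Y y0 @^-1` A).
Proof.
rewrite Lamperti_lawE; congr (P y0 _); apply/seteqP.
by split => w /=; rewrite /scaled_path scale_at0.
Qed.

Lemma Q_scale z A : measurable A ->
  Q z A = Q 0 ((scale_at alpha z : path_space R -> path_space R) @^-1` A).
Proof. by rewrite Q0E. Qed.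

Let fdd_cylinderE y n (s : 'I_n -> R) (B : 'I_n -> set (option R)) : I y ->
  (forall i, 0 <= s i) ->
  Y y @^-1` fdd_cylinder s B = [set w | forall i, pull_g (B i) (X y w (s i))].
Proof.
by move=> Iy s0; apply/seteqP; split => w /= H i;
  apply/(pull_gP w (B i) Iy (s0 i)); exact: H.
Qed.

(** On cylinders this is self-similarity, since [g] turns [f y] into the translation by [g y] and
    [c y] is [expR (- alpha * g y)]. *)
Lemma Q_law y A : I y -> measurable A -> P y (Y y @^-1` A) = Q (g y) A.
Proof.
move=> Iy mA.
suff : [set A | measurable A /\ image_law (P y) (measurable_Lamperti_path Iy) A = Q (g y) A] A.
  by move=> [].
move: A mA; apply: path_space_induction; first exact: dynkin_eq_probability.
move=> n s B s0 mB; split; first exact: measurable_fdd_cylinder.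
rewrite image_lawE fdd_cylinderE//.
have := Defs.inv_law hf Iy s0 (fun i => borel_pull_g (mB i)).
rewrite /fdd => ->; rewrite Lamperti_lawE; congr (P y0 _).
have cy := ltW (h_c0 Iy).
apply/seteqP; split => w /= H i.
  have := H i; rewrite /scaled_path coord_scale_at /scale_path -hc//.
  rewrite coord_Lamperti_path//; case E : (X y0 w (c y * s i)) => [r|] //= [_].
  have Ir := state_in hX Iy0 (mulr_ge0 cy (s0 i)) E.
  by rewrite hg_morph// addrC.
have := H i; rewrite /scaled_path coord_scale_at /scale_path -hc//.
rewrite coord_Lamperti_path//; case E : (X y0 w (c y * s i)) => [r|] //=.
have Ir := state_in hX Iy0 (mulr_ge0 cy (s0 i)) E.
by rewrite hg_morph// addrC => Bi; split => //; exact: h_in.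
Qed.

Lemma Q_start z : pr (Q z) [set p : path_space R | coord p 0 = Some z] = 1.
Proof.
have mS : measurable ([set p : path_space R | coord p 0 = Some z]).
  exact: measurable_coord (lexx 0) (borel_state1 _).
have mX : measurable [set w | X y0 w 0 = Some y0].
  exact: (process_measurable hX Iy0 (lexx 0) (borel_state1 _)).
have mZ : measurable (scaled_path z @^-1` [set p : path_space R | coord p 0 = Some z]).
  by apply: measurable_preimage => //; exact: measurable_scaled_path.
suff -> : pr (Q z) [set p : path_space R | coord p 0 = Some z] = fine (1%E : \bar R) by [].
rewrite /pr; congr fine; apply/eqP; rewrite eq_le probability_le1//=.
rewrite Lamperti_lawE -(process_start hX Iy0); apply: le_measure; rewrite ?inE//.
move=> w E; change (coord (scale_at alpha z (Y y0 w)) 0 = Some z).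
rewrite coord_scale_at /scale_path mulr0.
by rewrite coord_Lamperti_path// E /= hg0 add0r.
Qed.

Let Q_fdd y n (s : 'I_n -> R) (B : 'I_n -> set (option R)) : I y ->
  (forall i, 0 <= s i) -> (forall i, borel_state (B i)) ->
  Q (g y) (fdd_cylinder s B) = fdd (P y) (X y) s (fun i => pull_g (B i)).
Proof.
move=> Iy s0 mB; rewrite -Q_law//; last exact: measurable_fdd_cylinder.
by rewrite fdd_cylinderE.
Qed.

Lemma Q_kernel A : measurable A -> measurable_fun setT (fun z => Q z A).
Proof.
move=> mA; suff [] : [set A | measurable A /\ measurable_fun setT (fun z => Q z A)] A by [].
move: A mA; apply: path_space_induction; first exact: dynkin_measurable_kernel.
move=> n s B s0 mB; split; first exact: measurable_fdd_cylinder.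
have mI : measurable I by exact: open_measurable.
have := process_kernel hX s0 (fun i => borel_pull_g (mB i)) => mk.
have mg : measurable_fun setT ginv.
  by apply: continuous_measurable_fun; exact: hginv_cont.
have := measurable_comp mI _ mk mg.
have sub : ginv @` setT `<=` I by move=> _ [u _ <-].
move=> /(_ sub); apply: eq_measurable_fun => z _ /=.
by rewrite -Q_fdd// hginvK.
Qed.

(** On cylinders, the strong Markov property of [X y] at the inverse clock of its own path, with
    [g y = z]; a Dynkin class argument covers all events. *)
Lemma Q_Markov s z A : 0 <= s -> measurable A ->
  (Q z ([set p : path_space R | reached alpha (coord p) s] `&`
     (shift_at alpha s : path_space R -> path_space R) @^-1` A) =
   \int[Q z]_(p in [set p : path_space R | reached alpha (coord p) s])
     Q (path_val (lamperti alpha (coord p)) s) A)%E.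
Proof.
move=> s0 mA; set D := [set p | _].
have mD : measurable D by exact: measurable_reached.
have mv := measurable_lamperti_val alpha s0.
suff [] : [set A | measurable A /\ Q z (D `&`
    (shift_at alpha s : path_space R -> path_space R) @^-1` A) =
    (\int[Q z]_(p in D) Q (path_val (lamperti alpha (coord p)) s) A)%E] A by [].
move: A mA; apply: path_space_induction.
  apply: dynkin_integral_kernel => //; first exact: measurable_shift_at.
  exact: Q_kernel.
move=> n u B u0 mB; have mC := measurable_fdd_cylinder u0 mB; split => //.
pose y := ginv z; have Iy : I y by exact: hginv_in.
have gy : g y = z by exact: hginvK.
have QzE A : measurable A -> Q z A = P y (Y y @^-1` A).
  by move=> mA; rewrite Q_law// gy.
(* Infinite when [s] is not reached, so that the event of a finite [tau] with a living state is
   exactly [D]. *)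
pose tau (w : Omega y) : \bar R :=
  if `[< D (Y y w) >] then (clock_inv alpha (coord (Y y w)) s)%:E else +oo%E.
have tauE t : [set w | (tau w <= t%:E)%E] = Y y @^-1`
    [set p | reached alpha (coord p) s /\ clock_inv alpha (coord p) s <= t].
  apply/seteqP; split => w /=; rewrite /tau.
    by case: asboolP => // Dw; rewrite lee_fin.
  by move=> [rs ct]; rewrite asboolT// lee_fin.
have mtau t : 0 <= t -> natural_filtration (X y) t [set w | (tau w <= t%:E)%E].
  move=> t0; rewrite tauE; apply: natural_filtration_Lamperti_path => //.
  exact: clock_inv_stopping.
have st : stopping_time (X y) tau.
  split => // w; rewrite /tau; case: asboolP => // Dw.
  by have [c0 _ _] := clock_inv_spec Dw; rewrite lee_fin.
have se : stopped_event (X y) tau setT.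
  by split => // t t0; rewrite setTI; exact: mtau.
have /= := process_strong_Markov hX Iy st se u0 (fun i => borel_pull_g (mB i)).
have DE : setT `&` [set w | (tau w < +oo)%E /\ X y w (fine (tau w)) <> None] = Y y @^-1` D.
  rewrite setTI; apply/seteqP; split => w /=; rewrite /tau; case: asboolP => //.
    by move=> _ [].
  move=> Dw _; split; first exact: ltry.
  have [_ + _] := clock_inv_spec Dw; rewrite coord_Lamperti_path//=.
  by case: (X y w _).
rewrite DE => SM.
transitivity (P y (Y y @^-1` D `&`
    [set w | forall i, pull_g (B i) (X y w (fine (tau w) + u i))])).
  rewrite QzE; last first.
    apply: measurableI => //; apply: measurable_preimage => //.
    exact: measurable_shift_at.
  congr (P y _); apply/seteqP; split => w /= -[Dw H]; split => // i.
    have := H i; rewrite coord_shift_at// /shift_path /tau asboolT//.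
    by move=> ?; apply/pull_gP => //; rewrite addr_ge0//; have [] := clock_inv_spec Dw.
  rewrite coord_shift_at// /shift_path; have := H i; rewrite /tau asboolT//=.
  by move=> ?; apply/pull_gP => //; rewrite addr_ge0//; have [] := clock_inv_spec Dw.
rewrite SM.
transitivity (\int[P y]_(w in Y y @^-1` D)
    Q (path_val (lamperti alpha (coord (Y y w))) s) (fdd_cylinder u B))%E.
  apply: eq_integral => w; rewrite inE /= => Dw.
  have [c0 xc _] := clock_inv_spec Dw.
  have tw : tau w = (clock_inv alpha (coord (Y y w)) s)%:E by rewrite /tau asboolT.
  rewrite tw /path_val lampertiE//=.
  move: c0 xc; move: (clock_inv _ _ _) => t t0; rewrite coord_Lamperti_path//.
  case E : (X y w t) => [x|] //= _; rewrite Q_fdd//.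
  exact: (state_in hX Iy t0 E).
transitivity (\int[image_law (P y) (measurable_Lamperti_path Iy)]_(p in D)
    Q (path_val (lamperti alpha (coord p)) s) (fdd_cylinder u B))%E.
  apply/esym/integral_image_law => //.
  apply: measurable_funTS; exact: measurableT_comp (Q_kernel mC) mv.
apply: eq_measure_integral => A mA _.
exact/esym/QzE.
Qed.

Local Notation full := (lamperti_full alpha).
Local Notation lamp p := (path_val (lamperti alpha (coord p))).

(** The indicator replaces the exceptional paths by 0, since starting at 0 and the cadlag property
    are required for every sample point, not just almost surely. *)
Definition Levy_of (w : Omega y0) (t : R) : R := \1_full (Y y0 w) * lamp (Y y0 w) t.
Local Notation xi := Levy_of.

Let mE : measurable (Y y0 @^-1` full).
Proof.
apply: measurable_preimage; first exact: measurable_Lamperti_path.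
exact: measurable_lamperti_full.
Qed.

Let PE : P y0 (Y y0 @^-1` full) = 1%E.
Proof.
rewrite -Q0E prE; last exact: measurable_lamperti_full.
by rewrite (pr_lamperti_full Q_start Q_kernel Q_scale Q_Markov).
Qed.

Let xi_in w : full (Y y0 w) -> xi w = lamp (Y y0 w).
Proof.
by move=> Ew; apply/funext => t; rewrite /Levy_of indicE mem_set// mul1r.
Qed.

Let xi_out w : ~ full (Y y0 w) -> xi w = cst 0.
Proof.
by move=> Ew; apply/funext => t; rewrite /Levy_of indicE memNset// mul0r.
Qed.

Let measurable_xi t : 0 <= t -> measurable_fun setT (xi ^~ t).
Proof.
move=> t0; pose F (p : path_space R) := \1_full p * lamp p t.
have mF : measurable_fun setT F.
  apply: measurable_funM; last exact: measurable_lamperti_val.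
  apply: measurable_indic; exact: measurable_lamperti_full.
exact: (measurableT_comp mF (measurable_Lamperti_path Iy0)).
Qed.

Let xi_law (C : set (R -> R)) : measurable [set w | C (xi w)] ->
  measurable [set p : path_space R | C (lamp p)] ->
  P y0 [set w | C (xi w)] = (pr (Q 0) [set p : path_space R | C (lamp p)])%:E.
Proof.
move=> m1 m2; rewrite -prE// Q0E.
have m3 : measurable (Y y0 @^-1` [set p : path_space R | C (lamp p)]).
  by apply: measurable_preimage => //; exact: measurable_Lamperti_path.
have E1 : pr (P y0) (Y y0 @^-1` full) = 1 by rewrite /pr PE.
rewrite !prE// -(pr_full m1 mE E1) -(pr_full m3 mE E1); congr (pr _ _)%:E.
by apply/seteqP; split => w /= [Cw Ew]; split => //; move: Cw; rewrite xi_in.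
Qed.

Let measurable_xi_increment s t (B : set R) : 0 <= s -> 0 <= t -> measurable B ->
  measurable [set w | B (xi w t - xi w s)].
Proof.
move=> s0 t0; apply: measurable_preimage.
exact: (measurable_funB (measurable_xi t0) (measurable_xi s0)).
Qed.

Lemma Levy_of_Levy_process : Levy_process (P y0) xi.
Proof.
split.
- exact: measurable_xi.
- move=> w; have [Ew|Ew] := pselect (full (Y y0 w)); last by rewrite xi_out.
  have [c0 _] := lamperti_fullP Ew.
  by rewrite xi_in// /path_val lamperti0 ?c0//; exact: coordP.
- move=> w t t0; have [Ew|Ew] := pselect (full (Y y0 w)); last first.
    by rewrite xi_out//; exact: cvg_cst.
  have [_ rs] := lamperti_fullP Ew; rewrite xi_in//.
  apply/right_continuous_atP; exact: lamperti_right_continuous (coordP _) rs _ t0.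
- move=> w t t0; have [Ew|Ew] := pselect (full (Y y0 w)); last first.
    by rewrite xi_out//; exact: is_cvg_cst.
  have [_ rs] := lamperti_fullP Ew; rewrite xi_in//.
  have [l Hl] := lamperti_left_limit (coordP (Y y0 w)) rs t0.
  apply: (cvgP l); apply/cvgrPdist_le => e e0; have [h h0 Hh] := Hl e e0.
  near=> u; rewrite distrC; apply: Hh; last by near: u; exact: nbhs_left_lt.
  by near: u; apply: nbhs_left_gt; rewrite ltrBlDr ltrDl.
- move=> s t B s0 t0 mB; have st0 : 0 <= s + t by exact: addr_ge0.
  rewrite (xi_law (C := [set h | B (h (s + t) - h s)])); last 2 first.
  + exact: measurable_xi_increment.
  + exact: measurable_increment.
  rewrite (xi_law (C := [set h | B (h t)])); last 2 first.
  + by apply: measurable_preimage => //; exact: measurable_xi.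
  + by apply: measurable_preimage => //; exact: measurable_lamperti_val.
  by rewrite (pr_stationary Q_start Q_kernel Q_scale Q_Markov s0 t0 mB).
- move=> n t B t0 ht mB; have tge0 i : 0 <= t i by apply: (le_trans t0); exact: ht.
  rewrite (xi_law (C := [set h | forall i : 'I_n, B i (h (t i.+1) - h (t i))])); last 2 first.
  + by apply: measurable_forall_ord => i; exact: measurable_xi_increment.
  + by apply: measurable_forall_ord => i; exact: measurable_increment.
  rewrite /mkset (pr_independent Q_start Q_kernel Q_scale Q_Markov n t0 ht mB).
  rewrite -prodEFin; apply: eq_bigr => i _; apply/esym.
  apply: (xi_law (C := [set h | B i (h (t i.+1) - h (t i))])).
  + exact: measurable_xi_increment.
  + exact: measurable_increment.
Unshelve. all: by end_near. Qed.

Lemma Lamperti_decomposition :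
  [/\ g_well_defined I y0 f,
      exists! x, I x /\ g x = 1,
      Ck_diffeo_to_R k.+1 I g &
      exists2 xi : Omega y0 -> R -> R, Levy_process (P y0) xi &
        {ae P y0, forall w,
          lifetime I (X y0 w) = phi alpha (xi w) +oo%E /\
          forall t, 0 <= t -> (t%:E < phi alpha (xi w) +oo)%E ->
            X y0 w t = Some (ginv (xi w (phi_inv alpha (xi w) t)))}].
Proof.
split; [exact: hg_wd| |exact: hg_diffeo|].
  exists (ginv 1); split; first by split; [exact: hginv_in|exact: hginvK].
  by move=> x [Ix gx]; rewrite -(hgK Ix) gx.
exists xi; first exact: Levy_of_Levy_process.
exists (~` (Y y0 @^-1` full)); split; first exact: measurableC.
  by rewrite probability_setC// PE subee.
apply: subsetC => w Ew /=; rewrite xi_in//.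
have [c0 rs] := lamperti_fullP Ew; have hx := coordP (Y y0 w).
have hw := process_cadlag hX w Iy0.
have alive t : X y0 w t <-> coord (Y y0 w) t.
  by rewrite coord_Lamperti_path//; case: (X y0 w t).
have phiP t : 0 <= t -> (t%:E < phi alpha (lamp (Y y0 w)) +oo)%E <-> X y0 w t.
  by move=> t0; rewrite alive; exact: phi_lamperti_oo.
have lifeP t : 0 <= t -> (t%:E < lifetime I (X y0 w))%E <-> X y0 w t.
  move=> t0; have [H1 H2] := path_lifetime hw t0; rewrite ltNge; split.
    by move=> /negP H; case E : (X y0 w t) => //; exfalso; exact/H/H1.
  by move=> Xt; apply/negP => /H2 E; rewrite E in Xt.
have X0 : X y0 w 0 by rewrite alive c0.
split.
  (* Both quantities exceed a time [t] exactly when the path is alive at [t]. *)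
  apply: ereal_eq_ge0; [exact/ltW/lifeP|exact/ltW/phiP|].
  by move=> t t0; rewrite lifeP// phiP.
move=> t t0 /(phiP _ t0) Xt.
have := lamperti_phi_inv hx rs t0 ((alive t).1 Xt).
have -> : coord (Y y0 w) t = omap g (X y0 w t) by rewrite coord_Lamperti_path.
case E : (X y0 w t) Xt => [r|] // _ [->].
by rewrite hgK//; exact: (state_in hX Iy0 t0 E).
Qed.

End lamperti_representation.

Theorem theorem1p16 (R : realType) (k : nat) (I : set R)
    (d : measure_display) (Omega : R -> measurableType d)
    (P : forall y, probability (Omega y) R)
    (X : forall y, Omega y -> R -> option R)
    (y0 : R) (f : R -> R -> R) (c : R -> R) :
  (1 <= k)%N ->
  open I -> is_interval I ->
  strong_Markov_process I P X ->
  invariance_components I P X y0 f c ->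
  Ck_components k I f c ->
  good_components I y0 f c ->
  assumption1 I P X y0 \/ assumption2 I P X ->
  let g := g_of y0 f in
  let ginv := pinv I g in
  let alpha := - ln (c (ginv 1)) in
  [/\ g_well_defined I y0 f,
      exists! x, I x /\ g x = 1,
      Ck_diffeo_to_R k I g &
      exists2 xi : Omega y0 -> R -> R, Levy_process (P y0) xi &
        {ae P y0, forall w,
          lifetime I (X y0 w) = phi alpha (xi w) +oo%E /\
          forall t, 0 <= t -> (t%:E < phi alpha (xi w) +oo)%E ->
            X y0 w t = Some (ginv (xi w (phi_inv alpha (xi w) t)))}].

Proof.
case: k => // k _ oI iI hX hf hk hg hA g ginv alpha.
exact: (Lamperti_decomposition oI iI hX hf hk hg hA).
Qed.
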